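(* Let $n\ge 7$ and $\emptyset\ne I\subseteq\{2,3,\ldots,n-2\}$. Then: (a) if $I$ contains only odd numbers, then $\mathrm{Cay}(S_n,C(n,I))$ has two connected components and its strictly second largest eigenvalue is attained by $(n-1,1)$ and $(2,1^{n-2})$, with multiplicity $2(n-1)^2$; (b) $\mathrm{Cay}(S_n,C(n,\{2,3\}))$ is connected and its second largest eigenvalue is attained by $(n-1,1)$ and $(1^n)$, with multiplicity $(n-1)^2+1$; (c) if $I$ contains both even and odd numbers and the largest number in $I$ is odd and at least $5$, then $\mathrm{Cay}(S_n,C(n,I))$ is connected and its second largest eigenvalue is attained uniquely by $(1^n)$, with multiplicity $1$; (d) if the largest number in $I$ is even, then $\mathrm{Cay}(S_n,C(n,I))$ is connected and its second largest eigenvalue is attained uniquely by $(n-1,1)$, with multiplicity $(n-1)^2$.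
   Context: For $\emptyset\ne I\subseteq\{2,\ldots,n\}$, $C(n,I)$ is the set of all cycles in $S_n$ whose length lies in $I$, and $\mathrm{Cay}(S_n,C(n,I))$ is the Cayley graph with vertex set $S_n$ and edges $\{g,gs\}$, $s\in C(n,I)$. Eigenvalues are those of the adjacency matrix. The strictly second largest eigenvalue of a regular graph is the largest eigenvalue strictly smaller than its degree (for a connected graph this is the second largest eigenvalue). For a partition $\zeta\vdash n$, let $\chi_\zeta$ be the irreducible character of the Specht module $\rho_\zeta$ and $\tilde\chi_\zeta=\chi_\zeta/\chi_\zeta(\mathbf 1)$ its normalized character; the eigenvalue corresponding to $\zeta$ is $\lambda^I_\zeta=\sum_{\sigma\in C(n,I)}\tilde\chi_\zeta(\sigma)=\sum_{k\in I}\binom nk(k-1)!\,\tilde\chi_\zeta((k,1^{n-k}))$, where $(k,1^{n-k})$ denotes the cycle type of a $k$-cycle. The eigenvalues of the graph are exactly the $\lambda_\zeta^I$, and the multiplicity of $\lambda^I_\zeta$ equals $\sum_{\mu\vdash n,\,\lambda^I_\mu=\lambda^I_\zeta}\chi_\mu(\mathbf 1)^2$. An eigenvalue is ''attained by $\zeta$'' if it equals $\lambda^I_\zeta$. *)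

(* Defs.v *)
From HB Require Import structures.
From mathcomp Require Import all_boot all_order all_algebra.
From mathcomp Require Import all_fingroup all_solvable all_field all_character.

Set Implicit Arguments.
Unset Strict Implicit.
Unset Printing Implicit Defensive.

Import Order.TTheory GRing.Theory Num.Theory.

Local Open Scope ring_scope.

Section Graphs.

Variables (T : finType) (e : rel T).

Definition connected_graph := forall x y : T, connect e x y.

Definition adjacency_mx : 'M[algC]_#|T| :=
  \matrix_(i, j) (e (enum_val i) (enum_val j))%:R.

Definition regular_graph (d : nat) := forall x : T, #|[set y | e x y]| = d.

Definition strictly_second_largest (a : algC) :=
  exists2 d : nat, regular_graph d &
    [/\ eigenvalue adjacency_mx a, a < d%:R &
        forall b, eigenvalue adjacency_mx b -> b < d%:R -> b <= a].

(* The adjacency matrix of an undirected graph is real symmetric, so the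
   geometric and algebraic multiplicities coincide. *)
Definition eig_multiplicity (a : algC) : nat :=
  \rank (eigenspace adjacency_mx a).

End Graphs.

Definition cayley (gT : finGroupType) (S : {set gT}) : rel gT :=
  [rel g h | [exists s in S, (h == (g * s)%g) || (g == (h * s)%g)]].

Definition is_kcycle n (k : nat) (s : 'S_n) : bool :=
  [exists x, (#|porbit s x| == k) && perm_on (porbit s x) s].

Definition cycles n (I : {set 'I_n.+1}) : {set 'S_n} :=
  [set s | [exists k in I, is_kcycle k s]].

Definition is_partn n (z : seq nat) : bool :=
  [&& sorted geq z, 0 \notin z & sumn z == n]%N.

Definition partn n := {z : seq nat | is_partn n z}.

Section Specht.

Variables (n : nat) (z : partn n).

Fact lt_sumn (i : 'I_n) : (i < sumn (val z))%N.
Proof. by have /and3P[_ _ /eqP->] := valP z. Qed.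

(* The cells of the Young diagram are numbered 0, ..., n-1 in reading order
   (left to right, top row first). *)
Definition cell_row (c : 'I_n) : 'I_(size (val z)) :=
  Ordinal (reshape_indexP (lt_sumn c)).

Definition cell_col (c : 'I_n) : nat := reshape_offset (val z) c.

(* A tableau is a permutation t, with entry t c in cell c. Its tabloid (class
   modulo permutations within rows) is encoded by the map sending each entry
   to the row that contains it. *)
Definition rows_of (t : 'S_n) : {ffun 'I_n -> 'I_(size (val z))} :=
  [ffun i => cell_row (t^-1%g i)].

Definition tabloid : finType := {f | f \in codom rows_of}.

Definition tabloid_of (t : 'S_n) : tabloid := Sub (rows_of t) (codom_f _ t).

Fact tabloid_act_subproof (f : tabloid) (s : 'S_n) :
  [ffun i => val f (s^-1%g i)] \in codom rows_of.
Proof.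
have /codomP[t ->] := valP f; apply/codomP; exists (t * s)%g.
by apply/ffunP=> i; rewrite !ffunE invMg permM.
Qed.

Definition tabloid_act (f : tabloid) (s : 'S_n) : tabloid :=
  Sub [ffun i => val f (s^-1%g i)] (tabloid_act_subproof f s).

Definition tabloid_mx (s : 'S_n) : 'M[algC]_#|tabloid| :=
  \matrix_(i, j) (tabloid_act (enum_val i) s == enum_val j)%:R.

Fact tabloid_mx_repr : mx_repr [set: 'S_n] tabloid_mx.
Proof.
split=> [|x y _ _]; apply/matrixP=> i j; rewrite !mxE.
  congr (_%:R); rewrite -(inj_eq enum_val_inj); congr (nat_of_bool (_ == _)).
  by apply/val_inj/ffunP=> k; rewrite ffunE invg1 perm1.
rewrite (bigD1 (enum_rank (tabloid_act (enum_val i) x))) //= !mxE enum_rankK.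
rewrite eqxx mul1r big1 ?addr0 => [|k /negPf nk].
  congr (nat_of_bool (_ == _))%:R; apply/val_inj/ffunP=> k.
  by rewrite !ffunE invMg permM.
by rewrite !mxE -(inj_eq enum_rank_inj) enum_valK eq_sym nk mul0r.
Qed.

(* The permutation module M^z on tabloids. *)
Definition tabloid_repr : mx_representation algC [set: 'S_n]%G #|tabloid| :=
  MxRepresentation tabloid_mx_repr.

Definition col_stab (t : 'S_n) : {set 'S_n} :=
  [set s : 'S_n | [forall i : 'I_n, cell_col (t^-1%g (s i)) == cell_col (t^-1%g i)]].

Definition polytabloid (t : 'S_n) : 'rV[algC]_#|tabloid| :=
  \sum_(s in col_stab t)
     (-1) ^+ s *: delta_mx 0 (enum_rank (tabloid_act (tabloid_of t) s)).

Fact polytabloidM t s : polytabloid t *m tabloid_repr s = polytabloid (t * s)%g.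
Proof.
have actM f x y : tabloid_act (tabloid_act f x) y = tabloid_act f (x * y)%g.
  by apply/val_inj/ffunP=> k; rewrite !ffunE invMg permM.
have ofM x y : tabloid_of (x * y) = tabloid_act (tabloid_of x) y.
  by apply/val_inj/ffunP=> k; rewrite !ffunE invMg permM.
have rowM f : delta_mx 0 (enum_rank f) *m tabloid_mx s
            = delta_mx 0 (enum_rank (tabloid_act f s)) :> 'rV_#|tabloid|.
  rewrite -rowE; apply/rowP=> j; rewrite !mxE enum_rankK eqxx /=.
  by rewrite -(inj_eq enum_rank_inj) enum_valK eq_sym.
rewrite mulmx_suml /polytabloid [RHS](reindex_inj (conjg_inj s)) /=.
apply: eq_big => [u|u _].
  rewrite !inE; apply/forallP/forallP=> h i.
    by have := h (s^-1%g i); rewrite invMg !permM !permK.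
  by have := h (s i); rewrite invMg !permM !permK.
by rewrite -scalemxAl rowM odd_permJ ofM !actM conjgE !mulgA mulgV mul1g.
Qed.

(* The Specht module is the span of all polytabloids, i.e. the submodule of
   M^z generated by any one of them (see specht_span). *)
Definition specht_repr :=
  submod_repr (cyclic_mx_module tabloid_repr (polytabloid 1%g)).

Fact specht_span :
  (cyclic_mx tabloid_repr (polytabloid 1%g)
     :=: \sum_(t : 'S_n) <<polytabloid t>>)%MS.
Proof.
apply/eqmxP/andP; split.
  apply: cyclic_mx_sub; last first.
    by apply: (sumsmx_sup 1%g) => //; rewrite genmxE.
  apply/mxmoduleP=> s _; rewrite sumsmxMr; apply/sumsmx_subP=> t _.
  rewrite (eqmxMr _ (genmxE _)) polytabloidM.
  by apply: (sumsmx_sup (t * s)%g) => //; rewrite genmxE.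
apply/sumsmx_subP=> t _; rewrite genmxE -[t]mul1g -polytabloidM.
by apply: mxmodule_trans (cyclic_mx_module _ _) (in_setT _) (cyclic_mx_id _ _).
Qed.

Definition specht_char : 'CF([set: 'S_n]%G) := cfRepr specht_repr.

Definition eig_of (I : {set 'I_n.+1}) : algC :=
  \sum_(s in cycles I) specht_char s / specht_char 1%g.

End Specht.

Definition attained_by n (I : {set 'I_n.+1}) (a : algC) (z : seq nat) :=
  exists2 zeta : partn n, val zeta = z & eig_of zeta I = a.

Definition attained_uniquely_by n (I : {set 'I_n.+1}) (a : algC) (z : seq nat) :=
  attained_by I a z /\ forall zeta : partn n, eig_of zeta I = a -> val zeta = z.

(* Main.v *)
From HB Require Import structures.
From mathcomp Require Import all_boot all_order all_algebra.
From mathcomp Require Import all_fingroup all_solvable all_field all_character.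
From mathcomp Require Import zify ring.
(* Imported last so that [partn] is the type of partitions, not the pi-part of prime.v. *)
Require Import Defs.

(* The eigenvalues are lambda_chi = sum over s of chi(s)/chi(1), chi ranging over
   the irreducible characters of S_n. Write sgn for the sign, std for the
   standard character (fixed points minus one). The crux is the estimate
     (n-1) |chi(c)| < (n-k-1) chi(1)     for a k-cycle c, 2 <= k <= n-2,
   valid for n >= 7 and every chi outside {1, sgn, std, sgn*std}. It says that
   |lambda_chi| < lambda_std, so only the four exceptional characters matter,
   and those are compared through the numbers n(n-1)...(n-k+1)/k of k-cycles.

   The estimate is proved without the Murnaghan-Nakayama rule, by induction on
   n: if c fixes a point, chi(c)/chi(1) is an average of the ratios of the
   constituents of the restriction of chi to S_(n-1), which reduces everything
   to k = n-2 (and to n = 5). The characters of the hooks, the exterior powers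
   of std, already account for the whole column norm m of an m-cycle of S_m;
   hence all other irreducible characters vanish there, and restricting twice
   bounds chi on (n-2)-cycles. Only equality at n = 7 needs a special argument.

   Specht modules are irreducible by James's argument. They are recognised by
   their having a vector fixed by the row stabilizer and a vector on which the
   column stabilizer acts by the sign: Frobenius reciprocity with S_(n-1) then
   singles out std, sgn and sgn*std. *)

Set Implicit Arguments.
Unset Strict Implicit.
Unset Printing Implicit Defensive.

Import Order.TTheory GRing.Theory Num.Theory.

(* [Sym] alone denotes the full symmetric group of a type, from alt.v. *)
Notation SymOn := (@perm.Sym _).
Notation SymOn_group := (@perm.Sym_group _).

(** * Cycles in symmetric groups *)

Section Cycles.

Variable T : finType.
Implicit Types (s t g : {perm T}) (D : {set T}).

(** The constants of the estimate are those of std, which has the value n-k-1 on a k-cycle and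
    degree n-1. They suit an induction because (n-k-2)/(n-2) < (n-k-1)/(n-1): a weak bound on
    S_(n-1) already gives a strict one on S_n. The weak form has to include std and its sign twist,
    which do occur in restrictions of other characters; the linear characters, for which it fails,
    occur only in restrictions of the four exceptions. For k = n-2 the bound on S_(n-1) would say
    that chi vanishes, so another source is needed: the remaining hooks of S_(n-2) have values 1 or
    -1 on an (n-2)-cycle and degrees at least C(n-3, 2), to be compared with n-1. Both numbers are 6
    for n = 7, whence the special argument there. All symmetric groups are subgroups [SymOn D] of
    one permutation group: a point stabilizer is [SymOn (D :\ x)], with the same elements, and
    restriction involves no embedding. *)

Definition kcycle (k : nat) (s : {perm T}) : bool :=
  [exists x, (#|porbit s x| == k) && perm_on (porbit s x) s].

Lemma perm_of_lists (l1 l2 : seq T) : uniq l1 -> perm_eq l1 l2 ->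
  exists2 g : {perm T}, g \in SymOn [set x in l1] & map g l1 = l2.
Proof.
move=> Ul1 eql; have Ul2: uniq l2 by rewrite -(perm_uniq eql).
have sz := perm_size eql; have eqm := perm_mem eql.
pose f x := if x \in l1 then nth x l2 (index x l1) else x.
have fl x : (f x \in l1) = (x \in l1).
  rewrite /f; case: ifP => [l1x|-> //].
  by rewrite eqm mem_nth // -sz index_mem.
have f_inj : injective f.
  move=> x y eqf; have := fl x; rewrite eqf fl; move: eqf; rewrite /f.
  case: ifP => l1x; case: ifP => l1y //= eqf _.
  have ix : index x l1 < size l2 by rewrite -sz index_mem.
  have iy : index y l1 < size l2 by rewrite -sz index_mem.
  move/eqP: eqf; rewrite (set_nth_default x y iy) nth_uniq // => /eqP eqi.
  by rewrite -(nth_index x l1x) eqi nth_index.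
exists (perm f_inj).
  rewrite inE; apply/subsetP=> x; rewrite !inE permE /f; case: ifP => //.
  by rewrite eqxx.
case: l1 Ul1 eql sz eqm @f fl f_inj => [|x0 l1'] Ul1 eql sz eqm f fl f_inj.
  by move: sz => /esym/size0nil->.
apply: (@eq_from_nth _ x0); rewrite size_map // => i lti.
rewrite (nth_map x0) // permE /f mem_nth // index_uniq //.
by apply: set_nth_default; rewrite -sz.
Qed.

(** The common source of transitivity below: a subset, a pair of subsets or a placement of entries
    in rows and columns is a colouring of D, and two colourings with classes of equal sizes differ
    by a permutation of D. *)
Lemma recolour_perm D (R : eqType) (u v : T -> R) :
  (forall r, #|[set x in D | u x == r]| = #|[set x in D | v x == r]|) ->
  exists2 g : {perm T}, g \in SymOn D & {in D, forall x, v (g x) = u x}.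
Proof.
move=> cuv; have cnt w r : #|[set x in D | w x == r]| = count_mem r (map w (enum D)).
  rewrite count_map cardE -size_filter; apply: perm_size.
  apply: uniq_perm; rewrite ?filter_uniq -?enumT ?enum_uniq // => x.
  by rewrite mem_enum mem_filter mem_enum !inE andbC.
have puv : perm_eq (map u (enum D)) (map v (enum D)).
  by apply/allP => r _ /=; rewrite -!cnt cuv eqxx.
case: (set_0Vmem D) => [->|[x0 x0D]].
  by exists 1%g => [|x]; rewrite ?group1 // inE.
have [Is pIs eqs] := perm_iotaP (v x0) puv.
have sIs i : i \in Is -> i < size (enum D).
  by rewrite (perm_mem pIs) mem_iota size_map add0n.
have [||g gS eqg] := @perm_of_lists (enum D) (map (nth x0 (enum D)) Is).
- exact: enum_uniq.
- rewrite perm_sym -{2}[enum D](mkseq_nth x0) /mkseq; apply: perm_map.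
  by rewrite size_map in pIs.
exists g; first by move: gS; rewrite set_enum.
move=> x xD; have xE : x \in enum D by rewrite mem_enum.
have ix : index x (enum D) < size (enum D) by rewrite index_mem.
have szI : size Is = size (enum D) by rewrite (perm_size pIs) size_iota size_map.
have e1 : g x = nth x0 (map g (enum D)) (index x (enum D)).
  by rewrite (nth_map x0) // nth_index.
have e2 : u x = nth (v x0) (map u (enum D)) (index x (enum D)).
  by rewrite (nth_map x0) // nth_index.
rewrite e1 e2 eqg eqs !(nth_map 0) ?szI // (nth_map x0) //.
by rewrite sIs // mem_nth // szI.
Qed.

(** The bound on k excludes the identity, a 1-cycle whose orbit consists of a fixed point. *)
Lemma kcycleP k s : 1 < k -> kcycle k s ->
  exists x, #|porbit s x| = k /\ forall y, (s y == y) = (y \notin porbit s x).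
Proof.
move=> k_gt1 /existsP[x /andP[/eqP cx /subsetP sx]]; exists x; split=> // y.
apply/idP/idP=> [/eqP fy|]; last first.
  by apply: contraR => /sx.
apply/negP => yO; have /porbitP[i xy] : x \in porbit s y by rewrite porbit_sym.
have exy : x = y by rewrite xy permX_fix.
move: k_gt1; rewrite -cx exy.
rewrite (_ : porbit s y = [set y]) ?cards1 //.
apply/setP=> z; rewrite inE; apply/porbitP/eqP => [[j ->]|->].
  by rewrite permX_fix.
by exists 0; rewrite expg0 perm1.
Qed.

Lemma porbit_Sym s x D : 1 < #|porbit s x| -> s \in SymOn D ->
  (forall y, (s y == y) = (y \notin porbit s x)) -> porbit s x \subset D.
Proof.
move=> _ sD fx; apply/subsetP => y yO; apply: contraTT yO => yD.
by rewrite -fx (out_perm _ yD) //; move: sD; rewrite inE.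
Qed.

Lemma kcycle_le k s D : 1 < k -> kcycle k s -> s \in SymOn D -> k <= #|D|.
Proof.
move=> k1 ks sD; have [x [cx fx]] := kcycleP k1 ks.
by rewrite -cx subset_leq_card // porbit_Sym ?cx.
Qed.

Lemma card_fix_kcycle k s D : 1 < k -> kcycle k s -> s \in SymOn D ->
  #|[set x in D | s x == x]| = #|D| - k.
Proof.
move=> k1 ks sD; have [x [cx fx]] := kcycleP k1 ks.
rewrite -cx -cardsDS ?porbit_Sym ?cx //; apply: eq_card => y.
by rewrite !inE fx andbC.
Qed.

Lemma kcycle_avoid k s D : 1 < k -> kcycle k s -> s \in SymOn D -> k < #|D| ->
  exists2 x, x \in D & s \in SymOn (D :\ x).
Proof.
move=> k1 ks sD kD; have := card_fix_kcycle k1 ks sD.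
have [->|[x]] := set_0Vmem [set x in D | s x == x].
  by rewrite cards0; lia.
rewrite inE => /andP[xD fx] _; exists x => //; rewrite inE.
apply/subsetP => y /[!inE] sy; apply/andP; split.
  by apply: contraNneq sy => ->.
by apply: contraR sy => yD; rewrite (out_perm _ yD) //; move: sD; rewrite inE.
Qed.

(** The characters [hook D 2] and [pairc D] come from exterior and symmetric squares, whose values
    involve the fixed points of the square of g. *)
Lemma card_fix_kcycle_sqr k s D : 2 < k -> kcycle k s -> s \in SymOn D ->
  #|[set x in D | (s * s)%g x == x]| = #|D| - k.
Proof.
move=> k2 ks sD; have k1: 1 < k by lia.
rewrite -(card_fix_kcycle k1 ks sD); apply: eq_card => y; rewrite !inE.
congr (_ && _); have [x [cx fx]] := kcycleP k1 ks.
apply/idP/idP=> [|/eqP fy]; last by rewrite permM !fy.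
rewrite fx; apply: contraL => yO; have cy : #|porbit s y| = k.
  by rewrite -cx; congr #|pred_of_set _|; apply/eqP; rewrite eq_porbit_mem.
have := uniq_traject_porbit s y; rewrite cy -(subnKC k2) /= !inE !negb_or permM.
by case/and3P=> /and3P[_ n2 _] _ _; rewrite eq_sym.
Qed.

Lemma kcycle2_sqr s : kcycle 2 s -> (s * s = 1)%g.
Proof.
move=> ks; have [x [cx fx]] := kcycleP (ltnSn 1) ks.
apply/permP=> y; rewrite permM perm1; have := fx y.
case: (boolP (y \in _)) => [yO _|_ /eqP fy]; last by rewrite !fy.
have cy : #|porbit s y| = 2.
  by rewrite -cx; congr #|pred_of_set _|; apply/eqP; rewrite eq_porbit_mem.
by have := iter_porbit s y; rewrite cy.
Qed.

Lemma kcycle_tperm x y : x != y -> kcycle 2 (tperm x y).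
Proof.
move=> nxy; apply/existsP; exists x.
have -> : porbit (tperm x y) x = [set x; y].
  apply/setP=> z; rewrite !inE; apply/porbitP/orP => [[i ->]|].
    elim: i => [|i]; first by rewrite expg0 perm1 eqxx; left.
    by rewrite expgSr permM => -[]/eqP->; rewrite ?tpermL ?tpermR eqxx; [right|left].
  case=> /eqP->; first by exists 0; rewrite expg0 perm1.
  by exists 1; rewrite expg1 tpermL.
by rewrite cards2 nxy eqxx tperm_on.
Qed.

Lemma kcycle_conj k s t D : 1 < k -> kcycle k s -> kcycle k t ->
  s \in SymOn D -> t \in SymOn D -> exists2 g, g \in SymOn D & t = (s ^ g)%g.
Proof.
move=> k1 ks kt sD tD.
have [x [cx fx]] := kcycleP k1 ks; have [y [cy fy]] := kcycleP k1 kt.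
have Ox : porbit s x \subset D by rewrite porbit_Sym ?cx.
have Oy : porbit t y \subset D by rewrite porbit_Sym ?cy.
(* [L r z] writes the cycle in order from z, then the other points of D; the map between two such
   lists that preserves positions is the conjugating permutation. *)
pose L (r : {perm T}) z := traject r z k ++ enum (D :\: porbit r z).
have tr r z w : #|porbit r z| = k -> (w \in traject r z k) = (w \in porbit r z).
  by move=> <-; rewrite porbit_traject.
have LD r z : #|porbit r z| = k -> porbit r z \subset D -> L r z =i D.
  move=> ck rD w; rewrite mem_cat mem_enum tr // inE.
  by case: (boolP (w \in porbit r z)) => // /(subsetP rD).
have UL r z : #|porbit r z| = k -> uniq (L r z).
  move=> ck; rewrite cat_uniq enum_uniq andbT -{1}ck uniq_traject_porbit /=.
  by apply/hasPn => w; rewrite mem_enum inE tr // => /andP[].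
have [||g gS eqg] := @perm_of_lists (L s x) (L t y); first exact: UL.
  by apply: uniq_perm => [||w]; rewrite ?UL // !LD.
have gD : g \in SymOn D.
  by move: gS; rewrite (_ : [set w in _] = D) //; apply/setP=> w; rewrite inE LD.
exists g => //; have := eqg; rewrite map_cat => /eqP.
rewrite eqseq_cat ?size_map ?size_traject // => /andP[/eqP eq1 /eqP eq2].
have gi i : i < k -> g (iter i s x) = iter i t y.
  move=> ik; rewrite -(nth_traject t ik) -eq1 (nth_map x) ?size_traject //.
  by rewrite nth_traject.
apply/permP=> w; rewrite -[w](permKV g) permJ; move: (_ w) => {}w.
case: (boolP (w \in porbit s x)) => [|wO]; last first.
  have /eqP-> : s w == w by rewrite fx.
  apply/eqP; rewrite fy; case: (boolP (w \in D)) => wD; last first.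
    rewrite (out_perm _ wD); last by rewrite inE in gD.
    by apply: contra wD; apply: subsetP Oy _.
  have : g w \in map g (enum (D :\: porbit s x)).
    by rewrite map_f // mem_enum inE wO.
  by rewrite eq2 mem_enum inE => /andP[].
rewrite -tr // => /trajectP[i ik ->].
(* Only the last index wraps around: its successor is the starting point. *)
rewrite gi // -!iterS; move: ik; rewrite leq_eqVlt => /orP[/eqP ik|ik]; last by rewrite gi.
have k0 : 0 < k by lia.
have -> : iter i.+1 t y = y by rewrite ik -cy iter_porbit.
have -> : iter i.+1 s x = x by rewrite ik -cx iter_porbit.
exact: esym (gi 0 k0).
Qed.

Lemma kcycleJ k s g : kcycle k (s ^ g)%g = kcycle k s.
Proof.
have aux r h : kcycle k r -> kcycle k (r ^ h)%g.
  case/existsP=> x /andP[/eqP cx ox]; apply/existsP; exists (h x).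
  have -> : porbit (r ^ h)%g (h x) = h @: porbit r x.
    apply/setP=> z; apply/porbitP/imsetP=> [[i ->]|[w /porbitP[i ->] ->]].
      by exists ((r ^+ i)%g x); rewrite ?mem_porbit // -conjXg permJ.
    by exists i; rewrite -conjXg permJ.
  rewrite card_imset ?cx ?eqxx //=; last exact: perm_inj.
  apply/subsetP=> z; rewrite inE -[z](permKV h) permJ (inj_eq perm_inj) => nz.
  by rewrite imset_f // (subsetP ox).
by apply/idP/idP=> [/(aux _ g^-1%g)|/aux//]; rewrite -conjgM mulgV conjg1.
Qed.

Lemma kcycleV k s : kcycle k s^-1%g = kcycle k s.
Proof.
apply: eq_existsb => x; rewrite porbitV; congr (_ && _).
by apply/idP/idP=> /perm_onV; rewrite ?invgK.
Qed.

Lemma kcycle_inj k l s : 1 < k -> 1 < l -> kcycle k s -> kcycle l s -> k = l.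
Proof.
move=> k1 l1 ks ls; have sT : s \in SymOn [set: T] by rewrite inE; apply/subsetP.
have := card_fix_kcycle k1 ks sT; have := card_fix_kcycle l1 ls sT.
have := kcycle_le k1 ks sT; have := kcycle_le l1 ls sT; lia.
Qed.

Lemma kcycle_exists k D : 0 < k <= #|D| -> exists2 s, s \in SymOn D & kcycle k s.
Proof.
case/andP=> k0 kD; pose p := take k (enum D).
have Up : uniq p by rewrite take_uniq ?enum_uniq.
have sp : size p = k by rewrite size_takel // -cardE.
pose s := perm (can_inj (prev_next Up)).
have [x0 p0] : exists x0, x0 \in p.
  case: (p) sp => [|x q] spk; first by move: k0; rewrite -spk.
  by exists x; rewrite mem_head.
exists s.
  rewrite inE; apply/subsetP=> x; rewrite inE permE; apply: contraR => xD.
  rewrite next_nth ifN //; apply: contra xD => /mem_take; by rewrite mem_enum.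
have nx i : i < k -> nth x0 p (i.+1 %% k) = s (nth x0 p i).
  move=> ik; rewrite permE next_nth mem_nth ?sp // index_uniq ?sp //.
  case E: (p) sp => [|y q] //= sq; first by lia.
  have [lti|] := ltnP i.+1 k; first by rewrite modn_small //=; apply: set_nth_default; lia.
  move=> le; have eqk : i.+1 = k by lia.
  by rewrite eqk modnn /= nth_default // -ltnS sq eqk.
have it i : (s ^+ i)%g (nth x0 p 0) = nth x0 p (i %% k).
  elim: i => [|i IH]; first by rewrite expg0 perm1 mod0n.
  rewrite expgSr permM IH -nx ?ltn_pmod //; congr nth.
  by rewrite -addn1 modnDml addn1.
have eqO : porbit s (nth x0 p 0) =i p.
  move=> y; apply/porbitP/idP => [[i ->]|yp].
    by rewrite it mem_nth // sp ltn_pmod.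
  exists (index y p); rewrite it modn_small ?nth_index // -sp index_mem //.
apply/existsP; exists (nth x0 p 0); rewrite (eq_card eqO) (card_uniqP Up) sp eqxx /=.
apply/subsetP=> x; rewrite eqO inE permE; apply: contraR => xp.
by rewrite next_nth ifN.
Qed.

Lemma order_kcycle k s : 1 < k -> kcycle k s -> #[s]%g = k.
Proof.
move=> k1 ks; have [x [cx fx]] := kcycleP k1 ks.
have sk : (s ^+ k = 1)%g.
  apply/permP=> y; rewrite perm1; case: (boolP (y \in porbit s x)) => yO; last first.
    by rewrite permX_fix //; apply/eqP; rewrite fx.
  have cy : #|porbit s y| = k.
    by rewrite -cx; congr #|pred_of_set _|; apply/eqP; rewrite eq_porbit_mem.
  by rewrite permX -cy iter_porbit.
have le : k <= #[s]%g by rewrite -cx porbit.unlock; apply: leq_imset_card.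
have dv : #[s]%g %| k by rewrite order_dvdn sk.
by apply/eqP; rewrite eqn_leq le dvdn_leq //; lia.
Qed.

(** A generator of the cyclic group of s has the same orbits as s. *)
Lemma kcycleX k s i : 1 < k -> kcycle k s -> coprime k i -> kcycle k (s ^+ i)%g.
Proof.
move=> k1 ks; rewrite -(order_kcycle k1 ks) -generator_coprime => /eqP gen.
rewrite (order_kcycle k1 ks); case/existsP: ks => x /andP[cx ox].
apply/existsP; exists x.
have -> : porbit (s ^+ i)%g x = porbit s x by rewrite !porbit.unlock -gen.
rewrite cx /=; have := ox; rewrite -![perm_on _ _]/(_ \subset _).
have sS : s \in SymOn (porbit s x) by rewrite inE.
by move=> _; have := groupX i sS; rewrite inE.
Qed.

(** The centralizer is [<[s]>] times the symmetric group of the points of D off the orbit: an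
    element commuting with s is determined on the orbit by the image of x, which some power of s
    shares. *)
Lemma card_cent_kcycle k s D : 1 < k -> kcycle k s -> s \in SymOn D ->
  #|'C_(SymOn D)[s]%g| = (k * (#|D| - k)`!)%N.
Proof.
move=> k1 ks sD; have [x [cx fx]] := kcycleP k1 ks.
set O := porbit s x in cx fx.
have OD : O \subset D by rewrite porbit_Sym // cx.
have fixO (g : {perm T}) : commute g s -> g x = x -> {in O, forall y, g y = y}.
  move=> cgs gx y /porbitP[i ->].
  by rewrite -permM -(commuteX i cgs) permM gx.
have comm_out (g : {perm T}) : g \in SymOn (D :\: O) -> commute g s.
  rewrite inE => gDO; apply: (perm_onC (S1 := D :\: O) (S2 := O)) => //.
    by apply/subsetP=> y; rewrite inE fx negbK.
  by rewrite -setI_eq0; apply/eqP/setP=> y; rewrite !inE; case: (y \in O); rewrite ?andbF.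
have eqC : 'C_(SymOn D)[s]%g = (<[s]> * SymOn (D :\: O))%g.
  apply/setP=> g; apply/idP/mulsgP => [|[_ h /cycleP[i ->] hDO ->]]; last first.
    rewrite inE groupM ?groupX //=; last first.
      by move: hDO; rewrite !inE => /subset_trans; apply; apply: subsetDl.
    by rewrite groupM ?groupX ?cent1id //; apply/cent1P; apply: comm_out.
  rewrite inE => /andP[gD /cent1P cgs].
  have: g x \in O.
    have: s (g x) != g x.
      rewrite -permM cgs permM (inj_eq perm_inj) fx negbK; exact: porbit_id.
    by rewrite fx negbK.
  case/porbitP=> i gx; exists (s ^+ i)%g (s ^- i * g)%g; rewrite ?mem_cycle ?mulKVg //.
  have hD : (s ^- i * g)%g \in SymOn D by rewrite groupM ?groupV ?groupX.
  rewrite inE; apply/subsetP=> y; rewrite !inE => hy.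
  rewrite (contra _ hy); last first.
    move=> yO; apply/eqP; apply: fixO yO.
      apply: commute_sym; apply: commuteM; last exact: commute_sym.
      by apply: commuteV; apply: commuteX.
    have -> : (s ^- i * g = g * s ^- i)%g.
      by apply: commute_sym; apply: commuteV; apply: commuteX.
    by rewrite permM gx permK.
  by apply: contraR hy => yD; rewrite (out_perm _ yD) //; move: hD; rewrite inE.
rewrite eqC TI_cardMg.
  by rewrite -orderE (order_kcycle k1 ks) perm.card_Sym cardsDS // cx.
apply/trivgP/subsetP=> g; rewrite inE => /andP[/cycleP[i ->]] iDO.
rewrite inE; apply/eqP/permP=> y; rewrite perm1.
case: (boolP (y \in O)) => yO; last by rewrite permX_fix //; apply/eqP; rewrite fx.
by rewrite inE in iDO; apply: (out_perm iDO); rewrite inE yO.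
Qed.

Lemma odd_kcycle k s : 1 < k -> kcycle k s -> odd_perm s = ~~ odd k.
Proof.
move=> k1 ks; have [x [cx fx]] := kcycleP k1 ks.
have kT : k <= #|T|.
  have sT : s \in SymOn [set: T] by rewrite inE; apply/subsetP.
  by rewrite -cardsT; apply: kcycle_le ks sT.
have p1 y : y \notin porbit s x -> porbit s y = [set y].
  rewrite -fx => /eqP fy; apply/setP=> z; rewrite inE.
  apply/porbitP/eqP => [[j ->]|->]; first by rewrite permX_fix.
  by exists 0; rewrite expg0 perm1.
have -> : odd_perm s = odd #|T| (+) odd #|porbits s| by [].
have -> : porbits s = porbit s x |: [set [set y] | y in ~: porbit s x].
  apply/setP=> B; rewrite !inE; apply/imsetP/orP => [[y _ ->]|[/eqP->|/imsetP[y]]].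
  - case: (boolP (y \in porbit s x)) => yO.
      by left; rewrite eq_porbit_mem.
    by right; rewrite p1 // imset_f // inE.
  - by exists x.
  - by rewrite inE => yO ->; exists y => //; rewrite p1.
rewrite cardsU1 card_imset; last exact: set1_inj.
rewrite (_ : _ \notin _); last first.
  apply/imsetP=> -[y _ eqy]; move: k1; by rewrite -cx eqy cards1.
by rewrite cardsCs setCK cx oddD oddB //=; case: (odd #|T|); case: (odd k).
Qed.

End Cycles.

Local Open Scope ring_scope.

(** * Characters on subsets and their exterior twists *)

Section OrbitSums.

Variables (gT : finGroupType) (G : {group gT}) (R : finType).
Variables (act : R -> gT -> R) (S : {set R}).
Hypothesis actM : forall r g h, act r (g * h)%g = act (act r g) h.
Hypothesis act1 : forall r, act r 1%g = r.
Hypothesis act_trans : {in S &, forall r r', exists2 g, g \in G & r' = act r g}.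
Hypothesis act_stable : {in S & G, forall r g, act r g \in S}.

Let stab r := [set g in G | act r g == r].

Lemma sum_orbit (V : nmodType) (F : R -> V) r0 : r0 \in S ->
  \sum_(g in G) F (act r0 g) = (\sum_(r in S) F r) *+ #|stab r0|.
Proof.
move=> Sr0; rewrite (partition_big (act r0) (mem S)) /=; last first.
  by move=> g gG; apply: act_stable.
rewrite -sumrMnl; apply: eq_bigr => r Sr; have [h hG ->] := act_trans Sr0 Sr.
rewrite (eq_bigr (fun=> F (act r0 h))) => [|g /andP[_ /eqP->] //].
rewrite sumr_const; congr (_ *+ _).
rewrite -(card_rcoset _ h); apply: eq_card => g; rewrite mem_rcoset !inE.
rewrite groupMr ?groupV //= actM -(inj_eq (can_inj (_ : cancel (act^~ h) (act^~ h^-1)%g))).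
  by rewrite -(actM _ h^-1%g) mulVg act1.
by move=> r'; rewrite -actM mulgV act1.
Qed.

(** All stabilizers on a transitive set have order |G|/|S|. In an inner product of induced
    characters this makes an orbit count for 1. *)
Lemma sum_stab_orbit r0 : r0 \in S -> (\sum_(r in S) #|stab r| = #|G|)%N.
Proof.
move=> Sr0; have card_orbit r : r \in S -> (#|S| * #|stab r| = #|G|)%N.
  move=> Sr; have := sum_orbit (fun=> 1 : int) Sr.
  by rewrite !sumr_const -mulrnA => /eqP; rewrite eqr_nat => /eqP.
have S0 : (0 < #|S|)%N by apply/card_gt0P; exists r0.
apply/eqP; rewrite -(eqn_pmul2l S0) big_distrr /= -sum_nat_const.
by apply/eqP; apply: eq_bigr => r /card_orbit.
Qed.

End OrbitSums.

Lemma exists_subset_card (T : finType) (A : {set T}) k : (k <= #|A|)%N ->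
  exists2 B : {set T}, B \subset A & #|B| = k.
Proof.
move=> kA; have := cards_draws A k.
case: (set_0Vmem [set B : {set T} | B \subset A & #|B| == k]) => [->|[B]].
  by rewrite cards0 => /esym/eqP; rewrite -leqn0 leqNgt bin_gt0 kA.
by rewrite inE => /andP[sB /eqP cB] _; exists B.
Qed.

Section SetCharacters.

Variable T : finType.
Implicit Types (g h y : {perm T}) (A B D : {set T}).

Definition stabs B g := [forall x, (g x \in B) == (x \in B)].

Lemma stabsP B g : reflect (forall x, (g x \in B) = (x \in B)) (stabs B g).
Proof. exact: 'forall_eqP. Qed.

Lemma stabsE B g : stabs B g = (g \in 'N(B | 'P)%g).
Proof. by apply/stabsP/astabsP. Qed.

Lemma stabs_im B g : stabs B g = (g @: B == B).
Proof.
apply/stabsP/eqP => [sB|eqB x].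
  apply/eqP; rewrite eqEcard card_imset ?leqnn ?andbT; last exact: perm_inj.
  by apply/subsetP=> _ /imsetP[x xB ->]; rewrite sB.
by rewrite -{1}eqB mem_imset //; apply: perm_inj.
Qed.

(** The diagonal coefficient of g at the basis vector of B: in the permutation module on subsets if
    [b] is false, in an exterior power of the natural module if [b] is true. *)
Definition wt (b : bool) B g : algC :=
  if stabs B g then (-1) ^+ (b && restr_perm B g) else 0.

Lemma stabsJ B g y : stabs (y @: B) (g ^ y) = stabs B g.
Proof.
apply/stabsP/stabsP => sB x.
  by have := sB (y x); rewrite permJ !(mem_imset _ _ perm_inj).
by rewrite -(permKV y x) permJ !(mem_imset _ _ perm_inj).
Qed.

Lemma wtJ b B g y : wt b (y @: B) (g ^ y) = wt b B g.
Proof.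
rewrite /wt stabsJ; case: ifP => // sB; congr (_ ^+ (_ && _)).
rewrite (_ : restr_perm _ _ = (restr_perm B g) ^ y)%g ?odd_permJ //.
apply/permP=> x; rewrite -(permKV y x) permJ; move: (_ x) => {}x.
case: (boolP (x \in B)) => xB.
  by rewrite !restr_permE -?stabsE ?stabsJ // ?permJ // mem_imset //; apply: perm_inj.
rewrite !(out_perm (restr_perm_on _ _)) // mem_imset //; exact: perm_inj.
Qed.

Lemma wtM b B g h : stabs B g -> wt b B (g * h) = wt b B g * wt b B h.
Proof.
move=> sg; rewrite /wt sg; have -> : stabs B (g * h) = stabs B h.
  by rewrite !stabsE in sg *; rewrite groupMl.
case: ifP => sh; last by rewrite mulr0.
rewrite morphM -?stabsE // odd_permM; case: b => //=; last by rewrite mulr1.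
by rewrite signr_addb.
Qed.

Lemma wt_conj b B g : (wt b B g)^* = wt b B g.
Proof. by rewrite /wt; case: ifP => _; rewrite ?conjC0 // rmorph_sign. Qed.

Lemma wt1 b B : wt b B 1 = 1.
Proof.
have s1 : stabs B 1 by apply/stabsP => x; rewrite perm1.
by rewrite /wt s1 morph1 odd_perm1 andbF.
Qed.

Definition set_stab D B : {set {perm T}} := [set g in SymOn D | stabs B g].

Lemma set_stab_group_set D B : group_set (set_stab D B).
Proof.
rewrite (_ : set_stab D B = (SymOn D :&: 'N(B | 'P))%g) ?groupP //.
by apply/setP=> g; rewrite [LHS]inE stabsE [RHS]inE.
Qed.
Canonical set_stab_group D B := Group (set_stab_group_set D B).

Fact wt_mx_repr D b B :
  mx_repr (set_stab D B) (fun g => (wt b B g)%:M : 'M[algC]_1).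
Proof.
split=> [|g h]; first by rewrite wt1.
by rewrite inE => /andP[_ sg] _; rewrite wtM // scalar_mxM.
Qed.

Definition wt_cf D b B : 'CF(set_stab D B) :=
  cfRepr (MxRepresentation (wt_mx_repr D b B)).

Lemma wt_cfE D b B g : g \in SymOn D -> wt_cf D b B g = wt b B g.
Proof.
move=> gD; rewrite cfunE /set_stab inE gD /=.
by rewrite /wt; case: ifP => // _; rewrite mulr1n mxtrace_scalar.
Qed.

(* [set_char D b j] is the character of the action of [SymOn D] on the j-subsets
   of D, twisted by the sign on the subset when [b] holds; in that case it is
   the j-th exterior power of the natural permutation character. *)
Definition set_char D b j : 'CF(SymOn D) :=
  'Ind[SymOn D] (wt_cf D b [set x in take j (enum D)]).

Lemma set_char_char D b j : set_char D b j \is a character.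
Proof. exact/cfInd_char/cfRepr_char. Qed.

Lemma im_Sym_sub D B g : g \in SymOn D -> B \subset D -> g @: B \subset D.
Proof.
rewrite inE => gD BD; apply/subsetP => _ /imsetP[x xB ->].
by rewrite (perm_closed _ gD) (subsetP BD).
Qed.

Lemma imset_permM B g h : (g * h)%g @: B = h @: (g @: B).
Proof. by rewrite -imset_comp; apply: eq_imset => x; rewrite /= permM. Qed.

Lemma card_im_perm B g : #|g @: B| = #|B|.
Proof. by rewrite card_imset //; apply: perm_inj. Qed.

Lemma set_charE D b j g : (j <= #|D|)%N -> g \in SymOn D ->
  set_char D b j g = \sum_(B : {set T} | (B \subset D) && (#|B| == j)) wt b B g.
Proof.
move=> jD gD; set B0 := [set x in take j (enum D)].
have B0D : B0 \subset D.
  by apply/subsetP=> x; rewrite inE => /mem_take; rewrite mem_enum.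
have cB0 : #|B0| = j.
  rewrite cardsE (card_uniqP _) ?take_uniq ?enum_uniq // size_takel //.
  by rewrite -cardE.
rewrite /set_char -/B0 cfIndE; last by apply/subsetP => h; rewrite inE => /andP[].
pose S := [set B : {set T} | (B \subset D) && (#|B| == j)].
(* In the formula for induction, conjugating g is traded for moving [B0]; every subset of size j
   then occurs once for each element of the stabilizer of [B0]. *)
transitivity (#|set_stab D B0|%:R^-1 * \sum_(y in SymOn D) wt b (y @: B0) g).
  congr (_ * _); rewrite (reindex_inj invg_inj) /=; apply: eq_big => y.
    by rewrite groupV.
  rewrite groupV => yD; rewrite wt_cfE ?groupJ ?groupV //.
  by rewrite -[in RHS](wtJ _ _ _ y^-1) -imset_permM mulgV imset_perm1.
rewrite (@sum_orbit _ _ _ (fun (B : {set T}) (y : {perm T}) => y @: B) S _ _ _ _ _ (fun B => wt b B g)).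
- rewrite -[(\sum_(r in S) _) *+ _]mulr_natl (_ : [set y in _ | _] = set_stab D B0); last first.
    by apply/setP => y; rewrite !inE stabs_im.
  rewrite mulKf ?neq0CG //; apply: eq_bigl => B; by rewrite inE.
- by move=> B h1 h2; rewrite imset_permM.
- by move=> B; rewrite imset_perm1.
- move=> B B' /[!inE] /andP[BD /eqP cB] /andP[B'D /eqP cB'].
  have [r|h hD hB] := @recolour_perm _ D _ (fun x => x \in B) (fun x => x \in B').
    have e B1 : B1 \subset D -> #|[set x in D | (x \in B1) == r]| =
        if r then #|B1| else (#|D| - #|B1|)%N.
      move=> B1D; case: r.
        by apply: eq_card => x; rewrite inE eqb_id; case: (boolP (x \in B1)) => [/(subsetP B1D)->|]; rewrite ?andbF.
      by rewrite -cardsDS //; apply: eq_card => x; rewrite !inE eqbF_neg andbC.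
    by rewrite !e // cB cB'.
  exists h => //; apply/eqP; rewrite eq_sym eqEcard card_im_perm cB cB' leqnn andbT.
  by apply/subsetP=> _ /imsetP[x xB ->]; rewrite hB // (subsetP BD).
- by move=> B h /[!inE] /andP[BD /eqP cB] hD; rewrite card_im_perm cB eqxx im_Sym_sub // inE.
- by rewrite inE B0D cB0 eqxx.
Qed.

Lemma set_char1 D b j : (j <= #|D|)%N -> set_char D b j 1%g = ('C(#|D|, j))%:R.
Proof.
move=> jD; rewrite set_charE // (eq_bigr (fun=> 1)) => [|B _]; last exact: wt1.
rewrite sumr_const -cards_draws; congr (_%:R); apply: eq_card => B.
by rewrite !inE.
Qed.

Lemma stabs_set1 x g : stabs [set x] g = (g x == x).
Proof.
apply/stabsP/eqP => [/(_ x)|gx y]; first by rewrite !inE eqxx => /eqP.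
by rewrite !inE -{1}gx (inj_eq perm_inj).
Qed.

Lemma restr_perm_small B g : (#|B| <= 1)%N -> restr_perm B g = 1%g.
Proof. by move=> B1; apply: (perm_on_id (restr_perm_on B g)). Qed.

Lemma set_char_0 D b : set_char D b 0 = 1.
Proof.
apply/cfun_inP => g gD; rewrite set_charE // cfun1E gD.
rewrite (big_pred1 set0) => [|B]; last first.
  by rewrite cards_eq0 /= andbC; case: eqP => // ->; apply: sub0set.
rewrite /wt (_ : stabs _ _); last by apply/stabsP => x; rewrite !inE.
by rewrite restr_perm_small ?cards0 // odd_perm1 andbF.
Qed.

Definition nfix D g : nat := #|[set x in D | g x == x]|.

Lemma nfixE D g : (nfix D g)%:R = \sum_(x in D) (g x == x)%:R :> algC.
Proof.
rewrite /nfix -sum1_card natr_sum big_mkcond [RHS]big_mkcond /=.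
by apply: eq_bigr => x _; rewrite inE; case: (x \in D); case: (g x == x).
Qed.

Lemma set_char_1 D b g : (0 < #|D|)%N -> g \in SymOn D ->
  set_char D b 1 g = (nfix D g)%:R.
Proof.
move=> D0 gD; rewrite set_charE //.
rewrite (eq_bigl (fun B => B \in [set [set x] | x in D])) => [|B]; last first.
  apply/andP/imsetP=> [[BD /cards1P[x eB]]|[x xD ->]].
    by exists x; rewrite // (subsetP BD) // eB inE.
  by rewrite sub1set cards1.
rewrite big_imset /=; last by move=> x y _ _; apply: set1_inj.
rewrite nfixE; apply: eq_bigr => x _; rewrite /wt stabs_set1.
by rewrite restr_perm_small ?cards1 // odd_perm1 andbF; case: (g x == x).
Qed.

Lemma sum_pairs (V : nmodType) D (F : {set T} -> V) :
  (\sum_(B : {set T} | (B \subset D) && (#|B| == 2)) F B) *+ 2 =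
  \sum_(x in D) \sum_(y in D | y != x) F [set x; y].
Proof.
rewrite -sumrMnl.
transitivity (\sum_(B : {set T} | (B \subset D) && (#|B| == 2))
   \sum_(x in D) \sum_(y in D | y != x) (if (x \in B) && (y \in B) then F B else 0)).
  apply: eq_bigr => B /andP[BD /cards2P[x [y [nxy eB]]]].
  have xD : x \in D by rewrite (subsetP BD) // eB !inE eqxx.
  have yD : y \in D by rewrite (subsetP BD) // eB !inE eqxx orbT.
  have nyx : y != x by rewrite eq_sym.
  rewrite (bigD1 x) //= (bigD1 y) ?yD ?nyx //= eB !inE !eqxx orbT /=.
  rewrite big1 => [|z /andP[/andP[_ zx] zy]]; last by rewrite !inE (negPf zx) (negPf zy).
  rewrite addr0 (bigD1 y) ?yD ?nyx //= (bigD1 x) ?xD ?nxy //=.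
  rewrite !inE !eqxx orbT /= big1 => [|z /andP[/andP[_ zx] zy]]; last first.
    by rewrite !inE (negPf zx) (negPf zy) ?andbF.
  rewrite addr0 mulr2n big1 ?addr0 // => z /andP[/andP[_ zx] zy].
  by rewrite big1 // => w _; rewrite !inE (negPf zx) (negPf zy).
rewrite exchange_big /=; apply: eq_bigr => x xD.
rewrite exchange_big /=; apply: eq_bigr => y /andP[yD nyx].
have nxy : x != y by rewrite eq_sym.
rewrite -big_mkcondr (big_pred1 [set x; y]) // => B.
apply/idP/eqP=> [/andP[/andP[BD /eqP cB] /andP[xB yB]]|->]; last first.
  rewrite cards2 nxy !inE !eqxx orbT !andbT.
  by apply/subsetP=> z; rewrite !inE => /orP[]/eqP->.
apply/esym/eqP; rewrite eqEcard cB cards2 nxy leqnn andbT.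
by apply/subsetP=> z; rewrite !inE => /orP[]/eqP->.
Qed.

Lemma wt_pair b (x y : T) g : x != y -> wt b [set x; y] g =
  ((g x == x) && (g y == y))%:R + (-1) ^+ b * ((g x == y) && (g y == x))%:R.
Proof.
move=> nxy; have nyx : y != x by rewrite eq_sym.
have sxy : stabs [set x; y] g = (g x == x) && (g y == y) || (g x == y) && (g y == x).
  apply/stabsP/idP=> [s|].
    have := s x; have := s y; rewrite !inE !eqxx orbT /=.
    case/orP=> /eqP gy /orP[]/eqP gx; rewrite gx gy ?eqxx ?orbT //.
      by move: nxy; rewrite -(inj_eq (@perm_inj _ g)) gx gy eqxx.
    by move: nxy; rewrite -(inj_eq (@perm_inj _ g)) gx gy eqxx.
  case/orP=> /andP[/eqP gx /eqP gy] z; rewrite !inE.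
    by rewrite -(inj_eq (@perm_inj _ g) z x) -(inj_eq (@perm_inj _ g) z y) gx gy.
  by rewrite -(inj_eq (@perm_inj _ g) z x) -(inj_eq (@perm_inj _ g) z y) gx gy orbC.
rewrite /wt sxy; case: (boolP (_ && _)) => [/andP[/eqP gx /eqP gy]|_] /=.
  rewrite gx gy (negPf nxy) mulr0 addr0 (_ : restr_perm _ _ = 1%g).
    by rewrite odd_perm1 andbF.
  apply/permP=> z; rewrite perm1; case: (boolP (z \in [set x; y])) => zB.
    rewrite restr_permE // -?stabsE ?sxy ?gx ?gy ?eqxx //.
    by move: zB; rewrite !inE => /orP[]/eqP->.
  by rewrite (out_perm (restr_perm_on _ _)).
case: (boolP (_ && _)) => [/andP[/eqP gx /eqP gy]|_]; last by rewrite mulr0 addr0.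
rewrite add0r mulr1 (_ : restr_perm _ _ = tperm x y) ?odd_tperm ?nxy ?andbT //.
apply/permP=> z; case: (boolP (z \in [set x; y])) => zB.
  rewrite restr_permE // -?stabsE ?sxy ?gx ?gy ?eqxx ?orbT //.
  by move: zB; rewrite !inE => /orP[]/eqP->; rewrite ?gx ?gy ?tpermL ?tpermR.
rewrite (out_perm (restr_perm_on _ _)) // tpermD //;
  by apply: contraNneq zB => <-; rewrite !inE eqxx ?orbT.
Qed.

(** For [b] true this is the exterior square of the natural character, for [b] false its symmetric
    square without the squares of basis vectors. The factor 2 comes from counting ordered pairs. *)
Lemma set_char_2 D b g : (1 < #|D|)%N -> g \in SymOn D ->
  set_char D b 2 g *+ 2 = (nfix D g)%:R ^+ 2 - (nfix D g)%:R
     + (-1) ^+ b * ((nfix D (g * g)%g)%:R - (nfix D g)%:R).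
Proof.
move=> D1 gD; rewrite set_charE // sum_pairs.
have gDP : perm_on D g by rewrite inE in gD.
rewrite (eq_bigr (fun x => \sum_(y in D | y != x) ((g x == x) && (g y == y))%:R +
  (-1) ^+ b * \sum_(y in D | y != x) ((g x == y) && (g y == x))%:R)); last first.
  move=> x xD; rewrite mulr_sumr -big_split; apply: eq_bigr => y /andP[_ nyx].
  by rewrite wt_pair 1?eq_sym.
rewrite big_split -mulr_sumr /=; congr (_ + _ * _).
  rewrite expr2 {1}nfixE mulr_suml [X in _ - X]nfixE -sumrB; apply: eq_bigr => x xD.
  rewrite nfixE mulr_sumr [in RHS](bigD1 x) //= addrAC -natrM mulnb andbb subrr add0r.
  by apply: eq_bigr => y _; rewrite -natrM mulnb.
rewrite !nfixE -sumrB; apply: eq_bigr => x xD; rewrite permM.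
have [gx|ngx] := eqVneq (g x) x.
  rewrite big1 => [|y /andP[_ nyx]]; first by rewrite !gx eqxx subrr.
  by rewrite gx eq_sym (negPf nyx).
rewrite subr0 (bigD1 (g x)) ?ngx ?andbT ?(perm_closed _ gDP) //= eqxx /=.
by rewrite big1 ?addr0 // => y /andP[_ nyg]; rewrite eq_sym (negPf nyg).
Qed.

(** A subset stable under a cycle that is transitive on D is empty or all of D, so every weight
    vanishes. *)
Lemma set_char_full_cycle D b j c : (1 < #|D|)%N -> kcycle #|D| c -> c \in SymOn D ->
  (0 < j < #|D|)%N -> set_char D b j c = 0.
Proof.
move=> D1 kc cD /andP[j0 jD]; rewrite set_charE 1?ltnW // big1 // => B /andP[BD /eqP cB].
rewrite /wt; case: ifP => // /stabsP sB; have [x [cx fx]] := kcycleP D1 kc.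
have OD : porbit c x = D.
  by apply/eqP; rewrite eqEcard cx leqnn andbT porbit_Sym // cx.
have /card_gt0P[z zB] : (0 < #|B|)%N by rewrite cB.
have : D \subset B.
  have zO : porbit c z = D.
    by rewrite -OD; apply/eqP; rewrite eq_porbit_mem OD (subsetP BD).
  rewrite -zO; apply/subsetP => _ /porbitP[i ->].
  by elim: i => [|i IH]; rewrite ?expg0 ?perm1 // expgSr permM sB.
by move/subset_leq_card; rewrite cB leqNgt jD.
Qed.

End SetCharacters.

(** * Inner products of the subset characters *)

Section SetCharDot.

Variable T : finType.
Implicit Types (g h : {perm T}) (A B D : {set T}).

Definition pair_act (p : {set T} * {set T}) (g : {perm T}) := (g @: p.1, g @: p.2).

(** For fixed sizes i and j these are the orbits of [SymOn D] on pairs of subsets, one for each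
    possible t. *)
Definition set_pairs D (i j t : nat) : {set {set T} * {set T}} :=
  [set p : {set T} * {set T} | [&& p.1 \subset D, p.2 \subset D, #|p.1| == i, #|p.2| == j
             & #|p.1 :&: p.2| == t]].

Lemma set_pairs_colour D i j t p (r : bool * bool) : p \in set_pairs D i j t ->
  #|[set x in D | (x \in p.1, x \in p.2) == r]| =
    if r.1 then (if r.2 then t else i - t)%N
    else (if r.2 then j - t else #|D| - (i + j - t))%N.
Proof.
case: p => A B; rewrite inE /= => /and5P[AD BD /eqP cA /eqP cB /eqP cI].
have nA x : x \notin D -> x \notin A by apply/contra/(subsetP AD).
have nB x : x \notin D -> x \notin B by apply/contra/(subsetP BD).
case: r => [[] []] /=.
- rewrite -cI; apply: eq_card => x; rewrite !inE xpair_eqE !eqb_id.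
  by case: (boolP (x \in A)) => [/(subsetP AD)->|]; rewrite ?andbF.
- rewrite -cI -cA -cardsD; apply: eq_card => x; rewrite !inE xpair_eqE eqb_id eqbF_neg.
  by case: (boolP (x \in A)) => [/(subsetP AD)->|]; rewrite ?andbF ?andbT.
- rewrite -cI -cB setIC -cardsD; apply: eq_card => x; rewrite !inE xpair_eqE eqb_id eqbF_neg.
  by case: (boolP (x \in B)) => [/(subsetP BD)->|]; rewrite ?andbF ?andbT.
- rewrite -cI -cA -cB -cardsU -cardsDS ?subUset ?AD //; apply: eq_card => x.
  by rewrite !inE xpair_eqE !eqbF_neg negb_or andbC.
Qed.

Lemma set_pairs_trans D i j t : {in set_pairs D i j t &, forall p q,
  exists2 g, g \in SymOn D & q = pair_act p g}.
Proof.
move=> p q Pp Pq; have [r|g gD hg] := @recolour_perm _ D _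
    (fun x => (x \in p.1, x \in p.2)) (fun x => (x \in q.1, x \in q.2)).
  by rewrite (set_pairs_colour r Pp) (set_pairs_colour r Pq).
exists g => //; move: p q Pp Pq hg => [A B] [A' B'].
rewrite !inE /= => /and5P[AD BD /eqP cA /eqP cB _] /and5P[AD' BD' /eqP cA' /eqP cB' _] hg.
congr (_, _); apply/esym/eqP; rewrite eqEcard card_im_perm ?cA ?cA' ?cB ?cB' leqnn andbT;
  apply/subsetP=> _ /imsetP[x xX ->].
  by have [-> _] := hg x (subsetP AD _ xX).
by have [_ ->] := hg x (subsetP BD _ xX).
Qed.

Lemma set_pairs_stable D i j t : {in set_pairs D i j t & SymOn D, forall p g,
  pair_act p g \in set_pairs D i j t}.
Proof.
move=> [A B] g /[!inE] /and5P[AD BD cA cB cI] gD /=.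
rewrite -imsetI; last by move=> x y _ _; apply: perm_inj.
by rewrite !card_im_perm cA cB cI !im_Sym_sub // inE.
Qed.

Lemma sum_pairs_stab D i j t : (t <= i)%N -> (t <= j)%N -> (i + j <= #|D| + t)%N ->
  (\sum_(p in set_pairs D i j t) #|[set g in SymOn D | pair_act p g == p]| = #|SymOn D|)%N.
Proof.
move=> ti tj ijt.
have [A AD cA] : exists2 A : {set T}, A \subset D & #|A| = i.
  by apply: exists_subset_card; lia.
have [C CA cC] : exists2 C : {set T}, C \subset A & #|C| = t.
  by apply: exists_subset_card; lia.
have [E EA cE] : exists2 E : {set T}, E \subset D :\: A & #|E| = (j - t)%N.
  by apply: exists_subset_card; rewrite cardsDS // cA; lia.
have /subsetDP[ED dEA] := EA.
have iAE : A :&: E = set0 by apply/eqP; rewrite setIC setI_eq0.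
apply: (@sum_stab_orbit _ _ _ pair_act _ _ _ _ _ (A, C :|: E)).
- by move=> p g h; rewrite /pair_act !imset_permM.
- by move=> [A' B']; rewrite /pair_act !imset_perm1.
- exact: set_pairs_trans.
- exact: set_pairs_stable.
- rewrite inE /= AD subUset (subset_trans CA) //= ED cA eqxx /=.
  rewrite setIUr (setIidPr CA) iAE setU0 cC eqxx andbT cardsU cC cE.
  rewrite (_ : C :&: E = set0) ?cards0; first by apply/eqP; lia.
  by apply/eqP; rewrite -subset0 -iAE setSI.
Qed.

Lemma set_pairs_bounds D i j t p : p \in set_pairs D i j t ->
  [/\ (t <= i)%N, (t <= j)%N & (i + j <= #|D| + t)%N].
Proof.
case: p => A B; rewrite inE /= => /and5P[AD BD /eqP cA /eqP cB /eqP cI].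
split; first by rewrite -cI -cA subset_leq_card ?subsetIl.
  by rewrite -cI -cB subset_leq_card ?subsetIr.
have := cardsU A B; rewrite cA cB cI => e.
have : (#|A :|: B| <= #|D|)%N by rewrite subset_leq_card // subUset AD.
lia.
Qed.

(** The single point that A may have outside B is fixed by g. In this case, and its mirror image,
    the two sign twists agree on the stabilizer of the pair. *)
Lemma restr_perm_capl A B g : stabs A g -> stabs B g -> (#|A :\: B| <= 1)%N ->
  restr_perm A g = restr_perm (A :&: B) g.
Proof.
move=> sA sB AB1; have sI : stabs (A :&: B) g.
  by apply/stabsP=> x; rewrite !inE (stabsP _ _ sA) (stabsP _ _ sB).
apply/permP=> x; case: (boolP (x \in A)) => xA; last first.
  by rewrite !(out_perm (restr_perm_on _ _)) // inE (negPf xA).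
case: (boolP (x \in B)) => xB.
  by rewrite !restr_permE -?stabsE // inE xA.
rewrite restr_permE -?stabsE // (out_perm (restr_perm_on _ _)) ?inE ?(negPf xB) ?andbF //.
have xAB : x \in A :\: B by rewrite inE xA xB.
have gAB : g x \in A :\: B by rewrite inE (stabsP _ _ sA) (stabsP _ _ sB) xA xB.
by have /card_le1_eqP := AB1; apply.
Qed.

(** A transposition of two points of A outside B has sign -1 on A and is trivial on B, so
    translating by it negates the sum. *)
Lemma wt_sum0 D (b : bool) A B : A \subset D -> b -> (1 < #|A :\: B|)%N ->
  \sum_(g in SymOn D) wt b A g * wt b B g = 0.
Proof.
move=> AD bT /card_gt1P[x [y [/setDP[xA xB] /setDP[yA yB] nxy]]].
have tD : tperm x y \in SymOn D.
  rewrite inE; apply: subset_trans (tperm_on x y) _.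
  by apply/subsetP => z; rewrite !inE => /orP[]/eqP->; apply: (subsetP AD).
have sA : stabs A (tperm x y).
  by apply/stabsP=> z; case: tpermP => // ->; rewrite xA yA.
have sB : stabs B (tperm x y).
  by apply/stabsP=> z; case: tpermP => // ->; rewrite (negPf xB) (negPf yB).
have wA : wt b A (tperm x y) = -1.
  rewrite /wt sA bT (_ : restr_perm _ _ = tperm x y) ?odd_tperm ?nxy //.
  apply/permP => z; case: (boolP (z \in A)) => zA.
    by rewrite restr_permE -?stabsE.
  rewrite (out_perm (restr_perm_on _ _)) // tpermD //; apply: contraNneq zA => <- //.
have wB : wt b B (tperm x y) = 1.
  rewrite /wt sB (_ : restr_perm _ _ = 1%g) ?odd_perm1 ?andbF //.
  apply/permP => z; rewrite perm1; case: (boolP (z \in B)) => zB.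
    rewrite restr_permE -?stabsE // tpermD //.
      by apply: contraNneq xB => ->.
    by apply: contraNneq yB => ->.
  by rewrite (out_perm (restr_perm_on _ _)).
set s := \sum_(g in _) _; have : s = - s.
  rewrite {1}/s (reindex_inj (mulgI (tperm x y))) /= /s -sumrN; apply: eq_big => [g|g _].
    by rewrite groupMl.
  by rewrite !wtM // wA wB mulN1r mul1r mulNr.
by move/eqP; rewrite -addr_eq0 -mulr2n mulrn_eq0 /= => /eqP.
Qed.

Lemma wt_sum D b A B : A \subset D -> B \subset D ->
  \sum_(g in SymOn D) wt b A g * wt b B g =
  if b && ((1 < #|A :\: B|) || (1 < #|B :\: A|))%N then 0
  else #|[set g in SymOn D | pair_act (A, B) g == (A, B)]|%:R.
Proof.
move=> AD BD; case: ifP => [/andP[bT /orP[AB|BA]]|cond].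
- exact: wt_sum0.
- by rewrite -[RHS](wt_sum0 BD bT BA); apply: eq_bigr => g _; rewrite mulrC.
rewrite -sum1_card natr_sum big_mkcond [RHS]big_mkcond; apply: eq_bigr => g _ /=.
rewrite [in RHS]inE xpair_eqE /= -!stabs_im; case: (g \in SymOn D) => //=.
case: (boolP (stabs A g)) => sA; last by rewrite /wt (negPf sA) mul0r.
case: (boolP (stabs B g)) => sB; last by rewrite /wt (negPf sB) mulr0.
rewrite /wt sA sB; case: b cond => /=; last by rewrite mulr1.
move/negbT; rewrite negb_or -!leqNgt => /andP[AB BA].
by rewrite (restr_perm_capl sA sB AB) (restr_perm_capl sB sA BA) setIC -signr_addb addbb.
Qed.

(** Mackey's formula: t runs over the orbits on pairs of subsets, and an orbit counts 1 if the two
    linear characters agree on the stabilizer of a pair. With the twist they agree exactly when each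
    subset has at most one point outside the other, which is the last condition. *)
Lemma set_char_dot D b i j : (i <= #|D|)%N -> (j <= #|D|)%N ->
  '[set_char D b i, set_char D b j] =
  (\sum_(t < #|D|.+1) [&& t <= i, t <= j, i + j <= #|D| + t
      & b ==> (i <= t.+1) && (j <= t.+1)])%N%:R.
Proof.
move=> iD jD; rewrite cfdotE.
pose F (p : {set T} * {set T}) : algC :=
  if b && ((1 < #|p.1 :\: p.2|) || (1 < #|p.2 :\: p.1|))%N then 0
  else #|[set g in SymOn D | pair_act p g == p]|%:R.
have -> : \sum_(g in SymOn D) set_char D b i g * (set_char D b j g)^* =
  \sum_(p : {set T} * {set T} | [&& p.1 \subset D, #|p.1| == i, p.2 \subset D & #|p.2| == j]) F p.
  transitivity (\sum_(g in SymOn D) \sum_(A : {set T} | (A \subset D) && (#|A| == i))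
      \sum_(B : {set T} | (B \subset D) && (#|B| == j)) wt b A g * wt b B g).
    apply: eq_bigr => g gD; rewrite !set_charE // rmorph_sum mulr_suml.
    apply: eq_bigr => A _; rewrite mulr_sumr; apply: eq_bigr => B _.
    by congr (_ * _); apply: wt_conj.
  rewrite exchange_big /=.
  under eq_bigr do rewrite exchange_big /=.
  rewrite pair_big /=; apply: eq_big => [[A B]|[A B]] /=; first by rewrite -andbA.
  by case/andP=> /andP[AD _] /andP[BD _]; rewrite wt_sum.
rewrite (partition_big (fun p => inord #|p.1 :&: p.2| : 'I_(#|D|.+1)) predT) //=.
rewrite natr_sum mulr_sumr; apply: eq_bigr => t _.
have -> : \sum_(p : {set T} * {set T} | [&& p.1 \subset D, #|p.1| == i, p.2 \subset D
      & #|p.2| == j] && (inord #|p.1 :&: p.2| == t)) F p = \sum_(p in set_pairs D i j t) F p.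
  apply: eq_bigl => -[A B]; rewrite inE /=.
  case: (boolP (A \subset D)) => AD //=; case: (B \subset D); rewrite ?andbF //=.
  case: eqP => //= _; case: eqP => //= _.
  rewrite -val_eqE /= inordK // ltnS; apply: leq_trans (subset_leq_card AD).
  by rewrite subset_leq_card ?subsetIl.
case: (boolP [&& t <= i, t <= j & i + j <= #|D| + t]%N) => [/and3P[ti tj ijt]|nb]; last first.
  rewrite big1 => [|p /set_pairs_bounds[ti tj ijt]]; last by rewrite ti tj ijt in nb.
  by rewrite mulr0; move: nb; case: (t <= i)%N => //=; case: (t <= j)%N => //= /negPf->.
rewrite ti tj ijt /=; case: (boolP (_ ==> _)) => bij.
  rewrite -{2}(mulVf (neq0CG (SymOn_group D))); congr (_ * _).
  rewrite -(sum_pairs_stab ti tj ijt) natr_sum; apply: eq_bigr => -[A B].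
  rewrite inE /F /= => /and5P[AD BD /eqP cA /eqP cB /eqP cI].
  case: ifP => // /andP[bT]; rewrite !cardsD (setIC B A) cI cA cB.
  move: bij; rewrite bT /= => /andP[]; lia.
rewrite big1 ?mulr0 // => -[A B]; rewrite inE /F /= => /and5P[AD BD /eqP cA /eqP cB /eqP cI].
move: bij; rewrite negb_imply => /andP[-> nij] /=.
by rewrite !cardsD (setIC B A) cI cA cB ifT //; lia.
Qed.

Lemma sum_ord_indicator m (P : pred nat) (s : seq nat) : uniq s ->
  (forall t, (t < m)%N && P t = (t \in s)) -> (\sum_(t < m) P t)%N = size s.
Proof.
move=> Us sP; rewrite -(big_mkord xpredT (fun t => nat_of_bool (P t))).
rewrite (eq_bigr (fun t => if P t then 1 else 0)%N) => [|t _]; last by case: (P t).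
rewrite -big_mkcond sum1_count -size_filter.
apply/perm_size/uniq_perm => //; first by rewrite filter_uniq // iota_uniq.
by move=> t; rewrite mem_filter mem_index_iota leq0n /= andbC sP.
Qed.

(** The pattern of a chain in which consecutive exterior powers share one hook. On the diagonal only
    t = i - 1 and t = i survive the sign condition, and the former is impossible for i = 0 and for i
    = |D|. *)
Lemma ext_dot D i j : (i <= j)%N -> (j <= #|D|)%N ->
  '[set_char D true i, set_char D true j] =
    (if i == j then if 0 < i < #|D| then 2 else 1 else (j == i.+1))%N%:R.
Proof.
move=> ij jD; have iD := leq_trans ij jD; rewrite set_char_dot //=.
congr (_%:R).
pose P (t : nat) := [&& t <= i, t <= j, i + j <= #|D| + t, i <= t.+1 & j <= t.+1]%N.
have count_t s := @sum_ord_indicator #|D|.+1 P s.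
case: eqP => [eij|nij].
  case: ifP => cond.
    by rewrite (count_t [:: i.-1; i]) // => [|t]; rewrite /P /= !inE; lia.
  by rewrite (count_t [:: i]) // => t; rewrite /P !inE; lia.
case: eqP => [eij|nij1].
  by rewrite (count_t [:: i]) // => t; rewrite /P !inE; lia.
by rewrite (count_t [::]) // => t; rewrite /P in_nil; lia.
Qed.

End SetCharDot.

(** * Hook characters *)

Section GeneralCharacters.

Variables (gT : finGroupType) (G : {group gT}).

Lemma irr_dot_neq0 (chi psi : 'CF(G)) :
  chi \in irr G -> psi \in irr G -> '[chi, psi] != 0 -> chi = psi.
Proof.
by move=> /irrP[i ->] /irrP[j ->]; rewrite cfdot_irr; case: (i =P j) => [->|_] //; rewrite eqxx.
Qed.

Lemma irr_dot_eq0 (chi psi : 'CF(G)) :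
  chi \in irr G -> psi \in irr G -> chi != psi -> '[chi, psi] = 0.
Proof. by move=> Xc Xp; apply: contraNeq => /(irr_dot_neq0 Xc Xp)->. Qed.

Lemma irr_deg_gt0 (chi : 'CF(G)) : chi \in irr G -> 0 < chi 1%g.
Proof. by case/irrP=> i ->; apply: irr1_gt0. Qed.

Lemma vchar_norm1_irr (phi : 'CF(G)) :
  phi \in 'Z[irr G]%g -> '[phi] = 1 -> 0 < phi 1%g -> phi \in irr G.
Proof.
move=> Zphi n1 p1; have [[] [i defphi]] := vchar_norm1P Zphi n1; last first.
  by rewrite defphi scale1r mem_irr.
move: p1; rewrite defphi scaleN1r cfunE oppr_gt0 => /lt_trans/(_ (irr1_gt0 i)).
by rewrite ltxx.
Qed.

Lemma column_sum_le (x : gT) (L : seq 'CF(G)) : x \in G -> uniq L ->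
  {subset L <= irr G} -> \sum_(chi <- L) `|chi x| ^+ 2 <= #|'C_G[x]%g|%:R.
Proof.
move=> Gx UL sL; have := second_orthogonality_relation x Gx.
rewrite class_refl mulr1n => <-.
have -> : \sum_i 'chi[G]_i x * ('chi_i x)^* = \sum_(chi <- irr G) `|chi x| ^+ 2.
  rewrite big_tuple; apply: eq_bigr => i _.
  by rewrite normCK (tnth_nth 0).
have pL : perm_eq L [seq chi <- irr G | chi \in L].
  apply: uniq_perm => //; first by rewrite filter_uniq ?free_uniq ?irr_free.
  move=> chi; rewrite mem_filter; case: (boolP (chi \in L)) => //= cL.
  by rewrite (sL _ cL).
rewrite (perm_big _ pL) /= big_filter [leRHS](bigID (mem L)) /= lerDl.
by apply: sumr_ge0 => chi _; rewrite exprn_ge0.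
Qed.

Section Averaging.

Variables (phi : 'CF(G)) (x : gT) (a b : algC).
Hypotheses (Nphi : phi \is a character) (a_ge0 : 0 <= a).
Hypothesis bound :
  forall theta, theta \in irr G -> '[phi, theta] != 0 -> a * `|theta x| <= b * theta 1%g.

Let phiE : phi = \sum_i '[phi, 'chi_i] *: 'chi_i.
Proof. exact: cfun_sum_cfdot. Qed.

Let m_ge0 i : 0 <= '[phi, 'chi_i].
Proof. by rewrite natr_ge0 // Cnat_cfdot_char_irr. Qed.

(** By the triangle inequality the defect of phi is at least the sum of the defects of its
    constituents. One strict constituent thus makes the bound on phi strict. *)
Let gap : \sum_i '[phi, 'chi_i] * (b * 'chi_i 1%g - a * `|'chi_i x|)
  <= b * phi 1%g - a * `|phi x|.
Proof.
under eq_bigr do rewrite mulrBr.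
rewrite sumrB lerB //.
  rewrite {2}phiE sum_cfunE mulr_sumr; apply: ler_sum => i _.
  by rewrite cfunE mulrCA.
rewrite {1}phiE sum_cfunE; apply: le_trans (ler_wpM2l a_ge0 (ler_norm_sum _ _ _)) _.
rewrite mulr_sumr; apply: ler_sum => i _.
by rewrite cfunE normrM (ger0_norm (m_ge0 i)) mulrCA.
Qed.

Let term_ge0 i : 0 <= '[phi, 'chi_i] * (b * 'chi_i 1%g - a * `|'chi_i x|).
Proof.
have [->|nz] := eqVneq '[phi, 'chi_i] 0; first by rewrite mul0r.
by rewrite mulr_ge0 // subr_ge0 bound ?mem_irr.
Qed.

Lemma char_average_le : a * `|phi x| <= b * phi 1%g.
Proof. by rewrite -subr_ge0; apply: le_trans gap; apply: sumr_ge0. Qed.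

Lemma char_average_lt theta : theta \in irr G -> '[phi, theta] != 0 ->
  a * `|theta x| < b * theta 1%g -> a * `|phi x| < b * phi 1%g.
Proof.
case/irrP=> i -> nz lt; rewrite -subr_gt0; apply: lt_le_trans gap.
rewrite (bigD1 i) //= ltr_wpDr ?sumr_ge0 // mulr_gt0 ?subr_gt0 //.
by rewrite lt_def nz m_ge0.
Qed.

End Averaging.

Lemma char_constt (phi : 'CF(G)) : phi != 0 -> exists2 theta, theta \in irr G & '[phi, theta] != 0.
Proof.
move=> nz; have [i] := neq0_has_constt nz.
by rewrite irr_consttE => nzi; exists 'chi_i; rewrite ?mem_irr.
Qed.

End GeneralCharacters.

Lemma bin2_le_bin N j : (2 <= j)%N -> (j + 2 <= N)%N -> ('C(N, 2) <= 'C(N, j))%N.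
Proof.
elim: N j => [|N IH] j j2 jN; first lia.
have [->//|jn2] := eqVneq j 2.
have [eqj|njN] := eqVneq (j + 2)%N N.+1.
  by rewrite -(bin_sub (_ : j <= N.+1)%N); [have -> : (N.+1 - j = 2)%N by lia | lia].
case: j j2 jN jn2 njN => // j j2 jN jn2 njN; rewrite !binS bin1.
have h1 : ('C(N, 2) <= 'C(N, j.+1))%N by apply: IH; lia.
have h2 : ('C(N, 2) <= 'C(N, j))%N by apply: IH; lia.
have h3 : (N <= 'C(N, 2))%N.
  rewrite bin2 -divn2 leq_divRL //; nia.
lia.
Qed.

(** * Sign, hook and standard characters, and restriction to a point stabilizer *)

Section SymCharacters.

Variable T : finType.
Implicit Types (g h c : {perm T}) (D : {set T}).

Fact sgn_mx_repr D : mx_repr (SymOn D) (fun g => ((-1) ^+ odd_perm g)%:M : 'M[algC]_1).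
Proof.
split=> [|g h _ _]; first by rewrite odd_perm1.
by rewrite odd_permM signr_addb scalar_mxM.
Qed.

Definition sgnc D : 'CF(SymOn D) := locked (cfRepr (MxRepresentation (sgn_mx_repr D))).

Lemma sgncE D g : g \in SymOn D -> sgnc D g = (-1) ^+ odd_perm g.
Proof. by move=> gD; rewrite /sgnc -lock cfunE gD mulr1n mxtrace_scalar. Qed.

Lemma sgnc_lin D : sgnc D \is a linear_char.
Proof.
by rewrite /sgnc -lock qualifE /= cfRepr_char /=; apply/eqP; rewrite cfRepr1.
Qed.

Lemma sgncM D : sgnc D * sgnc D = 1.
Proof.
apply/cfun_inP=> g gD; rewrite cfunE sgncE // cfun1E gD.
by rewrite -signr_addb addbb.
Qed.

Lemma sgnc_irr D (chi : 'CF(SymOn D)) : (sgnc D * chi \in irr (SymOn D)) = (chi \in irr (SymOn D)).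
Proof.
apply/idP/idP => [X|]; last by apply: mul_lin_irr; apply: sgnc_lin.
by rewrite -[chi]mul1r -(sgncM D) -mulrA mul_lin_irr ?sgnc_lin.
Qed.

Lemma sgnc_norm D (chi : 'CF(SymOn D)) g : `|(sgnc D * chi) g| = `|chi g|.
Proof.
case: (boolP (g \in SymOn D)) => gD; last by rewrite !cfun0.
by rewrite cfunE sgncE // normrM normrX normrN1 expr1n mul1r.
Qed.

Lemma sgnc_deg D (chi : 'CF(SymOn D)) : (sgnc D * chi) 1%g = chi 1%g.
Proof. by rewrite cfunE sgncE // odd_perm1 mul1r. Qed.

Lemma sgnc_dot D (phi psi : 'CF(SymOn D)) : '[sgnc D * phi, psi] = '[phi, sgnc D * psi].
Proof.
rewrite !cfdotE; congr (_ * _); apply: eq_bigr => g gD.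
rewrite [(sgnc D * phi) g]cfunE [(sgnc D * psi) g]cfunE sgncE //.
by rewrite rmorphM rmorph_sign mulrCA mulrA.
Qed.

Lemma subSym D x : SymOn (D :\ x) \subset SymOn D.
Proof.
apply/subsetP => g; rewrite !inE => /subset_trans; apply; exact: subD1set.
Qed.

Lemma sgnc_Res D x (chi : 'CF(SymOn D)) :
  'Res[SymOn (D :\ x)] (sgnc D * chi) = sgnc (D :\ x) * 'Res chi.
Proof.
apply/cfun_inP => g gD; have gD' := subsetP (subSym D x) _ gD.
by rewrite cfunE !cfResE ?subSym // cfunE !sgncE.
Qed.

(** The j-th exterior power of 1 + std is the sum of the j-th and (j-1)-th ones of std. The
    alternating sum therefore isolates the j-th exterior power of std, the character of the hook
    with j boxes below its first row. *)
Fixpoint hook_rec D j : 'CF(SymOn D) :=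
  if j is j'.+1 then set_char D true j - hook_rec D j' else 1.

Definition hook D j := locked (hook_rec D j).

Lemma hook0 D : hook D 0 = 1.
Proof. by rewrite /hook -lock. Qed.

Lemma hookS D j : hook D j.+1 = set_char D true j.+1 - hook D j.
Proof. by rewrite /hook -!lock. Qed.

Lemma hook_vchar D j : hook D j \in 'Z[irr (SymOn D)]%g.
Proof.
elim: j => [|j IH]; first by rewrite hook0 -irr0 irr_vchar.
by rewrite hookS rpredB // char_vchar // set_char_char.
Qed.

Lemma hook_deg D j : (j < #|D|)%N -> hook D j 1%g = ('C(#|D|.-1, j))%:R.
Proof.
elim: j => [|j IH] jD; first by rewrite hook0 bin0 cfun1E group1.
rewrite hookS !cfunE set_char1 1?ltnW // IH 1?ltnW //.
have -> : #|D| = #|D|.-1.+1 by lia.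
by rewrite binS natrD /= addrK.
Qed.

(** The claims are proved together because the norm of [hook D j.+1] is 2 - 1 - 1 + 1, where the
    mixed products of [hook D j] with the next exterior power come from the first claim. *)
Lemma hook_dots D j : (j < #|D|)%N ->
  [/\ forall k, (j < k)%N -> (k <= #|D|)%N -> '[hook D j, set_char D true k] = (k == j.+1)%:R,
      '[hook D j] = 1 & forall i, (i < j)%N -> '[hook D i, hook D j] = 0].
Proof.
elim/ltn_ind: j => -[_ D0|j IH jD].
  split=> // [k k0 kD|]; last by rewrite hook0 -irr0 cfnorm_irr.
  by rewrite hook0 -(set_char_0 D true) ext_dot // ltn_eqF.
have jD' : (j < #|D|)%N by apply: ltnW.
have [IHk IHn IHi] := IH j (ltnSn j) jD'.
have e : '[hook D j, set_char D true j.+1] = 1 by rewrite IHk // eqxx.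
split=> [k jk kD||i ij]; rewrite hookS.
- rewrite cfdotBl (IHk k (ltnW jk) kD) (ext_dot (ltnW jk) kD) (ltn_eqF jk).
  by rewrite (gtn_eqF jk) /= subr0.
- have e' : '[set_char D true j.+1, hook D j] = 1 by rewrite cfdotC e conjC1.
  rewrite cfdotBl !cfdotBr IHn e e' (ext_dot (leqnn _) (ltnW jD)) eqxx /= jD.
  by ring.
- rewrite cfdotBr; move: ij; rewrite ltnS leq_eqVlt => /orP[/eqP->|ij].
    by rewrite e IHn subrr.
  have [IHk' _ _] := IH i (leqW ij) (ltn_trans ij jD').
  by rewrite IHi // subr0 IHk' 1?leqW // 1?ltnW // eqSS gtn_eqF.
Qed.

Lemma hook_irr D j : (j < #|D|)%N -> hook D j \in irr (SymOn D).
Proof.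
move=> jD; have [_ n1 _] := hook_dots jD.
apply: vchar_norm1_irr => //; first exact: hook_vchar.
by rewrite hook_deg // ltr0n bin_gt0; lia.
Qed.

Lemma hook_neq D i j : (i < #|D|)%N -> (j < #|D|)%N -> i != j -> hook D i != hook D j.
Proof.
wlog ij : i j / (i < j)%N => [hw iD jD|iD jD _].
  case: (ltngtP i j) => // ij _; first by rewrite hw // ltn_eqF.
  by rewrite eq_sym hw // ltn_eqF.
have [_ n1 /(_ i ij) d0] := hook_dots jD.
by apply/eqP => eqh; move: d0; rewrite eqh n1 => /eqP; rewrite oner_eq0.
Qed.

Lemma hook_full_cycle D c j : (1 < #|D|)%N -> kcycle #|D| c -> c \in SymOn D ->
  (j < #|D|)%N -> hook D j c = (-1) ^+ j.
Proof.
move=> D1 kc cD; elim: j => [|j IH] jD; first by rewrite hook0 cfun1E cD.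
by rewrite hookS !cfunE set_char_full_cycle // IH 1?ltnW // sub0r exprS mulN1r.
Qed.

Definition std D := hook D 1.
(** The character of the Specht module of (m-2, 2), for m = |D|: the permutation character on
    2-subsets minus the one on points. *)
Definition pairc D := locked (set_char D false 2 - set_char D false 1).

Lemma stdE D g : (0 < #|D|)%N -> g \in SymOn D -> std D g = (nfix D g)%:R - 1.
Proof. by move=> D0 gD; rewrite /std hookS hook0 !cfunE set_char_1 // cfun1E gD. Qed.

Lemma std_irr D : (1 < #|D|)%N -> std D \in irr (SymOn D).
Proof. exact: hook_irr. Qed.

Lemma std_deg D : (1 < #|D|)%N -> std D 1%g = (#|D|.-1)%:R.
Proof. by move=> D1; rewrite hook_deg // bin1. Qed.

Lemma half_eq (u v : algC) : u *+ 2 = v -> u = v / 2.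
Proof. by move=> <-; rewrite -[u *+ 2]mulr_natr mulfK // pnatr_eq0. Qed.

Lemma hook2E D g : (1 < #|D|)%N -> g \in SymOn D ->
  hook D 2 g = ((nfix D g)%:R ^+ 2 - (nfix D (g * g)%g)%:R) / 2 - (nfix D g)%:R + 1.
Proof.
move=> D1 gD; have D0 := ltnW D1; rewrite !hookS hook0 !cfunE set_char_1 // cfun1E gD.
by rewrite (half_eq (set_char_2 true D1 gD)) /=; field.
Qed.

Lemma paircE D g : (1 < #|D|)%N -> g \in SymOn D ->
  pairc D g = ((nfix D g)%:R ^+ 2 + (nfix D (g * g)%g)%:R) / 2 - (nfix D g)%:R *+ 2.
Proof.
move=> D1 gD; have D0 := ltnW D1; rewrite /pairc -lock !cfunE set_char_1 //.
by rewrite (half_eq (set_char_2 false D1 gD)) /=; field.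
Qed.

Lemma nfix1 D : nfix D 1 = #|D|.
Proof. by apply: eq_card => x; rewrite inE perm1 eqxx andbT. Qed.

Lemma pairc_deg D : (1 < #|D|)%N -> pairc D 1%g = #|D|%:R * (#|D|%:R - 3) / 2.
Proof. by move=> D1; rewrite paircE // mulg1 nfix1; field. Qed.

Lemma pairc_irr D : (4 <= #|D|)%N -> pairc D \in irr (SymOn D).
Proof.
move=> D4; have [D1 D2] : (1 <= #|D|)%N /\ (2 <= #|D|)%N by lia.
apply: vchar_norm1_irr.
- by rewrite /pairc -lock rpredB // char_vchar // set_char_char.
- have dotE i j s : (i <= #|D|)%N -> (j <= #|D|)%N -> uniq s ->
      (forall t, (t < #|D|.+1)%N && [&& t <= i, t <= j & i + j <= #|D| + t]%N = (t \in s)) ->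
      '[set_char D false i, set_char D false j] = (size s)%:R.
    move=> iD jD Us sP; rewrite set_char_dot //=; congr (_%:R).
    rewrite -(@sum_ord_indicator #|D|.+1 (fun t => [&& t <= i, t <= j & i + j <= #|D| + t]%N) s) //.
    by apply: eq_bigr => t _; rewrite andbT.
  (* The lists give the possible sizes of an intersection; two 2-subsets can be disjoint because D
     has at least four points. The norm is 3 - 2 - 2 + 2 = 1. *)
  have d22 := dotE 2 2 [:: 0; 1; 2]%N D2 D2 isT.
  have d21 := dotE 2 1 [:: 0; 1]%N D2 D1 isT.
  have d11 := dotE 1 1 [:: 0; 1]%N D1 D1 isT.
  rewrite /pairc -lock cfdotBl !cfdotBr [X in _ - (X - _)]cfdotC d22 ?d21 ?d11 ?conjC_nat /=.
  + by ring.
  + by move=> t; rewrite !inE; lia.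
  + by move=> t; rewrite !inE; lia.
  + by move=> t; rewrite !inE; lia.
- rewrite pairc_deg // divr_gt0 ?ltr0n // mulr_gt0 ?ltr0n // subr_gt0.
  by rewrite ltr_nat.
Qed.

Lemma std_sqr D : (1 < #|D|)%N -> std D * std D = 1 + std D + hook D 2 + pairc D.
Proof.
move=> D1; have D0 := ltnW D1; apply/cfun_inP => g gD.
rewrite !cfunE stdE // hook2E // paircE // cfun1E gD /=.
by field.
Qed.

Lemma nfix_D1 D x g : x \in D -> g \in SymOn (D :\ x) -> nfix D g = (nfix (D :\ x) g).+1.
Proof.
move=> xD gx; rewrite /nfix (cardsD1 x) inE xD /=.
have -> : g x == x by apply/eqP/(out_perm (S := D :\ x)); rewrite ?setD11 //; rewrite inE in gx.
by rewrite add1n; congr _.+1; apply: eq_card => y; rewrite !inE andbA.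
Qed.

Lemma std_Res D x : x \in D -> (1 < #|D|)%N ->
  'Res[SymOn (D :\ x)] (std D) = 1 + std (D :\ x).
Proof.
move=> xD D1; have D0 := ltnW D1; have cD : #|D| = #|D :\ x|.+1 by rewrite (cardsD1 x) xD.
apply/cfun_inP => g gD; have gD' := subsetP (subSym D x) _ gD.
rewrite cfResE ?subSym // cfunE !stdE //; last by rewrite cD in D1.
by rewrite cfun1E gD (nfix_D1 xD gD) -natr1 addrK addrC subrK.
Qed.

Lemma Ind1_Sym D x : x \in D -> (1 < #|D|)%N -> 'Ind[SymOn D, SymOn (D :\ x)] 1 = 1 + std D.
Proof.
move=> xD D1; have D0 := ltnW D1; apply/cfun_inP => g gD.
rewrite cfIndE ?subSym // cfunE stdE // cfun1E gD addrC subrK.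
transitivity (#|SymOn (D :\ x)|%:R^-1 * \sum_(y in SymOn D) (g (y x) == y x)%:R : algC).
  congr (_ * _); rewrite (reindex_inj invg_inj) /=; apply: eq_big => y; first by rewrite groupV.
  rewrite groupV => yD; rewrite cfun1E; congr (_%:R); congr nat_of_bool.
  have gyD : (g ^ y^-1)%g \in SymOn D by rewrite groupJ ?groupV.
  have -> : (g (y x) == y x) = ((g ^ y^-1)%g x == x).
    have -> : (g ^ y^-1)%g x = (y^-1)%g (g (y x)) by rewrite -{1}(permK y x) permJ.
    by rewrite -(inj_eq (@perm_inj _ y) (y^-1%g _)) permKV.
  rewrite inE; apply/subsetP/eqP => [s|fx z /[!inE] gz].
    by apply/eqP; apply: contraT => /(s x); rewrite !inE eqxx.
  have -> : z != x by apply: contraNneq gz => ->; rewrite fx.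
  by apply: contraR gz => zD; rewrite (out_perm _ zD) //; rewrite inE in gyD.
rewrite (@sum_orbit _ _ _ (fun (z : T) (y : {perm T}) => y z) D _ _ _ _ _ (fun z => (g z == z)%:R)) //.
- rewrite nfixE -[(\sum_(r in D) _) *+ _]mulr_natl (_ : [set y in _ | _] = SymOn (D :\ x)).
    by rewrite mulKf // neq0CG.
  apply/setP => y; rewrite [LHS]inE; apply/andP/idP => [[yD /eqP fx]|yx].
    rewrite inE; apply/subsetP => z /[!inE] gz.
    have -> : z != x by apply: contraNneq gz => ->; rewrite fx.
    by apply: contraR gz => zD; rewrite (out_perm _ zD) //; rewrite inE in yD.
  split; first exact: subsetP (subSym D x) _ yx.
  by apply/eqP/(out_perm (S := D :\ x)); rewrite ?setD11 //; rewrite inE in yx.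
- by move=> z y1 y2; rewrite permM.
- by move=> z; rewrite perm1.
- move=> y z yD zD; exists (tperm y z); last by rewrite tpermL.
  rewrite inE; apply: subset_trans (tperm_on y z) _.
  by apply/subsetP => w; rewrite !inE => /orP[]/eqP->.
- by move=> z y zD; rewrite inE => yD; rewrite (perm_closed _ yD).
Qed.

(** Write [std (D :\ x)] as a restriction minus 1. Inducing a restriction multiplies by the induced
    trivial character 1 + std, so the decomposition of [std * std] gives that of the induced
    character. *)
Lemma Ind_std D x : x \in D -> (1 < #|D|)%N ->
  'Ind[SymOn D] (std (D :\ x)) = std D + hook D 2 + pairc D.
Proof.
move=> xD D1; have -> : std (D :\ x) = 1 * 'Res[SymOn (D :\ x)] (std D) - 1.
  by rewrite mul1r std_Res // addrC addKr.
rewrite linearB /= cfIndM ?subSym // Ind1_Sym // mulrDl mul1r std_sqr //.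
by ring.
Qed.

(** This lemma and the next three stand in for the branching rule: they list the irreducible
    characters that can have an exceptional constituent on a point stabilizer. *)
Lemma constt_Res1 D x chi : x \in D -> (1 < #|D|)%N -> chi \in irr (SymOn D) ->
  '['Res[SymOn (D :\ x)] chi, 1] != 0 -> chi = 1 \/ chi = std D.
Proof.
move=> xD D1 Xchi; rewrite cfdot_Res_l Ind1_Sym // cfdotDr.
have [->|n1] := eqVneq chi 1; first by left.
rewrite irr_dot_eq0 // ?add0r => [nz|]; last by rewrite -irr0 mem_irr.
by right; apply: irr_dot_neq0 nz; rewrite ?std_irr.
Qed.

Lemma constt_Res_sgn D x chi : x \in D -> (1 < #|D|)%N -> chi \in irr (SymOn D) ->
  '['Res[SymOn (D :\ x)] chi, sgnc (D :\ x)] != 0 -> chi = sgnc D \/ chi = sgnc D * std D.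
Proof.
move=> xD D1 Xchi nz.
have {nz} nz : '['Res[SymOn (D :\ x)] (sgnc D * chi), 1] != 0.
  by rewrite sgnc_Res sgnc_dot mulr1.
have eqchi : chi = sgnc D * (sgnc D * chi) by rewrite mulrA sgncM mul1r.
have [|e|e] := constt_Res1 xD D1 _ nz; rewrite ?sgnc_irr //.
  by left; rewrite eqchi e mulr1.
by right; rewrite [LHS]eqchi e.
Qed.

Lemma constt_Res_std D x chi : x \in D -> (4 <= #|D|)%N -> chi \in irr (SymOn D) ->
  '['Res[SymOn (D :\ x)] chi, std (D :\ x)] != 0 -> [\/ chi = std D, chi = hook D 2 | chi = pairc D].
Proof.
move=> xD D4 Xchi; have D1 : (1 < #|D|)%N by lia.
rewrite cfdot_Res_l Ind_std // !cfdotDr.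
have [->|n1] := eqVneq chi (std D); first by constructor 1.
rewrite irr_dot_eq0 ?std_irr // add0r.
have [->|n2] := eqVneq chi (hook D 2); first by constructor 2.
rewrite irr_dot_eq0 ?hook_irr ?add0r //; last by lia.
by move=> nz; constructor 3; apply: irr_dot_neq0 nz; rewrite ?pairc_irr.
Qed.

Lemma constt_Res_sgn_std D x chi : x \in D -> (4 <= #|D|)%N -> chi \in irr (SymOn D) ->
  '['Res[SymOn (D :\ x)] chi, sgnc (D :\ x) * std (D :\ x)] != 0 ->
  [\/ chi = sgnc D * std D, chi = sgnc D * hook D 2 | chi = sgnc D * pairc D].
Proof.
move=> xD D1 Xchi; rewrite -sgnc_dot -sgnc_Res => nz.
have eqchi : chi = sgnc D * (sgnc D * chi) by rewrite mulrA sgncM mul1r.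
have [|e|e|e] := constt_Res_std xD D1 _ nz; rewrite ?sgnc_irr //.
- by constructor 1; rewrite [LHS]eqchi e.
- by constructor 2; rewrite [LHS]eqchi e.
- by constructor 3; rewrite [LHS]eqchi e.
Qed.

Definition special D (chi : 'CF(SymOn D)) :=
  chi \in [:: 1; sgnc D; std D; sgnc D * std D].

End SymCharacters.

(** * Bounds on normalized characters at cycles *)

Section SchurTrace.

Variables (gT : finGroupType) (G H : {group gT}).

(** Since the representation stays irreducible on H, Schur's lemma makes t act by a scalar, which is
    nonzero because t is invertible. *)
Lemma irr_Res_cent_neq0 (chi : 'CF(G)) t : H \subset G -> chi \is a character ->
  'Res[H] chi \in irr H -> t \in G -> t \in 'C(H)%g -> chi t != 0.
Proof.
move=> sHG /char_reprP[rG ->]; rewrite -(cfRepr_sub _ sHG) => /irr_reprP[rH irrH def_rH] tG tC.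
have irrG : mx_irreducible (subg_repr rG sHG).
  by apply: mx_rsim_irr irrH; apply/cfRepr_rsimP/eqP.
have [a def_a] : exists a, rG t = a%:M.
  apply/is_scalar_mxP; apply: (mx_abs_irr_cent_scalar (groupC irrG)).
  apply/centgmxP => x Hx; have Gx := subsetP sHG x Hx.
  by rewrite /= -!repr_mxM // (centP tC).
have n0 : (0 < rdegree rG)%N by case/mx_irrP: irrG.
rewrite cfunE tG def_a mxtrace_scalar mulr1n mulrn_eq0 negb_or -lt0n n0 /=.
apply/eqP => a0; have := congr1 mxtrace (repr_mxM rG tG (groupVr tG)).
rewrite mulgV repr_mx1 def_a a0 mul_scalar_mx scale0r mxtrace0 mxtrace1 => /eqP.
by rewrite pnatr_eq0 eqn0Ngt n0.
Qed.

End SchurTrace.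

(** * Values on cycles of length m and m - 1 in S_m *)

Section CycleBounds.

Variable T : finType.
Implicit Types (g h c : {perm T}) (D : {set T}).

Lemma exists_tperm D : (1 < #|D|)%N -> exists2 t, t \in SymOn D & kcycle 2 t.
Proof. by move=> D1; apply: kcycle_exists. Qed.

Lemma sgnc_kcycle D k c : (1 < k)%N -> kcycle k c -> c \in SymOn D ->
  sgnc D c = (-1) ^+ (~~ odd k).
Proof. by move=> k1 kc cD; rewrite sgncE // (odd_kcycle k1 kc). Qed.

Lemma std_kcycle D k c : (1 < k)%N -> kcycle k c -> c \in SymOn D ->
  std D c = (#|D| - k)%:R - 1.
Proof.
move=> k1 kc cD; have kD := kcycle_le k1 kc cD.
rewrite stdE //; last lia.
by rewrite /nfix (card_fix_kcycle k1 kc cD).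
Qed.

Lemma sgnc_neq D (phi : 'CF(SymOn D)) t : t \in SymOn D -> kcycle 2 t -> phi t != 0 ->
  sgnc D * phi != phi.
Proof.
move=> tD kt; apply: contraNneq => e; have := congr1 (fun f : 'CF(_) => f t) e.
rewrite cfunE (sgnc_kcycle _ kt tD) //= mulN1r => /eqP.
by rewrite eq_sym -addr_eq0 -mulr2n mulrn_eq0.
Qed.

Lemma sgnc_neq1 D : (1 < #|D|)%N -> sgnc D != 1.
Proof.
move=> D1; have [t tD kt] := exists_tperm D1.
by rewrite -[sgnc D]mulr1 (sgnc_neq tD kt) // cfun1E tD oner_eq0.
Qed.

Lemma sgnc_std_neq D : (4 <= #|D|)%N -> sgnc D * std D != std D.
Proof.
move=> D4; have [|t tD kt] := @exists_tperm D; first lia.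
rewrite (sgnc_neq tD kt) // (std_kcycle _ kt tD) // subr_eq0 pnatr_eq1; lia.
Qed.

Lemma bin_ge_n N j : (0 < j < N)%N -> (N <= 'C(N, j))%N.
Proof.
move=> jN; have [->|j1] := eqVneq j 1%N; first by rewrite bin1.
have [e|jN1] := eqVneq j.+1 N.
  by rewrite -e binSn.
apply: leq_trans (bin2_le_bin (j := j) _ _); try lia.
rewrite bin2 -divn2 leq_divRL //; nia.
Qed.

Lemma bin_gt_n N j : (1 < j)%N -> (j + 1 < N)%N -> (N < 'C(N, j))%N.
Proof.
move=> j1 jN; apply: leq_trans (bin2_le_bin (j := j) _ _); try lia.
rewrite bin2 -divn2 leq_divRL //; nia.
Qed.

Lemma irr_full_cycle D c theta : (4 <= #|D|)%N -> kcycle #|D| c -> c \in SymOn D ->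
  theta \in irr (SymOn D) -> theta c != 0 -> ~~ special theta ->
  exists j, [/\ (2 <= j)%N, (j + 3 <= #|D|)%N & theta = hook D j].
Proof.
move=> D4 kc cD; have D1 : (1 < #|D|)%N by lia.
have hk (psi : 'CF(SymOn D)) : psi \in irr (SymOn D) -> psi c != 0 ->
    exists2 j, (j < #|D|)%N & psi = hook D j.
  move=> Xpsi nz; pose L := [seq hook D j | j <- iota 0 #|D|].
  case: (boolP (psi \in L)) => [/mapP[j]|nL].
    by rewrite mem_iota => /andP[_ jD] ->; exists j.
  have : \sum_(chi <- psi :: L) `|chi c| ^+ 2 <= #|'C_(SymOn D)[c]%g|%:R.
    apply: column_sum_le => //= [|chi].
      rewrite nL /= map_inj_in_uniq ?iota_uniq // => i j; rewrite !mem_iota /= => iD jD.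
      by apply: contra_eq => /(hook_neq iD jD).
    rewrite inE => /orP[/eqP->//|/mapP[j]]; rewrite mem_iota /= => jD ->.
    exact: hook_irr.
  rewrite (card_cent_kcycle D1 kc cD) subnn muln1 big_cons big_map.
  rewrite (eq_big_seq (fun=> 1%N%:R)) => [|j]; last first.
    rewrite mem_iota /= => jD.
    by rewrite (hook_full_cycle D1 kc cD jD) normrX normrN1 !expr1n.
  rewrite -natr_sum sum1_size size_iota gerDr => le0.
  have := exprn_gt0 2 (_ : 0 < `|psi c|); rewrite normr_gt0 => /(_ nz).
  by move=> /lt_le_trans/(_ le0); rewrite ltxx.
(* The sign does not vanish at c, hence is a hook; degree 1 and [sgnc D != 1] leave only the last
   index. Likewise degree |D| - 1 leaves only the last but one for the product with [std D]. A
   nonspecial hook thus has an index from 2 to |D| - 3. *)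
have sgn_hook : sgnc D = hook D #|D|.-1.
  have [||j jD e] := hk (sgnc D); first exact/lin_char_irr/sgnc_lin.
    by rewrite lin_char_neq0 ?sgnc_lin.
  have := hook_deg jD; rewrite -e (lin_char1 (sgnc_lin D)) => /esym/eqP.
  rewrite pnatr_eq1 => /eqP cj; rewrite e; congr hook.
  have [j0|jn0] := eqVneq j 0%N.
    by move: (sgnc_neq1 D1); rewrite e j0 hook0 eqxx.
  by have := @bin_ge_n #|D|.-1 j; lia.
have sgn_std_hook : sgnc D * std D = hook D #|D|.-2.
  have Xss : sgnc D * std D \in irr (SymOn D) by rewrite sgnc_irr std_irr.
  have [||j jD e] := hk (sgnc D * std D) => //.
    rewrite -normr_gt0 sgnc_norm normr_gt0 (hook_full_cycle D1 kc cD) //.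
    by rewrite expr1 oppr_eq0 oner_eq0.
  have := hook_deg jD; rewrite -e sgnc_deg std_deg // => /esym/eqP.
  rewrite eqr_nat => /eqP cj; rewrite e; congr hook.
  have [j0|jn0] := eqVneq j 0%N; first by move: cj; rewrite j0 bin0; lia.
  have [j1|jn1] := eqVneq j 1%N; first by move: (sgnc_std_neq D4); rewrite e j1 eqxx.
  have [jN|jnN] := eqVneq j #|D|.-1; first by move: cj; rewrite jN binn; lia.
  by have := @bin_gt_n #|D|.-1 j; lia.
move=> Xt nz; have [j jD ->] := hk _ Xt nz => nsp; exists j; split => //.
  case: j jD nsp => [|[|j]] // jD; rewrite /special !inE ?hook0 ?eqxx ?orbT //.
have [e|n1] := eqVneq j #|D|.-1.
  by move: nsp; rewrite /special e -sgn_hook !inE eqxx orbT.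
have [e|n2] := eqVneq j #|D|.-2.
  by move: nsp; rewrite /special e -sgn_std_hook !inE eqxx !orbT.
lia.
Qed.

Definition nonlinear D (chi : 'CF(SymOn D)) := (chi != 1) && (chi != sgnc D).

(** Let m = |D|. If the restriction has a special constituent, psi is up to sign [std D], [hook D 2]
    or [pairc D], with values 0, 0, -1 on c; the degree m(m-3)/2 of the last equals m exactly for m
    = 5. Otherwise only hooks of index 2 to m-4 contribute, with values 1 or -1 and degrees at least
    C(m-2, 2), which equals m exactly for m = 6. These are the exceptions to strictness. *)
Lemma irr_near_full_cycle D x c psi : (5 <= #|D|)%N -> x \in D ->
    kcycle #|D|.-1 c -> c \in SymOn (D :\ x) -> psi \in irr (SymOn D) -> nonlinear psi ->
  #|D|%:R * `|psi c| <= 1 * psi 1%g /\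
  ((5 < #|D|)%N -> #|D|%:R * `|psi c| < 1 * psi 1%g \/
    #|D| = 6%N /\ forall theta, theta \in irr (SymOn (D :\ x)) ->
        '['Res[SymOn (D :\ x)] psi, theta] != 0 -> theta = hook (D :\ x) 2).
Proof.
move=> D5 xD kc cD' Xpsi /andP[n1 ns]; have cD := subsetP (subSym D x) _ cD'.
have [D1 D4] : (1 < #|D|)%N /\ (4 <= #|D|)%N by lia.
have cardD' : #|D :\ x| = #|D|.-1 by rewrite (cardsD1 x D) xD.
have k1 : (1 < #|D|.-1)%N by lia.
have nf1 : nfix D c = 1%N by rewrite /nfix (card_fix_kcycle k1 kc cD); lia.
have nf2 : nfix D (c * c)%g = 1%N.
  by rewrite /nfix (card_fix_kcycle_sqr _ kc cD); lia.
have std0 : std D c = 0 by rewrite stdE // ?nf1 ?subrr //; lia.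
have hook0 : hook D 2 c = 0 by rewrite hook2E // nf1 nf2; field.
have pair1 : pairc D c = -1 by rewrite paircE // nf1 nf2; field.
pose good (phi : 'CF(SymOn D)) := #|D|%:R * `|phi c| <= 1 * phi 1%g /\
  ((5 < #|D|)%N -> #|D|%:R * `|phi c| < 1 * phi 1%g).
have goodW phi : psi = phi -> good phi -> #|D|%:R * `|psi c| <= 1 * psi 1%g /\
  ((5 < #|D|)%N -> #|D|%:R * `|psi c| < 1 * psi 1%g \/
    #|D| = 6%N /\ forall theta, theta \in irr (SymOn (D :\ x)) ->
        '['Res[SymOn (D :\ x)] psi, theta] != 0 -> theta = hook (D :\ x) 2).
  by move=> -> [g1 g2]; split=> // /g2; left.
have good0 phi : phi \in irr (SymOn D) -> phi c = 0 -> good phi.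
  move=> Xphi p0; have := irr_deg_gt0 Xphi; rewrite /good p0 normr0 mulr0 mul1r.
  by move=> gt0; split=> //; apply: ltW.
have good_sgn phi : good phi -> good (sgnc D * phi) by rewrite /good sgnc_norm sgnc_deg.
have good_std : good (std D) by apply: good0; rewrite ?std_irr.
have good_hook : good (hook D 2) by apply: good0; rewrite ?hook_irr //; lia.
have good_pair : good (pairc D).
  rewrite /good pair1 normrN1 mulr1 mul1r pairc_deg //.
  have -> : #|D|%:R = (#|D| - 5)%:R + 5 :> algC by rewrite -natrD subnK.
  set y := (#|D| - 5)%:R : algC; have y0 : 0 <= y by rewrite ler0n.
  have e : (y + 5) * (y + 5 - 3) / 2 - (y + 5) = y * (y + 5) / 2 by field.
  rewrite -subr_ge0 e -subr_gt0 e; split=> [|D6].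
    by rewrite divr_ge0 ?ler0n // mulr_ge0 // addr_ge0 ?ler0n.
  by rewrite divr_gt0 ?ltr0n // mulr_gt0 ?ltr0n ?subn_gt0 // ltr_wpDl ?ltr0n.
case: (boolP (has (fun th => '['Res[SymOn (D :\ x)] psi, th] != 0)
   [:: 1; sgnc (D :\ x); std (D :\ x); sgnc (D :\ x) * std (D :\ x)])) => [|nosp].
  rewrite /= orbF => /or4P[] nz.
  - have [e|e] := constt_Res1 xD D1 Xpsi nz; first by rewrite e eqxx in n1.
    exact: goodW e good_std.
  - have [e|e] := constt_Res_sgn xD D1 Xpsi nz; first by rewrite e eqxx in ns.
    exact: goodW e (good_sgn _ good_std).
  - by have [e|e|e] := constt_Res_std xD D4 Xpsi nz; apply: (goodW _ e).
  - by have [e|e|e] := constt_Res_sgn_std xD D4 Xpsi nz; apply: (goodW _ e); apply: good_sgn.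
have Nres : 'Res[SymOn (D :\ x)] psi \is a character by rewrite cfRes_char // irrWchar.
have nsp theta : '['Res[SymOn (D :\ x)] psi, theta] != 0 -> ~~ special theta.
  by move=> nz; apply: contra nosp => sp; apply/hasP; exists theta.
have D'4 : (4 <= #|D :\ x|)%N by rewrite cardD'; move: D5; clear; lia.
have D'1 : (1 < #|D :\ x|)%N by rewrite cardD'.
have kc' : kcycle #|D :\ x| c by rewrite cardD'.
have hookb theta : theta \in irr (SymOn (D :\ x)) -> '['Res[SymOn (D :\ x)] psi, theta] != 0 ->
    theta c = 0 \/ exists2 j, (2 <= j)%N && (j + 4 <= #|D|)%N & theta = hook (D :\ x) j.
  move=> Xt nz; have [t0|tn0] := eqVneq (theta c) 0; first by left.
  have [j [j2 jD ->]] := irr_full_cycle D'4 kc' cD' Xt tn0 (nsp _ nz).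
  by right; exists j => //; move: j2 jD; rewrite cardD'; clear; lia.
have hookv j : (2 <= j)%N && (j + 4 <= #|D|)%N -> #|D|%:R * `|hook (D :\ x) j c| <= 1 * hook (D :\ x) j 1%g
   /\ ((6 < #|D|)%N -> #|D|%:R * `|hook (D :\ x) j c| < 1 * hook (D :\ x) j 1%g).
  move=> hj; have jD' : (j < #|D :\ x|)%N by rewrite cardD'; move: hj; clear; lia.
  rewrite (hook_full_cycle D'1 kc' cD' jD') normrX normrN1 expr1n mulr1 mul1r hook_deg //.
  rewrite ler_nat ltr_nat cardD'; have := @bin2_le_bin #|D|.-2 j.
  have := bin2 #|D|.-2; rewrite -divn2 => e2 hb.
  have {}hb : ('C(#|D|.-2, 2) <= 'C(#|D|.-2, j))%N by apply: hb; move: hj; clear; lia.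
  have h2 : ((#|D| <= 'C(#|D|.-2, 2)) && ((6 < #|D|) ==> (#|D| < 'C(#|D|.-2, 2))))%N.
    rewrite e2 !leq_divRL //; move: D5 hj; clear => D5 hj.
    by apply/andP; split; [nia | apply/implyP; nia].
  by case/andP: h2 => h2 /implyP h3; split=> [|/h3 {}h3]; [apply: leq_trans h2 hb|apply: leq_trans h3 hb].
have bound theta : theta \in irr (SymOn (D :\ x)) -> '['Res[SymOn (D :\ x)] psi, theta] != 0 ->
    #|D|%:R * `|theta c| <= 1 * theta 1%g.
  move=> Xt nz; have [t0|[j hj ->]] := hookb _ Xt nz; last by case: (hookv j hj).
  by rewrite t0 normr0 mulr0 mul1r ltW // irr_deg_gt0.
have resE : psi c = 'Res[SymOn (D :\ x)] psi c by rewrite cfResE ?subSym.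
have res1 : psi 1%g = 'Res[SymOn (D :\ x)] psi 1%g by rewrite cfRes1.
split; first by rewrite resE res1; apply: char_average_le; rewrite ?ler0n.
move=> D6; have strict theta : theta \in irr (SymOn (D :\ x)) ->
    '['Res[SymOn (D :\ x)] psi, theta] != 0 ->
    #|D|%:R * `|theta c| < 1 * theta 1%g -> #|D|%:R * `|psi c| < 1 * psi 1%g.
  by move=> Xt nz lt; rewrite resE res1; apply: char_average_lt Xt nz lt; rewrite ?ler0n.
case: (boolP [forall i : Iirr (SymOn (D :\ x)),
   ('['Res[SymOn (D :\ x)] psi, 'chi_i] != 0) ==> ('chi_i == hook (D :\ x) 2)]).
  move/forallP => all2; have [D7|] := ltnP 6 #|D|.
    left; have [|theta Xt nz] := @char_constt _ _ ('Res[SymOn (D :\ x)] psi).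
      by rewrite cfRes_eq0 ?irrWchar //; have [i ->] := irrP Xpsi; apply: irr_neq0.
    apply: (strict _ Xt nz); have [t0|[j hj ->]] := hookb _ Xt nz.
      by rewrite t0 normr0 mulr0 mul1r irr_deg_gt0.
    by case: (hookv j hj) => _; apply.
  move=> D6'; right; split; first by apply/eqP; rewrite eqn_leq D6' D6.
  move=> theta /irrP[i ->] nz; apply/eqP; exact: implyP (all2 i) nz.
rewrite negb_forall => /existsP[i]; rewrite negb_imply => /andP[nz n2]; left.
apply: (strict 'chi_i) => //; first exact: mem_irr.
have [t0|[j hj e]] := hookb _ (mem_irr i) nz.
  by rewrite t0 normr0 mulr0 mul1r irr1_gt0.
rewrite e; case: (hookv j hj) => _; apply.
have : j != 2%N by apply: contraNneq n2 => <-; rewrite e.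
move: hj; clear; lia.
Qed.

End CycleBounds.

(** * The normalized bound on k-cycles *)

Section NormalizedBounds.

Variable T : finType.
Implicit Types (g h c : {perm T}) (D E : {set T}).

Lemma special_uniq D : (4 <= #|D|)%N -> uniq [:: 1; sgnc D; std D; sgnc D * std D].
Proof.
move=> D4; have D1 : (1 < #|D|)%N by lia.
have neq1 (f h : 'CF(SymOn D)) : f 1%g = 1 -> h 1%g = (#|D|.-1)%:R -> (f == h) = false.
  move=> f1 h1; apply/eqP => e; move: f1; rewrite e h1 => /eqP.
  by rewrite pnatr_eq1; lia.
have s1 : sgnc D 1%g = 1 by rewrite (lin_char1 (sgnc_lin D)).
have e1 : (1 : 'CF(SymOn D)) 1%g = 1 by rewrite cfun1E group1.
have d1 := std_deg D1; have d2 : (sgnc D * std D) 1%g = (#|D|.-1)%:R by rewrite sgnc_deg.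
rewrite /= !inE (neq1 1 (std D)) // (neq1 1 (sgnc D * std D)) //.
rewrite (neq1 (sgnc D) (std D)) // (neq1 (sgnc D) (sgnc D * std D)) // !orbF andbT.
by rewrite eq_sym sgnc_neq1 //= eq_sym sgnc_std_neq.
Qed.

Lemma special_irr D : (4 <= #|D|)%N ->
  {subset [:: 1; sgnc D; std D; sgnc D * std D] <= irr (SymOn D)}.
Proof.
move=> D4 chi; have D1 : (1 < #|D|)%N by lia.
rewrite !inE => /or4P[]/eqP->; rewrite ?sgnc_irr ?std_irr //; first by rewrite -irr0 mem_irr.
exact/lin_char_irr/sgnc_lin.
Qed.

(** The special characters take the share 1 + 1 + 2(|D| - k - 1)^2 of the column norm; only the rest
    is left for [L]. *)
Lemma column_nonspecial D k c L : (4 <= #|D|)%N -> (1 < k)%N -> kcycle k c -> c \in SymOn D ->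
  uniq L -> {subset L <= irr (SymOn D)} -> ~~ has (@special T D) L ->
  \sum_(chi <- L) `|chi c| ^+ 2 + (2 + `|(#|D| - k)%:R - 1 : algC| ^+ 2 *+ 2)
    <= (k * (#|D| - k)`!)%:R.
Proof.
move=> D4 k1 kc cD UL sL nsp; pose S := [:: 1; sgnc D; std D; sgnc D * std D].
have : \sum_(chi <- L ++ S) `|chi c| ^+ 2 <= #|'C_(SymOn D)[c]%g|%:R.
  apply: column_sum_le => //.
    rewrite cat_uniq UL special_uniq // andbT; apply/hasPn => chi Sc.
    by apply: contra nsp => Lc; apply/hasP; exists chi.
  by move=> chi; rewrite mem_cat => /orP[/sL//|]; apply: special_irr.
rewrite (card_cent_kcycle k1 kc cD) big_cat /=; apply: le_trans.
rewrite lerD2l !big_cons big_nil sgnc_norm (std_kcycle k1 kc cD) cfun1E cD.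
rewrite normr1 -[sgnc D]mulr1 sgnc_norm cfun1E cD normr1 expr1n addr0 mulr2n.
by rewrite addrA.
Qed.

(* The only possible equality case: the restriction of chi to S_5 would be r copies
   of the second hook character; r = 1 contradicts Schur's lemma for a transposition
   commuting with S_5, r = 2 the column norm of a 7-cycle. *)
Lemma seven_contradiction D x y c chi : #|D| = 7%N -> x \in D -> y \in D :\ x ->
    kcycle 5 c -> c \in SymOn (D :\ x :\ y) -> chi \in irr (SymOn D) -> ~~ special chi ->
  (forall theta, theta \in irr (SymOn (D :\ x :\ y)) ->
     '['Res[SymOn (D :\ x :\ y)] chi, theta] != 0 -> theta = hook (D :\ x :\ y) 2) ->
  False.
Proof.
set E := D :\ x :\ y => D7 xD yD kc cE Xchi nsp all2.
have cardE : #|E| = 5%N.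
  by move: D7; rewrite (cardsD1 x) xD (cardsD1 y (D :\ x)) yD -/E; lia.
have sED : SymOn E \subset SymOn D := subset_trans (subSym _ _) (subSym _ _).
have cD := subsetP sED c cE; have Nchi := irrWchar Xchi.
have E1 : (1 < #|E|)%N by rewrite cardE.
have E2 : (2 < #|E|)%N by rewrite cardE.
have D4 : (4 <= #|D|)%N by rewrite D7.
set R := 'Res[SymOn E] chi in all2; have NR : R \is a character by apply: cfRes_char.
have Xh := hook_irr E2.
have [r Dr] : exists r : nat, '[R, hook E 2] = r%:R.
  by apply/natrP; rewrite Cnat_cfdot_char // irrWchar.
have RE : R = r%:R *: hook E 2.
  have [i0 Di0] := irrP Xh; rewrite [LHS]cfun_sum_cfdot (bigD1 i0) //= -Di0 Dr.
  rewrite big1 ?addr0 // => i ni; apply/eqP; rewrite scaler_eq0.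
  case: (boolP (_ == 0)) => //= nz.
  by have := all2 _ (mem_irr i) nz; rewrite Di0 => /irr_inj ei; rewrite ei eqxx in ni.
have chiE g : g \in SymOn E -> chi g = r%:R * hook E 2 g.
  by move=> gE; rewrite -(cfResE chi sED gE) -/R RE cfunE.
have chi1 : chi 1%g = (6 * r)%:R.
  by rewrite chiE ?group1 // hook_deg // cardE natrM mulrC.
have chic : chi c = r%:R.
  by rewrite chiE // (hook_full_cycle E1 _ cE) ?cardE // expr2 mulrNN !mulr1.
have nhas : ~~ has (@special T D) [:: chi] by rewrite /= orbF.
have U1 : uniq [:: chi] by [].
have sub1 : {subset [:: chi] <= irr (SymOn D)} by move=> f; rewrite inE => /eqP->.
have := column_nonspecial D4 (isT : 1 < 5)%N kc cD U1 sub1 nhas.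
rewrite D7 big_seq1 chic normr_nat -(natrB _ (isT : 1 <= 7 - 5)%N) normr_nat.
rewrite -!natrX -mulrnA -!natrD ler_nat => r_le.
(* The column norm is 5 * 2! = 10, of which the special characters use 4. *)
have {}r_le : (r ^ 2 + 4 <= 10)%N := r_le.
have r2 : (r <= 2)%N by move: r_le; rewrite -mulnn; clear; nia.
case: r r2 r_le RE chiE chi1 chic {Dr} => [|[|[|//]]] _ _ RE chiE chi1 chic.
- by have := irr_deg_gt0 Xchi; rewrite chi1 muln0 ltxx.
- have nxy : x != y by move: yD; rewrite !inE => /andP[]; rewrite eq_sym.
  have tD : tperm x y \in SymOn D.
    rewrite inE; apply: subset_trans (tperm_on x y) _.
    by apply/subsetP => z; rewrite !inE => /orP[]/eqP-> //; move: yD; rewrite inE => /andP[].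
  have tC : tperm x y \in 'C(SymOn E)%g.
    apply/centP => g gE; apply: (perm_onC (S1 := [set x; y]) (S2 := E)).
    + exact: tperm_on.
    + by rewrite inE in gE.
    + rewrite -setI_eq0; apply/eqP/setP => z; rewrite !inE.
      by case: (z =P x) => //=; case: (z =P y) => //=; rewrite andbF.
  have XR : 'Res[SymOn E] chi \in irr (SymOn E) by rewrite -/R RE scale1r.
  have := irr_Res_cent_neq0 sED Nchi XR tD tC.
  (* [tperm x y] centralizes [SymOn E] and is conjugate to a transposition of E, where [hook E 2]
     has the value (9 - 5)/2 - 3 + 1 = 0. *)
  have [t tE kt] := exists_tperm E1; have tD' := subsetP sED t tE.
  have [g gD ->] := kcycle_conj (ltnSn 1) kt (kcycle_tperm nxy) tD' tD.
  rewrite cfunJ // chiE // hook2E // (kcycle2_sqr kt) nfix1 /nfix.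
  rewrite (card_fix_kcycle _ kt tE) // cardE.
  rewrite -[(5 - 2)%N]/3%N.
  have -> : (3%:R ^+ 2 - 5%:R) / 2 - 3%:R + 1 = 0 :> algC by field.
  by rewrite mulr0 eqxx.
- have [g gD kg] : exists2 g, g \in SymOn D & kcycle 7 g by apply: kcycle_exists; rewrite D7.
  have := column_nonspecial D4 (isT : 1 < 7)%N kg gD U1 sub1 nhas.
  rewrite D7 big_seq1 subnn sub0r normrN1 => v_le.
  have og := order_kcycle (isT : 1 < 7)%N kg.
  have sZ : <[g]>%g \subset SymOn D by rewrite cycle_subG.
  have [k Dk] : exists k : nat, '['Res[<[g]>] chi, 1] = k%:R.
    by apply/natrP; rewrite Cnat_cfdot_char ?cfRes_char ?rpred1.
  (* All nontrivial powers of a 7-cycle are conjugate, so the multiplicity k of the trivial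
     character on [<[g]>] satisfies 7k = 12 + 6 chi(g). Hence chi(g) is rational, so an integer, and
     congruent to -2 modulo 7; but the column norm 7, less 4 for the special characters, leaves only
     -1, 0 and 1. *)
  have : '['Res[<[g]>] chi, 1] *+ 7 = chi 1%g + chi g *+ 6.
    rewrite cfdotE -orderE og; set S := \sum_(z in _) _.
    have -> : 7%:R^-1 * S *+ 7 = S by rewrite -mulrnAr -[S *+ 7]mulr_natl mulKf ?pnatr_eq0.
    rewrite {}/S.
    rewrite (bigD1 1%g) //= cfResE // cfun1E group1 conjC1 mulr1; congr (_ + _).
    rewrite (eq_bigr (fun=> chi g)) => [|z /andP[zZ nz]].
      rewrite sumr_const; congr (_ *+ _).
      by have := cardsD1 1%g <[g]>%g; rewrite group1 -orderE og add1n => -[->]; apply: eq_card => z; rewrite !inE andbC.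
    rewrite cfResE // cfun1E zZ conjC1 mulr1.
    case/cycleP: (zZ) => i Dz; have co : coprime 7 i.
      rewrite prime_coprime //; apply: contra nz => /dvdnP[q Dq].
      by rewrite Dz Dq mulnC expgM -og expg_order expg1n.
    have kz : kcycle 7 z by rewrite Dz kcycleX.
    have zD := subsetP sZ z zZ.
    have [h hD ->] := kcycle_conj (isT : 1 < 7)%N kg kz gD zD.
    by rewrite cfunJ.
  rewrite Dk chi1 => eqk.
  have vE : chi g = (7 * k)%:R / 6 - 2.
    have -> : chi g = (chi g *+ 6) / 6 by rewrite -[chi g *+ 6]mulr_natr mulfK ?pnatr_eq0.
    have -> : chi g *+ 6 = k%:R *+ 7 - (6 * 2)%:R by rewrite eqk [RHS]addrAC subrr add0r.
    by rewrite -mulrnA mulnC; field.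
  have vint : chi g \in Num.int.
    apply: Cint_rat_Aint; last exact: Aint_char.
    by rewrite vE rpredB ?rpred_div ?rpred_nat.
  have [m Dm] := intrP vint.
  have m_eq : (7 * k)%:R = (m * 6 + 12)%:~R :> algC.
    by rewrite intrD intrM -Dm vE; field.
  have {}m_eq : (7 * k)%:Z = m * 6 + 12 by apply/eqP; rewrite -(eqr_int algC) -m_eq.
  move: v_le; rewrite Dm real_normK ?realz // expr1n.
  have -> : 2 + 1 *+ 2 = (Posz 4)%:~R :> algC by rewrite -pmulrn; ring.
  rewrite -rmorphXn /= -intrD -[(7 * 0`!)%:R]/((Posz 7)%:~R) ler_int => m_le.
  have m_range : (-1 <= m) && (m <= 1) by move: m_le; rewrite expr2; clear; nia.
  by move: m_eq m_range; clear; lia.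
Qed.

(** A linear constituent on [D :\ x] would make chi special, so the bound for near full cycles
    applies to all of them. If strictness fails, every constituent is tight, which leaves |D| = 7
    and the second hook as the only constituent on [D :\ x :\ y]. *)
Lemma irr_conear_cycle D c chi : (6 <= #|D|)%N -> kcycle (#|D| - 2) c -> c \in SymOn D ->
  chi \in irr (SymOn D) -> ~~ special chi ->
  (#|D| - 1)%:R * `|chi c| <= 1 * chi 1%g /\
  ((7 <= #|D|)%N -> (#|D| - 1)%:R * `|chi c| < 1 * chi 1%g).
Proof.
move=> D6 kc cD Xchi nsp; have k1 : (1 < #|D| - 2)%N by lia.
have [|x xD cD'] := kcycle_avoid k1 kc cD; first lia.
have cardD' : #|D :\ x| = #|D|.-1 by rewrite (cardsD1 x D) xD.
have [|y yD cD''] := kcycle_avoid k1 kc cD'; first by rewrite cardD'; lia.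
have [D1 D'5] : (1 < #|D|)%N /\ (5 <= #|D :\ x|)%N by rewrite cardD'; lia.
have kc' : kcycle #|D :\ x|.-1 c by rewrite cardD' -subn2.
have Nchi := irrWchar Xchi.
have Nres : 'Res[SymOn (D :\ x)] chi \is a character by rewrite cfRes_char.
have nl psi : psi \in irr (SymOn (D :\ x)) -> '['Res[SymOn (D :\ x)] chi, psi] != 0 -> nonlinear psi.
  move=> Xpsi nz; apply/andP; split; apply: contraNneq nsp => e; rewrite e in nz.
    by have [->|->] := constt_Res1 xD D1 Xchi nz; rewrite /special !inE eqxx ?orbT.
  by have [->|->] := constt_Res_sgn xD D1 Xchi nz; rewrite /special !inE eqxx ?orbT.
have bnd psi Xpsi nz := irr_near_full_cycle D'5 yD kc' cD'' Xpsi (nl psi Xpsi nz).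
have cE : (#|D| - 1)%N = #|D :\ x| by rewrite cardD' subn1.
have resE : chi c = 'Res[SymOn (D :\ x)] chi c by rewrite cfResE ?subSym.
have res1 : chi 1%g = 'Res[SymOn (D :\ x)] chi 1%g by rewrite cfRes1.
rewrite cE resE res1; split; first by apply: char_average_le => // th Xt nz; case: (bnd th Xt nz).
move=> D7; have strict psi : psi \in irr (SymOn (D :\ x)) -> '['Res[SymOn (D :\ x)] chi, psi] != 0 ->
    #|D :\ x|%:R * `|psi c| < 1 * psi 1%g ->
    #|D :\ x|%:R * `|'Res[SymOn (D :\ x)] chi c| < 1 * 'Res[SymOn (D :\ x)] chi 1%g.
  move=> Xpsi nz lt; apply: char_average_lt Xpsi nz lt => // th Xt nz'.
  by case: (bnd th Xt nz').
have D'6 : (5 < #|D :\ x|)%N by rewrite cardD'; move: D7; clear; lia.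
case: (boolP [exists i : Iirr (SymOn (D :\ x)), ('['Res[SymOn (D :\ x)] chi, 'chi_i] != 0)
   && (#|D :\ x|%:R * `|'chi_i c| < 1 * 'chi_i 1%g)]) => [/existsP[i /andP[nz lt]]|].
  exact: strict (mem_irr i) nz lt.
rewrite negb_exists => /forallP nolt; exfalso.
have tight psi (Xpsi : psi \in irr (SymOn (D :\ x))) (nz : '['Res[SymOn (D :\ x)] chi, psi] != 0) :
    #|D :\ x| = 6%N /\ forall theta, theta \in irr (SymOn (D :\ x :\ y)) ->
        '['Res[SymOn (D :\ x :\ y)] psi, theta] != 0 -> theta = hook (D :\ x :\ y) 2.
  have [_ /(_ D'6)[lt|//]] := bnd psi Xpsi nz.
  have [i Di] := irrP Xpsi; have := nolt i; rewrite -Di nz lt //.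
have Rn0 : 'Res[SymOn (D :\ x)] chi != 0.
  by rewrite cfRes_eq0 //; have [i ->] := irrP Xchi; apply: irr_neq0.
have [psi0 Xpsi0 nz0] := char_constt Rn0; have [D6' _] := tight _ Xpsi0 nz0.
have D7' : #|D| = 7%N by move: D6' D7; rewrite cardD'; clear; lia.
have kc5 : kcycle 5 c by move: kc; rewrite D7'.
apply: (seven_contradiction D7' xD yD kc5 cD'' Xchi nsp) => theta Xt nz.
have [th Dt] := irrP Xt.
have : '['Res[SymOn (D :\ x :\ y)] ('Res[SymOn (D :\ x)] chi), theta] != 0.
  by rewrite cfResRes ?subSym.
(* A constituent of the double restriction already occurs in the restriction of some constituent of
   the first one. *)
rewrite cfdot_Res_l => nzI; pose Ith := 'Ind[SymOn (D :\ x)] theta.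
have [i nzi] : exists i, '['Res[SymOn (D :\ x)] chi, 'chi_i] * '['chi_i, Ith] != 0.
  apply/existsP; apply: contraNT nzI; rewrite negb_exists => /forallP z0.
  rewrite cfdot_sum_irr big1 // => i _; have := z0 i; rewrite negbK => /eqP <-.
  by congr (_ * _); rewrite [RHS]cfdotC.
move: nzi; rewrite mulf_eq0 negb_or => /andP[nz1 nz2].
have [_ all2] := tight _ (mem_irr i) nz1.
by apply: all2 => //; rewrite cfdot_Res_l.
Qed.

Lemma normalized_kcycle_bound D k c chi : (5 <= #|D|)%N -> (1 < k)%N -> (k <= #|D| - 2)%N ->
    kcycle k c -> c \in SymOn D -> chi \in irr (SymOn D) -> nonlinear chi ->
  (#|D| - 1)%:R * `|chi c| <= (#|D| - k - 1)%:R * chi 1%g /\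
  ((7 <= #|D|)%N -> ~~ special chi ->
     (#|D| - 1)%:R * `|chi c| < (#|D| - k - 1)%:R * chi 1%g).
Proof.
move: {2}#|D| (leqnn #|D|) => N; elim: N D chi => [|N IH] D chi DN D5 k1 kD kc cD Xchi nl.
  by move: DN D5; clear; lia.
have [D1 D4] : (1 < #|D|)%N /\ (4 <= #|D|)%N by move: D5; clear; lia.
have stdv : std D c = (#|D| - k - 1)%:R.
  by rewrite (std_kcycle k1 kc cD) [RHS]natrB //; move: D5 kD; clear; lia.
case: (boolP (special chi)) => [|nsp].
  case/andP: nl; rewrite /special !inE => /negPf-> /negPf-> /=.
  case/orP=> /eqP->; rewrite ?sgnc_norm ?sgnc_deg stdv std_deg // normr_nat mulrC -subn1 lexx;
    by split.
have [D5'|] := leqP #|D| 5.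
  have eD : #|D| = 5%N by move: D5 D5'; clear; lia.
  split; last by rewrite eD.
  have k23 : ((k == 2) || (k == 3))%N by move: k1 kD; rewrite eD; clear; lia.
  have pv : `|pairc D c| = 1.
    rewrite paircE // /nfix (card_fix_kcycle k1 kc cD) eD; case/orP: k23 => /eqP ek.
      rewrite ek in kc; rewrite (kcycle2_sqr kc) -/(nfix D 1) nfix1 eD ek.
      rewrite -[(5 - 2)%N]/3%N; have -> : (3%:R ^+ 2 + 5%:R) / 2 - 3%:R *+ 2 = 1 :> algC by field.
      by rewrite normr1.
    rewrite (card_fix_kcycle_sqr _ kc cD) ?ek // eD.
    rewrite -[(5 - 3)%N]/2%N; have -> : (2%:R ^+ 2 + 2%:R) / 2 - 2%:R *+ 2 = -1 :> algC by field.
    by rewrite normrN1.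
  have pd : pairc D 1%g = 5 by rewrite pairc_deg // eD; field.
  case: (boolP (chi \in [:: pairc D; sgnc D * pairc D])) => [|npc].
    rewrite !inE => /orP[]/eqP->; rewrite ?sgnc_norm ?sgnc_deg pv pd mulr1 -natrM ler_nat eD;
      by case/orP: k23 => /eqP->.
  suff -> : chi c = 0 by rewrite normr0 mulr0 mulr_ge0 ?ler0n // ltW // irr_deg_gt0.
  pose L := [:: chi; pairc D; sgnc D * pairc D].
  have spdeg (f : 'CF(SymOn D)) : special f -> f 1%g = 1 \/ f 1%g = 4.
    rewrite /special !inE => /or4P[]/eqP->; [left|left|right|right].
    - by rewrite cfun1E group1.
    - by rewrite (lin_char1 (sgnc_lin D)).
    - by rewrite std_deg // eD.
    - by rewrite sgnc_deg std_deg // eD.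
  have nsp5 (f : 'CF(SymOn D)) : f 1%g = 5 -> ~~ special f.
    by move=> f5; apply/negP => /spdeg; rewrite f5 => -[] /eqP; rewrite ?pnatr_eq1 ?eqr_nat.
  have UL : uniq L.
    rewrite /= npc !inE andbT /= eq_sym.
    have [|t tD kt] := @exists_tperm _ D; first by [].
    rewrite (sgnc_neq tD kt) // paircE // (kcycle2_sqr kt) nfix1 /nfix.
    rewrite (card_fix_kcycle _ kt tD) // eD.
    rewrite -[(5 - 2)%N]/3%N; have -> : (3%:R ^+ 2 + 5%:R) / 2 - 3%:R *+ 2 = 1 :> algC by field.
    exact: oner_neq0.
  have sL : {subset L <= irr (SymOn D)}.
    by move=> f; rewrite !inE => /or3P[]/eqP->; rewrite ?sgnc_irr ?pairc_irr.
  have nL : ~~ has (@special T D) L.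
    by apply/hasPn => f; rewrite !inE => /or3P[]/eqP-> //; rewrite nsp5 // sgnc_deg.
  have := column_nonspecial D4 k1 kc cD UL sL nL.
  rewrite !big_cons big_nil sgnc_norm pv expr1n addr0 eD.
  set v := `|chi c| ^+ 2; set w := (2 + _ *+ 2) => v_le.
  (* The column is full: 2 * 3! = 1 + 1 + 2 + 2 * 4 for k = 2 and 3 * 2! = 1 + 1 + 2 + 2 * 1 for k =
     3, the leading ones being [pairc D] and its twist. So every other nonspecial character vanishes
     at c. *)
  have w_ge : (k * (5 - k)`!)%:R <= 1 + 1 + w.
    have k5 : (1 <= 5 - k)%N by case/orP: k23 => /eqP->.
    have -> : 1 + 1 + w = (4 + (5 - k - 1) ^ 2 * 2)%:R.
      rewrite /w -(natrB _ k5) normr_nat -natrX -mulrnA natrD addrA.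
      by congr (_ + _); ring.
    rewrite ler_nat.
    by case/orP: k23 => /eqP->.
  have {}v_le : v <= 0 by have := le_trans v_le w_ge; rewrite -addrA gerDr.
  have : v == 0 by rewrite eq_le v_le exprn_ge0.
  by rewrite /v expf_eq0 /= normr_eq0 => /eqP.
move=> D6; have [ek|nk] := eqVneq k (#|D| - 2)%N.
  rewrite ek in kc *; have [le lt] := irr_conear_cycle D6 kc cD Xchi nsp.
  have -> : (#|D| - (#|D| - 2) - 1 = 1)%N by move: D6; clear; lia.
  by split=> // D7 _; apply: lt.
have kD3 : (k <= #|D| - 3)%N by move: kD nk; clear; lia.
have [|x xD cD'] := kcycle_avoid k1 kc cD; first by move: D6 kD; clear; lia.
have cardD' : #|D :\ x| = #|D|.-1 by rewrite (cardsD1 x D) xD.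
have nl' psi : psi \in irr (SymOn (D :\ x)) -> '['Res[SymOn (D :\ x)] chi, psi] != 0 -> nonlinear psi.
  move=> Xpsi nz; apply/andP; split; apply: contraNneq nsp => e; rewrite e in nz.
    by have [->|->] := constt_Res1 xD D1 Xchi nz; rewrite /special !inE eqxx ?orbT.
  by have [->|->] := constt_Res_sgn xD D1 Xchi nz; rewrite /special !inE eqxx ?orbT.
have resE : chi c = 'Res[SymOn (D :\ x)] chi c by rewrite cfResE ?subSym.
have res1 : chi 1%g = 'Res[SymOn (D :\ x)] chi 1%g by rewrite cfRes1.
have lt' : (#|D| - 2)%:R * `|chi c| <= (#|D| - k - 2)%:R * chi 1%g.
  rewrite resE res1; apply: char_average_le; rewrite ?ler0n ?cfRes_char ?irrWchar //.
  move=> psi Xpsi nz; have [|||le _] := IH (D :\ x) psi _ _ k1 _ kc cD' Xpsi (nl' _ Xpsi nz).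
  - by rewrite cardD'; move: DN; clear; lia.
  - by rewrite cardD'; move: D6; clear; lia.
  - by rewrite cardD'; move: D6 kD3; clear; lia.
  have -> : (#|D| - 2 = #|D :\ x| - 1)%N by rewrite cardD'; clear; lia.
  by have -> : (#|D| - k - 2 = #|D :\ x| - k - 1)%N by rewrite cardD'; clear; lia.
(* With m = |D|, the gain of the induction step is (m-2)(m-k-1) - (m-1)(m-k-2) = k > 0. *)
suff lt : (#|D| - 1)%:R * `|chi c| < (#|D| - k - 1)%:R * chi 1%g by split=> // *; apply: ltW.
have n2 : 0 < (#|D| - 2)%:R :> algC by rewrite ltr0n; move: D6; clear; lia.
rewrite -(ltr_pM2l n2) mulrCA.
apply: le_lt_trans (ler_wpM2l (ler0n _ _) lt') _.
rewrite !mulrA -!natrM ltr_pM2r ?irr_deg_gt0 // ltr_nat.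
by move: D6 k1 kD3; clear; nia.
Qed.

End NormalizedBounds.

(** * Spectrum of a normal Cayley graph *)

Section Spectrum.

(** In a factorization A = CB of full rank, cancelling on both sides of C(BC)B = CB gives BC = 1,
    and A has the trace of BC. *)
Lemma mxtrace_idempotent (F : fieldType) m (A : 'M[F]_m) :
  A *m A = A -> \tr A = (\rank A)%:R.
Proof.
move=> AA; rewrite -{1}(mulmx_base A) mxtrace_mulC.
suff -> : row_base A *m col_base A = 1%:M by rewrite mxtrace1.
apply: (row_full_inj (col_base_full A)); apply: (row_free_inj (row_base_free A)).
by rewrite mulmx1 [col_base A *m (_ *m _)]mulmxA -[in LHS]mulmxA !mulmx_base AA.
Qed.

(** The idempotents with [lam i = a] add up to the projection onto the eigenspace, whose trace is
    its rank. *)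
Lemma spectral_rank (F : fieldType) (J : finType) m (A : 'M[F]_m)
    (P : J -> 'M[F]_m) (lam : J -> F) (a : F) :
    (forall i j, P i *m P j = if i == j then P i else 0) ->
    \sum_i P i = 1%:M -> A = \sum_i lam i *: P i ->
  (\rank (eigenspace A a))%:R = \sum_(i | lam i == a) \tr (P i).
Proof.
move=> PP P1 AE; pose Fa := \sum_(i | lam i == a) P i.
have PA i : P i *m A = lam i *: P i.
  rewrite AE mulmx_sumr (bigD1 i) //= -scalemxAr PP eqxx big1 ?addr0 // => j ji.
  by rewrite -scalemxAr PP eq_sym (negPf ji) scaler0.
have AP i : A *m P i = lam i *: P i.
  rewrite AE mulmx_suml (bigD1 i) //= -scalemxAl PP eqxx big1 ?addr0 // => j ji.
  by rewrite -scalemxAl PP (negPf ji) scaler0.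
have FF : Fa *m Fa = Fa.
  rewrite /Fa mulmx_suml; apply: eq_bigr => i li; rewrite mulmx_sumr (bigD1 i) //=.
  rewrite PP eqxx big1 ?addr0 // => j /andP[_ ji].
  by rewrite PP eq_sym (negPf ji).
have -> : \rank (eigenspace A a) = \rank Fa.
  apply/eqP; rewrite eqn_leq; apply/andP; split; apply: mxrankS.
    set W := eigenspace A a; have WA : W *m A = a *: W by apply/eigenspaceP.
    have -> : W = W *m Fa.
      rewrite -{1}[W]mulmx1 -P1 (bigID (fun i => lam i == a)) /= mulmxDr [X in _ + X]mulmx_sumr.
      rewrite [X in _ + X]big1 ?addr0 // => i nli; apply/eqP.
      have /eqP : a *: (W *m P i) = lam i *: (W *m P i).
        by rewrite scalemxAl -WA -mulmxA AP -scalemxAr.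
      by rewrite -subr_eq0 -scalerBl scaler_eq0 subr_eq0 eq_sym (negPf nli).
    exact: submxMl.
  apply/eigenspaceP; rewrite /Fa mulmx_suml scaler_sumr; apply: eq_bigr => i /eqP <-.
  by rewrite PA.
by rewrite -mxtrace_idempotent // /Fa raddf_sum.
Qed.

Variables (gT : finGroupType) (S : {set gT}).
Hypothesis S_conj : forall x y, (x ^ y)%g \in S = (x \in S).
Hypothesis S_inv : forall x, (x^-1)%g \in S = (x \in S).

Let G := [set: gT]%G.
Let A := adjacency_mx (cayley S).

Definition cayley_eig (k : Iirr G) : algC := \sum_(s in S) 'chi_k s / 'chi_k 1%g.

Lemma cayleyE x y : cayley S x y = ((x^-1 * y)%g \in S).
Proof.
apply/existsP/idP => [[s /andP[sS /orP[]/eqP->]]|xy].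
- by rewrite mulKg.
- by rewrite invMg mulgKV S_inv.
- by exists (x^-1 * y)%g; rewrite xy mulKVg eqxx.
Qed.

Lemma cayley_regular : regular_graph (cayley S) #|S|.
Proof.
move=> x; rewrite -(card_lcoset S x); apply: eq_card => y.
by rewrite inE cayleyE mem_lcoset.
Qed.

(** The isotypic projections of the regular representation, that is, the central idempotents of the
    group algebra. *)
Let P (k : Iirr G) : 'M[algC]_#|gT| :=
  \matrix_(i, j) ('chi_k 1%g / #|G|%:R * 'chi_k ((enum_val i)^-1 * enum_val j)%g).

Let sum_enum (V : nmodType) (f : gT -> V) : \sum_(i < #|gT|) f (enum_val i) = \sum_x f x.
Proof.
by rewrite (reindex (@enum_val gT predT)) //; apply: onW_bij; apply: enum_val_bij.
Qed.

Let PP i j : P i *m P j = if i == j then P i else 0.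
Proof.
apply/matrixP => u v; rewrite mxE.
under eq_bigr do rewrite !mxE.
rewrite (sum_enum (fun x => 'chi_i 1%g / #|G|%:R * 'chi_i ((enum_val u)^-1 * x)%g *
   ('chi_j 1%g / #|G|%:R * 'chi_j (x^-1 * enum_val v)%g))).
set g := enum_val u; set h := enum_val v.
transitivity ('chi_i 1%g / #|G|%:R * 'chi_j 1%g *
   (#|G|%:R^-1 * \sum_(x in G) 'chi_i (x * (g^-1 * h))%g * 'chi_j (x^-1)%g)).
  rewrite !mulr_sumr (reindex_inj (mulgI h)) /=; apply: eq_big => [x|x _].
    by rewrite inE.
  have -> : 'chi_i (g^-1 * (h * x))%g = 'chi_i (x * (g^-1 * h))%g.
    have -> : (x * (g^-1 * h) = (g^-1 * (h * x)) ^ x^-1)%g.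
      by rewrite conjgE invgK !mulgA mulgK.
    by rewrite cfunJ ?inE.
  by rewrite invMg mulgKV; ring.
rewrite generalized_orthogonality_relation; case: eqP => [->|_]; rewrite ?mxE; last first.
  by rewrite mul0r mulr0.
rewrite mul1r; have := irr1_neq0 j; have : #|G|%:R != 0 :> algC by rewrite neq0CG.
by move=> G0 c0; field; rewrite G0 c0.
Qed.

Let sumP : \sum_k P k = 1%:M.
Proof.
apply/matrixP => u v; rewrite summxE !mxE.
transitivity (#|G|%:R^-1 * \sum_k 'chi[G]_k ((enum_val u)^-1 * enum_val v)%g * ('chi_k 1%g)^*).
  rewrite mulr_sumr; apply: eq_bigr => k _; rewrite mxE.
  by rewrite (conj_natr (Cnat_irr1 k)); ring.
rewrite second_orthogonality_relation ?group1 // class1G inE.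
rewrite -(inj_eq enum_val_inj) [enum_val u == _]eq_mulVg1.
case: eqP => [->|_]; last by rewrite mulr0.
by rewrite cent11T setIT mulr1n mulVf ?neq0CG.
Qed.

(** At an entry given by y, column orthogonality keeps only the s in S conjugate to y; when y lies
    in S they form its whole class, and |C(y)| for each of them adds up to |G|. *)
Let AE : A = \sum_k cayley_eig k *: P k.
Proof.
apply/matrixP => u v; rewrite summxE !mxE cayleyE.
set y := ((enum_val u)^-1 * enum_val v)%g.
transitivity (#|G|%:R^-1 * \sum_(s in S) \sum_k 'chi[G]_k y * ('chi_k s)^*); last first.
  rewrite exchange_big mulr_sumr; apply: eq_bigr => k _; rewrite !mxE -/y /cayley_eig.
  have sE : \sum_(s in S) 'chi_k s = \sum_(s in S) ('chi_k s)^*.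
    rewrite (reindex_inj invg_inj) /=; apply: eq_big => [s|s _]; first exact: S_inv.
    by rewrite char_inv ?irr_char.
  rewrite -mulr_sumr -mulr_suml sE.
  have := irr1_neq0 k; have : #|G|%:R != 0 :> algC by rewrite neq0CG.
  by move=> G0 c0; field; rewrite G0 c0.
rewrite (eq_bigr (fun s => #|'C_G[y]%g|%:R *+ (y \in s ^: G)%g)); last first.
  by move=> s _; rewrite second_orthogonality_relation ?inE.
case: (boolP (y \in S)) => yS; last first.
  rewrite big1 ?mulr0 // => s sS; case: (boolP (y \in _)) => // /imsetP[x _ eqy].
  by rewrite eqy S_conj sS in yS.
rewrite (eq_bigr (fun s => (if s \in y ^: G then #|'C_G[y]|%:R else 0)%g)) => [|s _]; last first.
  by rewrite class_sym; case: ifP.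
rewrite -big_mkcondr (eq_bigl (fun s => s \in (y ^: G)%g)) => [|s]; last first.
  rewrite andbC; case: (boolP (s \in (y ^: G)%g)) => //= /imsetP[x _ ->].
  by rewrite S_conj.
by rewrite sumr_const -index_cent1 -mulrnA Lagrange ?subsetIl // mulVf ?neq0CG.
Qed.

Let trP k : \tr (P k) = 'chi_k 1%g ^+ 2.
Proof.
rewrite /mxtrace (eq_bigr (fun=> 'chi_k 1%g / #|G|%:R * 'chi_k 1%g)) => [|i _]; last first.
  by rewrite mxE mulVg.
rewrite sumr_const card_ord -mulr_natl -cardsT.
have : #|G|%:R != 0 :> algC by rewrite neq0CG.
by move=> G0; field.
Qed.

Lemma cayley_multiplicity a :
  (eig_multiplicity (cayley S) a)%:R = \sum_(k | cayley_eig k == a) 'chi_k 1%g ^+ 2.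
Proof.
rewrite /eig_multiplicity (spectral_rank a PP sumP AE).
by apply: eq_bigr => k _; rewrite trP.
Qed.

Lemma cayley_eigenvalueP a :
  reflect (exists k, cayley_eig k = a) (eigenvalue (adjacency_mx (cayley S)) a).
Proof.
have ev : eigenvalue A a = (eig_multiplicity (cayley S) a != 0%N).
  by rewrite /eigenvalue -mxrank_eq0.
rewrite ev -(eqr_nat algC) cayley_multiplicity; apply: (iffP idP) => [nz|[k <-]].
  apply/exists_eqP; apply: contraNT nz; rewrite negb_exists => /forallP n0.
  by rewrite big_pred0 // => k; apply: negPf.
rewrite (bigD1 k) //= gt_eqF // ltr_wpDr ?exprn_gt0 ?irr1_gt0 //.
by apply: sumr_ge0 => j _; rewrite exprn_ge0 // ltW // irr1_gt0.
Qed.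

End Spectrum.

(** * Specht modules *)

Section Eigenvectors.

Variables (gT : finGroupType) (G H : {group gT}) (m : nat).
Variables (rG : mx_representation algC G m) (b : gT -> bool) (v : 'rV[algC]_m).
Hypotheses (sHG : H \subset G) (bM : {in H &, forall x y, b (x * y)%g = b x (+) b y}).
Hypotheses (v_neq0 : v != 0) (vH : {in H, forall x, v *m rG x = (-1) ^+ b x *: v}).

(** The signed average over H is an idempotent fixing v, so its trace, being its rank, is nonzero. A
    vector of the module thus becomes a statement on the character alone. *)
Lemma sign_eigenvector_trace : \sum_(x in H) (-1) ^+ b x * cfRepr rG x != 0.
Proof.
pose E := \sum_(x in H) (-1) ^+ b x *: rG x.
have EM x : x \in H -> rG x *m E = (-1) ^+ b x *: E.
  move=> Hx; have Gx := subsetP sHG x Hx.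
  rewrite /E mulmx_sumr scaler_sumr [RHS](reindex_inj (mulgI x)) /=.
  apply: eq_big => [y|y Hy]; first by rewrite groupMl.
  rewrite -scalemxAr -repr_mxM // ?(subsetP sHG) // bM // signr_addb scalerA.
  by rewrite mulrA -signr_addb addbb mul1r.
have H0 : #|H|%:R != 0 :> algC by rewrite neq0CG.
have EE : E *m E = #|H|%:R *: E.
  rewrite {1}/E mulmx_suml (eq_bigr (fun=> E)) => [|x Hx].
    by rewrite sumr_const scaler_nat.
  by rewrite -scalemxAl EM // scalerA -signr_addb addbb scale1r.
have vE : v *m E = #|H|%:R *: v.
  rewrite /E mulmx_sumr (eq_bigr (fun=> v)) => [|x Hx].
    by rewrite sumr_const scaler_nat.
  by rewrite -scalemxAr vH // scalerA -signr_addb addbb scale1r.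
pose F := #|H|%:R^-1 *: E.
have FF : F *m F = F.
  by rewrite /F -scalemxAl -scalemxAr EE !scalerA -mulrA mulVf // mulr1.
have trF : \tr F != 0.
  rewrite mxtrace_idempotent // pnatr_eq0 mxrank_eq0.
  apply: contraNneq v_neq0 => F0.
  have : v *m F = v by rewrite /F -scalemxAr vE scalerA mulVf // scale1r.
  by rewrite F0 mulmx0 => <-.
apply: contraNneq trF; rewrite /F linearZ /= /E raddf_sum /= => e.
rewrite (eq_bigr (fun x => (-1) ^+ b x * cfRepr rG x)) ?e ?mulr0 // => x Hx.
by rewrite linearZ /= cfunE (subsetP sHG) // mulr1n.
Qed.

End Eigenvectors.

Section SpechtTheory.

Variables (n : nat) (z : partn n).

Local Notation crow := (cell_row z).
Local Notation ccol := (cell_col z).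
Local Notation sh := (val z).

Let rho := tabloid_repr z.
Let t1 := tabloid_of z 1.
Let dl (f : tabloid z) : 'rV[algC]_#|tabloid z| := delta_mx 0 (enum_rank f).

Lemma partn_sorted : sorted geq sh. Proof. by have /and3P[] := valP z. Qed.
Lemma partn_pos : 0%N \notin sh. Proof. by have /and3P[] := valP z. Qed.
Lemma partn_sum : sumn sh = n. Proof. by have /and3P[_ _ /eqP] := valP z. Qed.

Lemma cell_inj c d : crow c = crow d -> ccol c = ccol d -> c = d.
Proof.
move=> /(congr1 val) /= er ec; apply: val_inj => /=.
by rewrite -(reshape_indexK sh c) -(reshape_indexK sh d) er; congr flatten_index.
Qed.

Lemma cell_exists r q : (q < nth 0 sh r)%N -> exists2 c, val (crow c) = r & ccol c = q.
Proof.
move=> qr; have lt := flatten_indexP qr.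
have ltn : (flatten_index sh r q < n)%N by rewrite -[X in (_ < X)%N]partn_sum.
by exists (Ordinal ltn); [apply: flatten_indexKl | apply: flatten_indexKr].
Qed.

Lemma cell_above (c : 'I_n) (r : nat) : (r <= crow c)%N ->
  exists2 d, val (crow d) = r & ccol d = ccol c.
Proof.
move=> rc; apply: cell_exists.
have lt : (c < sumn sh)%N by rewrite partn_sum.
apply: leq_trans (reshape_offsetP lt) _.
have := partn_sorted; rewrite (sorted_pairwise (rev_trans leq_trans)) => pw.
move: rc; rewrite leq_eqVlt => /orP[/eqP->//|rc].
have rs := ltn_ord (crow c).
by apply: (pairwiseP 0%N pw) => //; rewrite inE ?(ltn_trans rc).
Qed.

Lemma col_lt (c : 'I_n) : (ccol c < n)%N.
Proof. by apply: leq_ltn_trans (ltn_ord c); rewrite /cell_col /reshape_offset leq_subr. Qed.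

Lemma tabloid_actM f x y : tabloid_act (tabloid_act f x) y = tabloid_act f (x * y)%g :> tabloid z.
Proof. by apply/val_inj/ffunP=> k; rewrite !ffunE invMg permM. Qed.

Lemma tabloid_act1 f : tabloid_act f 1 = f :> tabloid z.
Proof. by apply/val_inj/ffunP=> k; rewrite ffunE invg1 perm1. Qed.

Lemma val_t1 i : val t1 i = crow i.
Proof. by rewrite ffunE invg1 perm1. Qed.

Lemma dlM f s : dl f *m rho s = dl (tabloid_act f s).
Proof.
rewrite -rowE; apply/rowP=> j; rewrite !mxE enum_rankK eqxx /=.
by rewrite -(inj_eq enum_rank_inj) enum_valK eq_sym.
Qed.

Lemma tabloid_mxM s t : tabloid_mx z (s * t) = tabloid_mx z s *m tabloid_mx z t.
Proof. exact: (repr_mxM rho (in_setT s) (in_setT t)). Qed.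

Definition colg : {set 'S_n} := col_stab z 1.
Definition rowg : {set 'S_n} := [set s | tabloid_act t1 s == t1].

Lemma colgP (s : 'S_n) : reflect (forall i, ccol (s i) = ccol i) (s \in colg).
Proof.
rewrite inE; apply: (iffP forallP) => h i; last by rewrite invg1 !perm1 h.
by have /eqP := h i; rewrite invg1 !perm1.
Qed.

Lemma rowgP (s : 'S_n) : reflect (forall i, crow (s i) = crow i) (s \in rowg).
Proof.
rewrite inE; apply: (iffP eqP) => [e i|h].
  have := congr1 (fun f : tabloid z => val f (s i)) e.
  by rewrite /= ffunE !val_t1 permK.
apply/val_inj/ffunP => i; rewrite /= ffunE !val_t1.
by rewrite -[in RHS](permKV s i) h.
Qed.

Lemma colg_group_set : group_set colg.
Proof.
apply/group_setP; split=> [|s t /colgP hs /colgP ht]; apply/colgP => i.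
  by rewrite perm1.
by rewrite permM ht.
Qed.
Canonical colg_group := Group colg_group_set.

Lemma rowg_group_set : group_set rowg.
Proof.
apply/group_setP; split=> [|s t /rowgP hs /rowgP ht]; apply/rowgP => i.
  by rewrite perm1.
by rewrite permM ht.
Qed.
Canonical rowg_group := Group rowg_group_set.

Lemma colg_rowg s : s \in colg -> s \in rowg -> s = 1%g.
Proof.
move=> /colgP hc /rowgP hr; apply/permP => i; rewrite perm1.
exact: cell_inj.
Qed.

Lemma tabloid_count (f : tabloid z) (P : pred 'I_(size sh)) :
  #|[set i | P (val f i)]| = #|[set i | P (crow i)]|.
Proof.
have /codomP[t ef] := valP f.
rewrite -(card_imset [set i | P (crow i)] (@perm_inj _ t)); apply: eq_card => i.
rewrite -[i](permKV t) mem_imset; last exact: perm_inj.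
by rewrite !inE ef ffunE permK.
Qed.

(* The tabloids that survive the column antisymmetrizer: comparing, column by
   column, how many entries lie in the first r rows shows that a tabloid whose
   rows meet every column at most once is a column permutation of t1. *)
Lemma tabloid_column_dichotomy (f : tabloid z) :
  (exists i j, [/\ i != j, val f i = val f j & ccol i = ccol j]) \/
  (exists2 s, s \in colg & f = tabloid_act t1 s).
Proof.
case: (boolP [exists i, exists j, [&& i != j, val f i == val f j & ccol i == ccol j]]).
  by case/existsP=> i /existsP[j /and3P[ij /eqP e1 /eqP e2]]; left; exists i, j.
rewrite negb_exists => /forallP nd; right.
have finj i j : ccol i = ccol j -> val f i = val f j -> i = j.
  move=> e2 e1; apply/eqP; apply: contraT => ij; have := nd i.
  by rewrite negb_exists => /forallP /(_ j); rewrite ij e1 e2 !eqxx.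
pose X q r := [set i | (ccol i == q) && (val f i < r)%N].
pose Y q r := [set i | (ccol i == q) && (crow i < r)%N].
(* If column q of the diagram reaches row r, it has a cell in every row above, and these are the
   only rows that f can use, each once; otherwise the whole column lies above row r. *)
have XY q r : (#|X q r| <= #|Y q r|)%N.
  case: (boolP [exists i, (ccol i == q) && (r <= crow i)%N]) => [/existsP[i0 /andP[/eqP ci0 ri0]]|].
    have -> : #|X q r| = #|(val f : {ffun 'I_n -> 'I_(size sh)}) @: X q r|.
      rewrite card_in_imset // => i j; rewrite !inE => /andP[/eqP ci _] /andP[/eqP cj _].
      by apply: finj; rewrite ci cj.
    apply: leq_trans (leq_imset_card crow _); apply: subset_leq_card.
    apply/subsetP => y /imsetP[i iX ->]; move: iX; rewrite inE => /andP[_ fr].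
    have [d rd cd] := cell_above (ltnW (leq_trans fr ri0)).
    apply/imsetP; exists d; last by apply: val_inj.
    by rewrite inE cd ci0 eqxx rd fr.
  rewrite negb_exists => /forallP all; apply: subset_leq_card.
  apply/subsetP => i; rewrite !inE => /andP[ci _]; rewrite ci /=.
  by have := all i; rewrite ci /= -ltnNge.
(* Summed over the columns both sides count the entries in the first r rows, which are equally many
   for f and [t1]; so the inequality is an equality in each column. *)
have eqXY q r : #|X q r| = #|Y q r|.
  have sumX : (\sum_(p < n) #|X p r| = \sum_(p < n) #|Y p r|)%N.
    have split (h : 'I_n -> 'I_(size sh)) :
        (\sum_(p < n) #|[set i | (ccol i == p) && (h i < r)%N]| = #|[set i | (h i < r)%N]|)%N.
      rewrite -[RHS]sum1_card [RHS](partition_big (fun i => Ordinal (col_lt i)) predT) //=.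
      apply: eq_bigr => p _; rewrite -sum1_card; apply: eq_bigl => i.
      by rewrite !inE andbC -val_eqE.
    by rewrite !split (tabloid_count f (fun k => (k < r)%N)).
  have [qn|nq] := ltnP q n; last first.
    by rewrite !eq_card0 // => i; rewrite inE; apply/negP => /andP[/eqP ci _];
      move: nq; rewrite -ci leqNgt col_lt.
  have /leqif_sum : forall p : 'I_n, true -> (#|X p r| <= #|Y p r| ?= iff (#|X p r| == #|Y p r|))%N.
    by move=> p _; split; first exact: XY.
  by case=> _; rewrite sumX eqxx => /esym/forallP/(_ (Ordinal qn))/eqP.
have [[q r]|g _ hg] := @recolour_perm _ [set: 'I_n] _ (fun i => (ccol i, crow i)) (fun i => (ccol i, val f i)).
  have cnt (h : 'I_n -> 'I_(size sh)) : #|[set i in [set: 'I_n] | (ccol i, h i) == (q, r)]| =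
      (#|[set i | (ccol i == q) && (h i < r.+1)%N]| - #|[set i | (ccol i == q) && (h i < r)%N]|)%N.
    rewrite -cardsDS; last first.
      by apply/subsetP => i; rewrite !inE => /andP[-> /ltnW].
    apply: eq_card => i; rewrite !inE xpair_eqE negb_and -leqNgt ltnS -val_eqE /=.
    by case: (ccol i == q) => //=; rewrite eqn_leq andbC.
  by rewrite (cnt crow) (cnt (val f)) -![#|[set i | _]|]/(#|Y _ _|) -!eqXY.
exists g; first by apply/colgP => i; have := hg i; rewrite inE => /(_ isT)[].
apply/val_inj/ffunP => i; rewrite /= ffunE val_t1.
by have := hg (g^-1%g i); rewrite inE permKV => /(_ isT)[].
Qed.

Definition kappa : 'M[algC]_#|tabloid z| := \sum_(s in colg) (-1) ^+ odd_perm s *: rho s.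

Let e := polytabloid z 1.

Lemma kappa_mull s : s \in colg -> rho s *m kappa = (-1) ^+ odd_perm s *: kappa.
Proof.
move=> sC; rewrite /kappa mulmx_sumr scaler_sumr [RHS](reindex_inj (mulgI s)) /=.
apply: eq_big => [y|y _]; first by rewrite groupMl.
rewrite -scalemxAr -tabloid_mxM odd_permM signr_addb scalerA.
by rewrite mulrA -signr_addb addbb mul1r.
Qed.

Lemma kappa_mulr s : s \in colg -> kappa *m rho s = (-1) ^+ odd_perm s *: kappa.
Proof.
move=> sC; rewrite /kappa mulmx_suml scaler_sumr [RHS](reindex_inj (mulIg s)) /=.
apply: eq_big => [y|y _]; first by rewrite groupMr.
rewrite -scalemxAl -tabloid_mxM odd_permM signr_addb scalerA.
by rewrite mulrCA -signr_addb addbb mulr1.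
Qed.

Lemma polytabloidE : e = dl t1 *m kappa.
Proof.
rewrite /e /polytabloid /kappa mulmx_sumr; apply: eq_bigr => s _.
by rewrite -scalemxAr dlM.
Qed.

(** In the first case of the dichotomy a transposition in the column group fixes f, so the product
    equals its own negative; in the second f is [t1] moved by a column permutation, which [kappa]
    absorbs up to sign. *)
Lemma kappa_dl f : exists a, dl f *m kappa = a *: e.
Proof.
have [[i [j [ij fij cij]]]|[s sC ->]] := tabloid_column_dichotomy f; last first.
  exists ((-1) ^+ odd_perm s).
  by rewrite -dlM -mulmxA kappa_mull // -scalemxAr polytabloidE.
exists 0; rewrite scale0r; have tC : tperm i j \in colg.
  by apply/colgP => k; case: tpermP => // ->.
have ft : tabloid_act f (tperm i j) = f.
  by apply/val_inj/ffunP => k; rewrite /= ffunE tpermV; case: tpermP => // ->.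
have : dl f *m kappa = - (dl f *m kappa).
  rewrite -{1}ft -dlM -mulmxA kappa_mull // odd_tperm ij expr1.
  by rewrite -scalemxAr scaleN1r.
by move/eqP; rewrite -addr_eq0 -mulr2n -scaler_nat scaler_eq0 pnatr_eq0 /= => /eqP.
Qed.

Lemma kappa_row (v : 'rV_#|tabloid z|) : exists a, v *m kappa = a *: e.
Proof.
have /fin_all_exists[a ha] := kappa_dl.
exists (\sum_i v 0 i * a (enum_val i)); rewrite {1}(row_sum_delta v) mulmx_suml scaler_suml.
apply: eq_bigr => i _; rewrite -scalemxAl -scalerA -ha; congr (_ *: (_ *m _)).
by rewrite /dl enum_valK.
Qed.

(** A column permutation preserving all rows is trivial, so after moving by r only the identity term
    of [e] reaches [t1]. *)
Lemma e_coef r : r \in rowg -> (e *m rho r) 0 (enum_rank t1) = 1.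
Proof.
move=> rR; rewrite /e /polytabloid mulmx_suml summxE (bigD1 1%g (group1 colg_group)) /=.
have actr s : (tabloid_act (tabloid_act t1 s) r == t1) = (s \in rowg).
  have tr : tabloid_act t1 r = t1 by move: rR; rewrite inE => /eqP.
  rewrite inE tabloid_actM; apply/eqP/eqP => [h|h].
    by rewrite -[s](mulgK r) -tabloid_actM h -{1}tr tabloid_actM mulgV tabloid_act1.
  by rewrite -tabloid_actM h.
have coef s : (((-1) ^+ odd_perm s *: delta_mx 0 (enum_rank (tabloid_act (tabloid_of z 1) s)) : 'rV_#|tabloid z|)
    *m rho r) 0 (enum_rank t1) = (-1) ^+ odd_perm s * (s \in rowg)%:R.
  rewrite -scalemxAl -/(dl _) dlM mxE mxE eqxx /= (inj_eq enum_rank_inj) eq_sym.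
  by rewrite -/t1 actr.
rewrite coef odd_perm1 mul1r group1 big1 ?addr0 // => s /andP[sC s1].
rewrite coef; case: (boolP (s \in rowg)) => [sR|_]; last by rewrite mulr0.
by move: s1; rewrite (colg_rowg sC sR) eqxx.
Qed.

Lemma e_neq0 : e != 0.
Proof.
apply/eqP => e0; have := e_coef (group1 rowg_group).
by rewrite e0 mul0mx mxE => /esym/eqP; rewrite oner_eq0.
Qed.

Lemma e_kappa : e *m kappa = #|colg|%:R *: e.
Proof.
have kk : kappa *m kappa = #|colg|%:R *: kappa.
  rewrite {1}/kappa mulmx_suml (eq_bigr (fun=> kappa)) => [|s sC].
    by rewrite sumr_const scaler_nat.
  by rewrite -scalemxAl kappa_mull // scalerA -signr_addb addbb scale1r.
by rewrite polytabloidE -mulmxA kk -scalemxAr.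
Qed.

Let U := cyclic_mx rho e.

(** A submodule V on which [kappa] is nonzero contains a nonzero multiple of [e], hence U. If
    [kappa] kills V, then [e], proportional to [e *m kappa], lies in a Maschke complement of V; this
    contains U and meets V trivially, so V would be 0. The complement plays the part of the
    orthogonal space in James's submodule theorem. *)
Lemma specht_simple : mxsimple rho U.
Proof.
split; first exact: cyclic_mx_module.
  by rewrite cyclic_mx_eq0 e_neq0.
move=> V Vmod VU V0.
have Vk (w : 'rV_#|tabloid z|) : (w <= V)%MS -> (w *m kappa <= V)%MS.
  move=> wV; rewrite /kappa mulmx_sumr summx_sub // => s _.
  by rewrite -scalemxAr scalemx_sub // (mxmodule_trans Vmod) ?inE.
case: (boolP [exists i, row i V *m kappa != 0]) => [/existsP[i nz]|].
  have [a ea] := kappa_row (row i V).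
  have a0 : a != 0 by apply: contraNneq nz => a0; rewrite ea a0 scale0r.
  apply: cyclic_mx_sub => //; have := Vk _ (row_sub i V).
  by rewrite ea => /(scalemx_sub a^-1); rewrite scalerA mulVf // scale1r.
rewrite negb_exists => /forallP all0; exfalso.
have Vk0 (w : 'rV_#|tabloid z|) : (w <= V)%MS -> w *m kappa = 0.
  case/submxP=> D ->; rewrite -mulmxA (_ : V *m kappa = 0) ?mulmx0 //.
  by apply/row_matrixP => i; rewrite row_mul row0; apply/eqP; have := all0 i; rewrite negbK.
have [W Wmod VW dVW] := mx_Maschke_pchar rho (algC'G_pchar _) Vmod (submx1 V).
have /sub_addsmxP[[w1 w2] /= ew] : (e <= V + W)%MS by rewrite VW submx1.
have eW : (e <= W)%MS.
  have : (#|colg|%:R *: e <= W)%MS.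
    rewrite -e_kappa ew mulmxDl (Vk0 (w1 *m V)) ?submxMl // add0r.
    rewrite /kappa mulmx_sumr summx_sub // => s _.
    by rewrite -scalemxAr scalemx_sub // (mxmodule_trans Wmod) ?inE ?submxMl.
  move/(scalemx_sub #|colg|%:R^-1); rewrite scalerA mulVf ?scale1r //.
  exact: (neq0CG colg_group).
have UW : (U <= W)%MS by apply: cyclic_mx_sub.
have : (V <= V :&: W)%MS by rewrite sub_capmx submx_refl (submx_trans VU).
by rewrite (mxdirect_addsP dVW) submx0 (negPf V0).
Qed.

Lemma specht_irr : specht_char z \in irr [set: 'S_n].
Proof.
apply/irr_reprP; exists (Representation (specht_repr z)) => //=.
exact/submod_mx_irr/specht_simple.
Qed.

Lemma specht_col_sum : \sum_(s in colg) (-1) ^+ odd_perm s * specht_char z s != 0.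
Proof.
have eU : (e <= U)%MS by apply: cyclic_mx_id.
apply: (@sign_eigenvector_trace _ [set: 'S_n]%G colg_group _ (specht_repr z) (fun s => odd_perm s)
  (in_submod U e)).
- exact: subsetT.
- by move=> x y _ _; apply: odd_permM.
- by rewrite -val_submod_eq0 in_submodK // e_neq0.
- move=> s sC; rewrite /= -in_submodJ // -linearZ /=; congr in_submod.
  by rewrite polytabloidE -mulmxA kappa_mulr // -scalemxAr.
Qed.

(** The fixed vector is the sum of the row translates of [e]; nothing cancels, as each term has
    coefficient 1 at [t1]. *)
Lemma specht_row_sum : \sum_(s in rowg) specht_char z s != 0.
Proof.
pose w := \sum_(r in rowg) e *m rho r.
have eU : (e <= U)%MS by apply: cyclic_mx_id.
have wU : (w <= U)%MS.
  by apply: summx_sub => r _; rewrite mxmodule_trans ?cyclic_mx_module ?inE.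
have w0 : w != 0.
  apply/eqP => w0; have : w 0 (enum_rank t1) = #|rowg|%:R.
    rewrite summxE (eq_bigr (fun=> 1)) => [|r rR]; last exact: e_coef.
    by rewrite sumr_const.
  by rewrite w0 mxE => /esym/eqP; rewrite (negPf (neq0CG rowg_group)).
rewrite (eq_bigr (fun s => (-1) ^+ false * specht_char z s)) => [|s _]; last by rewrite mul1r.
apply: (@sign_eigenvector_trace _ [set: 'S_n]%G rowg_group _ (specht_repr z) (fun s => false)
  (in_submod U w)) => //; first exact: subsetT.
- by rewrite -val_submod_eq0 in_submodK.
- move=> s sR; rewrite /= scale1r -in_submodJ //; congr in_submod.
  rewrite /w mulmx_suml [RHS](reindex_inj (mulIg s)) /=; apply: eq_big => [r|r _].
    by rewrite groupMr.
  by rewrite -mulmxA -tabloid_mxM.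
Qed.

End SpechtTheory.

(** * Connectivity and cycle counts *)

Section CayleyConnect.

Variables (gT : finGroupType) (S : {set gT}).
Hypothesis S_inv : forall x, (x^-1)%g \in S = (x \in S).

Lemma cayley_connect x y : connect (cayley S) x y = ((x^-1 * y)%g \in <<S>>%g).
Proof.
apply/idP/idP => [cxy|].
  have cl : closed (cayley S) [pred w | (x^-1 * w)%g \in <<S>>%g].
    move=> u v; rewrite cayleyE // => uv; rewrite !inE.
    by rewrite -(groupMr (x^-1 * u)%g (mem_gen uv)) -mulgA mulKVg.
  by have := closed_connect cl cxy; rewrite !inE mulVg group1 => <-.
pose K := [set g | [forall u, connect (cayley S) u (u * g)%g]].
have gK : group_set K.
  apply/group_setP; split=> [|g h].
    by rewrite inE; apply/forallP => u; rewrite mulg1 connect0.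
  rewrite !inE => /forallP hg /forallP hh; apply/forallP => u.
  by apply: connect_trans (hg u) _; rewrite mulgA.
have sSK : S \subset Group gK.
  apply/subsetP => s sS; rewrite inE; apply/forallP => u; apply: connect1.
  by rewrite cayleyE // mulKg.
move=> xy; have := subsetP (_ : <<S>>%g \subset Group gK) _ xy.
by rewrite gen_subG => /(_ sSK); rewrite inE => /forallP/(_ x); rewrite mulKVg.
Qed.

End CayleyConnect.

(** * Generation by cycles and counting of cycles *)

Section CycleSets.

Variables (n : nat) (I : {set 'I_n.+1}).
Hypothesis n_ge7 : (7 <= n)%N.
Hypothesis I_range : forall k, k \in I -> (2 <= k <= n - 2)%N.

Lemma cyclesP (s : 'S_n) : reflect (exists2 k, k \in I & kcycle k s) (s \in cycles I).
Proof. by rewrite inE; apply: (iffP exists_inP). Qed.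

Lemma cyclesJ (s g : 'S_n) : ((s ^ g)%g \in cycles I) = (s \in cycles I).
Proof. by apply/cyclesP/cyclesP => -[k kI]; rewrite ?kcycleJ => ks; exists k; rewrite ?kcycleJ. Qed.

Lemma cyclesV (s : 'S_n) : ((s^-1)%g \in cycles I) = (s \in cycles I).
Proof. by apply/cyclesP/cyclesP => -[k kI]; rewrite ?kcycleV => ks; exists k; rewrite ?kcycleV. Qed.

Lemma SymOnT : SymOn [set: 'I_n] = [set: 'S_n].
Proof. by apply/setP => s; rewrite !inE; apply/subsetP. Qed.

Lemma kcycle_exists_ord k : (0 < k <= n)%N -> exists s : 'S_n, kcycle k s.
Proof.
move=> kn; have [|s _ ks] := @kcycle_exists _ k [set: 'I_n]; last by exists s.
by rewrite cardsT card_ord.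
Qed.

(** The generated group is normal, so by simplicity of the alternating group one nontrivial even
    element suffices. It is the quotient of a cycle by its conjugate under a transposition that
    exchanges a moved point with a fixed one; the latter exists since k <= n - 2. *)
Lemma Alt_sub_gen_cycles : I != set0 -> (Alt 'I_n) \subset <<cycles I>>%g.
Proof.
case/set0Pn => k kI; have /andP[k2 kn] := I_range kI.
have [|s ks] := @kcycle_exists_ord k; first by lia.
have sI : s \in cycles I by apply/cyclesP; exists k.
have [x [cx fx]] := kcycleP k2 ks.
have [y yO] : exists y, y \notin porbit s x.
  have := cardsCs (porbit s x); rewrite cx card_ord => e.
  have /card_gt0P[y] : (0 < #|~: porbit s x|)%N by clear -e kn n_ge7; lia.
  by rewrite inE => yO; exists y.
have sy : s y = y by apply/eqP; rewrite fx.
have xO : x \in porbit s x := porbit_id s x.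
have sx : s x != x by rewrite fx xO.
have sxO : s x \in porbit s x by have := mem_porbit s 1 x; rewrite expg1.
pose t := tperm x y.
have nst : (s ^ t)%g != s.
  apply/eqP => e; have : (s ^ t)%g (t x) = t (s x) by rewrite permJ.
  rewrite e /t tpermL sy tpermD; [|by rewrite eq_sym|by apply: contraNneq yO => ->].
  by move=> ey; rewrite ey sxO in yO.
pose N := <<cycles I>>%G.
have nN : [set: 'S_n] \subset 'N(N)%g.
  apply: subset_trans (norm_gen _); apply/subsetP => g _; rewrite inE.
  by apply/subsetP => _ /imsetP[h hI ->]; rewrite cyclesJ.
have nNA : ((N :&: Alt 'I_n)%G <| Alt 'I_n)%g.
  rewrite /normal subsetIr /= normsI ?normG //; exact: subset_trans (subsetT _) nN.
have n5 : (4 < #|'I_n|)%N by rewrite card_ord; clear -n_ge7; lia.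
have /simpleP[_ /(_ _ nNA)[triv|full]] := simple_Alt5 n5; last first.
- by apply/setIidPr; exact: full.
- have : (s^-1 * s ^ t)%g \in (N :&: Alt 'I_n)%G.
    rewrite inE Alt_even odd_permM odd_permV odd_permJ addbb andbT.
    by rewrite groupM ?groupV ?mem_gen ?cyclesJ.
  by rewrite triv inE -eq_mulVg1 eq_sym (negPf nst).
Qed.

Lemma cycles_connected (k : 'I_n.+1) : k \in I -> ~~ odd k -> connected_graph (cayley (cycles I)).
Proof.
move=> kI ek x y; rewrite cayley_connect; last exact: cyclesV.
have /subsetP sA : (Alt 'I_n) \subset <<cycles I>>%g.
  by apply: Alt_sub_gen_cycles; apply/set0Pn; exists k.
have /andP[k2 kn] := I_range kI.
have [|s ks] := @kcycle_exists_ord k; first by lia.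
have sI : s \in cycles I by apply/cyclesP; exists k.
have os : odd_perm s by rewrite (odd_kcycle k2 ks).
move: (x^-1 * y)%g => g; case: (boolP (odd_perm g)) => og; last by rewrite sA ?Alt_even.
rewrite -[g](mulKVg s) groupM //; first exact: mem_gen.
by rewrite sA // Alt_even odd_permM odd_permV os og.
Qed.

Lemma cycles_two_components : I != set0 -> (forall k, k \in I -> odd k) ->
  n_comp (cayley (cycles I)) predT = 2%N.
Proof.
move=> I0 Iodd; have conE x y : connect (cayley (cycles I)) x y = ~~ odd_perm (x^-1 * y)%g.
  rewrite cayley_connect; last exact: cyclesV.
  rewrite -Alt_even; apply/idP/idP; last exact: (subsetP (Alt_sub_gen_cycles I0)).
  apply/subsetP; rewrite gen_subG; apply/subsetP => s /cyclesP[k kI ks].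
  by rewrite Alt_even (odd_kcycle _ ks) ?Iodd //; case/andP: (I_range kI).
have csym : connect_sym (cayley (cycles I)).
  by move=> x y; rewrite !conE !odd_permM !odd_permV addbC.
have lt01 : [/\ 0 < n & 1 < n]%N by lia.
case: lt01 => n0 n1; pose t : 'S_n := tperm (Ordinal n0) (Ordinal n1).
have ot : odd_perm t by rewrite odd_tperm.
rewrite (n_compC (connect (cayley (cycles I)) 1%g)) n_comp_connect //.
rewrite (eq_n_comp_r (a' := connect (cayley (cycles I)) t)) ?n_comp_connect // => y.
change (~~ connect (cayley (cycles I)) 1%g y = connect (cayley (cycles I)) t y).
rewrite !conE invg1 mul1g odd_permM odd_permV ot.
by rewrite addTb negbK.
Qed.

Definition ncyc k := #|[set s : 'S_n | kcycle k s]|.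

Lemma ncyc_ffact k : (1 < k <= n)%N -> (ncyc k * k = n ^_ k)%N.
Proof.
case/andP=> k1 kn; have [|c kc] := @kcycle_exists_ord k; first by lia.
have cD : c \in SymOn [set: 'I_n] by rewrite SymOnT inE.
have -> : ncyc k = #|(c ^: SymOn [set: 'I_n])%g|.
  apply: eq_card => s; rewrite inE; apply/idP/imsetP => [ks|[g _ ->]]; last by rewrite kcycleJ.
  have sD : s \in SymOn [set: 'I_n] by rewrite SymOnT inE.
  by have [g gD ->] := kcycle_conj k1 kc ks cD sD; exists g.
have := Lagrange (subcent1_sub c (SymOn_group [set: 'I_n])).
rewrite -index_cent1 (card_cent_kcycle k1 kc cD) perm.card_Sym cardsT card_ord.
rewrite -(ffact_fact kn) => e.
apply/eqP; rewrite -(eqn_pmul2r (fact_gt0 (n - k))) -e; apply/eqP.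
by rewrite -mulnA [LHS]mulnC.
Qed.

Lemma ncyc_gt0 k : (1 < k <= n)%N -> (0 < ncyc k)%N.
Proof.
move=> kn; have := ncyc_ffact kn; case: (ncyc k) => // /esym/eqP.
by rewrite -leqn0 leqNgt ffact_gt0; case/andP: kn => _ ->.
Qed.

Lemma sum_cycles (V : nmodType) (F : 'S_n -> V) (f : nat -> V) :
  (forall k s, k \in I -> kcycle k s -> F s = f k) ->
  \sum_(s in cycles I) F s = \sum_(k in I) f k *+ ncyc k.
Proof.
move=> Ff; transitivity (\sum_(k in I) \sum_(s : 'S_n | kcycle k s) F s); last first.
  apply: eq_bigr => k kI; rewrite (eq_bigr (fun=> f k)) => [|s ks]; last exact: Ff.
  by rewrite sumr_const; congr (_ *+ _); apply: eq_card => s; rewrite !inE.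
rewrite (exchange_big_dep (mem (cycles I))) /= => [|k s kI ks]; last by apply/cyclesP; exists k.
apply: eq_bigr => s /cyclesP[k kI ks]; rewrite (big_pred1 k) // => l.
apply/andP/eqP => [[lI ls]|->] //; apply: val_inj => /=.
have /andP[k2 _] := I_range kI; have /andP[l2 _] := I_range lI.
exact: kcycle_inj ls ks.
Qed.

Lemma max_in_I : I != set0 ->
  exists2 m, m \in I & (\max_(k in I) k = m)%N /\ forall k, k \in I -> (k <= m)%N.
Proof.
case/set0Pn => k0 k0I; have I0 : (0 < #|I|)%N by apply/card_gt0P; exists k0.
have [m mI mE] := @eq_bigmax_cond _ (mem I) (fun k => nat_of_ord k) I0.
exists m => //; split=> // k kI.
by rewrite -mE; apply: (@leq_bigmax_cond _ (mem I) (fun k => nat_of_ord k)).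
Qed.

Lemma sum_I_le (f : nat -> nat) (P : pred nat) M : (M <= n.+1)%N ->
    (forall k, k \in I -> P k -> (k < M)%N) ->
  (\sum_(k in I | P k) f k <= \sum_(k < M | (1 < k) && P k) f k)%N.
Proof.
move=> MN kM; rewrite (big_ord_widen_cond n.+1 (fun i => (1 < i)%N && P i) f MN).
rewrite big_mkcond [X in (_ <= X)%N]big_mkcond; apply: leq_sum => k _.
case: (boolP (_ && _)) => // /andP[kI Pk].
by rewrite Pk kM //; have /andP[-> _] := I_range kI.
Qed.

(** In n-1 times the difference of the eigenvalues of std and sgn, an even k counts
    [(2 * (n - 1) - k) * ncyc k] and an odd k counts minus [n ^_ k]. Here an odd length of at least
    5 outweighs all smaller even ones together. For length 3, with 2 as the only smaller even one,
    there is equality: this is the case {2, 3}. *)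
Lemma even_cycles_lt j : (j.*2 + 5 <= n - 2)%N ->
  (\sum_(k < j.*2 + 5 | (1 < k) && ~~ odd k) (2 * (n - 1) - k) * ncyc k < n ^_ (j.*2 + 5))%N.
Proof.
elim: j => [|j IH] jn.
  rewrite big_mkcond /= !big_ord_recr big_ord0 /= !add0n addn0.
  have e2 := @ncyc_ffact 2; have e4 := @ncyc_ffact 4.
  have {}e2 : (ncyc 2 * 2 = n ^_ 2)%N by apply: e2; lia.
  have {}e4 : (ncyc 4 * 4 = n ^_ 4)%N by apply: e4; lia.
  rewrite !(ffactnSr n 4) !(ffactnSr n 3) in e4 *; rewrite !(ffactnSr n 2) in e4 *.
  have X0 : (0 < n ^_ 2)%N by rewrite ffact_gt0; lia.
  move: (n ^_ 2) (ncyc 2) (ncyc 4) e2 e4 X0 => X a b e2 e4 X0.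
  have [d dn] : exists d, n = (d + 7)%N by exists (n - 7)%N; lia.
  move: e4; rewrite dn; clear -e2 X0 => e4.
  have e1 : (d + 7 - 1 = d + 6)%N by lia.
  have e3 : (d + 7 - 2 = d + 5)%N by lia.
  have e5 : (d + 7 - 3 = d + 4)%N by lia.
  have e6 : (d + 7 - 4 = d + 3)%N by lia.
  rewrite e1 e3 e5 e6 in e4 *; nia.
have {}IH := IH (ltac:(lia)).
set m := (j.*2 + 5)%N in IH.
have em : (j.+1.*2 + 5 = m.+2)%N by rewrite /m doubleS; lia.
rewrite em in jn *; rewrite big_mkcond /= !big_ord_recr -big_mkcond /=.
have om : odd m by rewrite /m oddD odd_double.
rewrite om /= andbF addn0 andbT (_ : (1 < m.+1)%N) //; last by rewrite /m; lia.
have e1 : (ncyc m.+1 * m.+1 = n ^_ m.+1)%N by apply: ncyc_ffact; rewrite /m; lia.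
rewrite !ffactnSr in e1 *.
have m5 : (5 <= m)%N by rewrite /m; lia.
have [d [dn d4]] : exists d, n = (m + d)%N /\ (4 <= d)%N by exists (n - m)%N; lia.
move: (\sum_(i < m | _) _)%N (n ^_ m) (ncyc m.+1) IH e1 => A X b IH e1.
move: IH e1; rewrite dn; clear -m5 d4 => IH e1.
have h1 : (m + d - m = d)%N by lia.
have h2 : (m + d - m.+1 = d - 1)%N by lia.
have h3 : (2 * (m + d - 1) - m.+1 = m + 2 * d - 3)%N by lia.
rewrite h1 h2 h3 in IH e1 *.
(* The factor m+1 turns the number of (m+1)-cycles into a falling factorial. The extra summand X is
   room for the smaller lengths, which stay below it by induction. *)
have : ((m + 2 * d - 3) * b * m.+1 + X * m.+1 <= X * d * (d - 1) * m.+1)%N.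
  have -> : ((m + 2 * d - 3) * b * m.+1 = (m + 2 * d - 3) * (X * d))%N by rewrite -e1; lia.
  have [u du] : exists u, d = (u + 4)%N by exists (d - 4)%N; lia.
  have [v dv] : exists v, m = (v + 5)%N by exists (m - 5)%N; lia.
  rewrite du dv; clear.
  have -> : (v + 5 + 2 * (u + 4) - 3 = v + 2 * u + 10)%N by lia.
  have -> : (u + 4 - 1 = u + 3)%N by lia.
  nia.
rewrite -mulnDl leq_pmul2r // => h; lia.
Qed.

(** Already the sum over all k from 2 to m - 1 obeys the bound, since [n ^_ k.+1] is at least twice
    [n ^_ k] while k <= n - 2. *)
Lemma lower_cycles_le m : (2 <= m)%N -> (m <= n - 2)%N ->
  (\sum_(k < m | (1 < k) && odd k) n ^_ k <= n ^_ m)%N.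
Proof.
move=> m2 mn; apply: (@leq_trans (\sum_(k < m | 1 < k) n ^_ k)%N).
  rewrite big_mkcond [X in (_ <= X)%N]big_mkcond; apply: leq_sum => k _.
  by case: (1 < k)%N => //=; case: odd.
elim: m m2 mn => [//|m IH] m2 mn.
have [m1|] := leqP m 1.
  by rewrite big_pred0 // => k; have := ltn_ord k; lia.
move=> m1; rewrite big_mkcond big_ord_recr /= -big_mkcond m1 /=.
have {}IH := IH m1 (ltac:(lia)).
rewrite ffactnSr; have : (2 <= n - m)%N by lia.
move: IH; move: (\sum_(i < m | _) _)%N (n ^_ m) (n - m)%N; clear => A X d; nia.
Qed.

(** Once the points moved by even lengths are cancelled, the even lengths carry the weights of
    [even_cycles_lt], and the largest length alone exceeds their sum. *)
Lemma odd_max_sum : I != set0 -> odd (\max_(k in I) k) -> (5 <= \max_(k in I) k)%N ->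
  (2 * (n - 1) * \sum_(k in I | ~~ odd k) ncyc k < \sum_(k in I) ncyc k * k)%N.
Proof.
case/max_in_I => m mI [-> maxm] om m5; have /andP[_ mn] := I_range mI.
have [j ej] : exists j, nat_of_ord m = (j.*2 + 5)%N.
  exists ((m - 5)./2); have := odd_double_half (m - 5).
  by rewrite oddB // om /= add0n => ->; lia.
have := @even_cycles_lt j; rewrite -ej => /(_ mn) lt.
rewrite [X in (_ < X)%N](bigID (fun k : 'I_n.+1 => odd k)) /=.
have mX : (n ^_ m <= \sum_(k in I | odd k) ncyc k * k)%N.
  rewrite (bigD1 m) ?mI ?om //= ncyc_ffact ?leq_addr //; lia.
have split : (2 * (n - 1) * \sum_(k in I | ~~ odd k) ncyc k =
    \sum_(k in I | ~~ odd k) ncyc k * k + \sum_(k in I | ~~ odd k) (2 * (n - 1) - k) * ncyc k)%N.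
  rewrite big_distrr -big_split /=; apply: eq_bigr => k /andP[kI _].
  have /andP[_ kn] := I_range kI.
  by rewrite [(ncyc k * k)%N]mulnC -mulnDl subnKC //; lia.
rewrite split addnC ltn_add2r; apply: leq_trans mX; apply: leq_ltn_trans lt.
apply: (@sum_I_le (fun k => (2 * (n - 1) - k) * ncyc k)%N (fun k => ~~ odd k)); first by lia.
move=> k kI ok; rewrite ltn_neqAle maxm // andbT.
by apply: contraNneq ok => ->; rewrite om.
Qed.

(** The largest length m decides alone: as m < n - 1, its weight 2(n-1) - m exceeds m, so it
    contributes more than [n ^_ m], which bounds all odd lengths together. *)
Lemma even_max_sum : I != set0 -> ~~ odd (\max_(k in I) k) ->
  (\sum_(k in I) ncyc k * k < 2 * (n - 1) * \sum_(k in I | ~~ odd k) ncyc k)%N.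
Proof.
case/max_in_I => m mI [-> maxm] em; have /andP[m2 mn] := I_range mI.
rewrite (bigID (fun k : 'I_n.+1 => odd k)) /=.
have split : (2 * (n - 1) * \sum_(k in I | ~~ odd k) ncyc k =
    \sum_(k in I | ~~ odd k) (2 * (n - 1) - k) * ncyc k + \sum_(k in I | ~~ odd k) ncyc k * k)%N.
  rewrite big_distrr -big_split /=; apply: eq_bigr => k /andP[kI _].
  have /andP[_ kn] := I_range kI.
  by rewrite [(ncyc k * k)%N]mulnC -mulnDl subnK //; lia.
rewrite split ltn_add2r.
have oddle : (\sum_(k in I | odd k) ncyc k * k <= n ^_ m)%N.
  rewrite (eq_bigr (fun k : 'I_n.+1 => n ^_ k)%N) => [|k /andP[kI _]]; last first.
    by apply: ncyc_ffact; have := I_range kI; lia.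
  apply: leq_trans (lower_cycles_le m2 mn).
  apply: (@sum_I_le (fun k => n ^_ k)%N (fun k => odd k)); first by lia.
  move=> k kI ok; rewrite ltn_neqAle maxm // andbT.
  by apply: contraNneq em => <-.
apply: leq_ltn_trans oddle _; rewrite -ncyc_ffact; last by lia.
rewrite (bigD1 m) ?mI ?em //=; apply: leq_trans (leq_addr _ _).
rewrite mulnC ltn_pmul2r ?ncyc_gt0 //; lia.
Qed.

End CycleSets.

(** * Identification of the exceptional Specht modules *)

Section EqualGroups.

Variables (gT : finGroupType) (G H : {group gT}).
Hypothesis eqHG : H :=: G.

Lemma Res_irr_eq (chi : 'CF(G)) : chi \in irr G -> 'Res[H] chi \in irr H.
Proof. by move: eqHG => /group_inj ->; rewrite cfRes_id. Qed.

Lemma Res_eqE (chi : 'CF(G)) x : 'Res[H] chi x = chi x.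
Proof. by move: eqHG => /group_inj ->; rewrite cfRes_id. Qed.

End EqualGroups.

Section FullSymmetricGroup.

Variable n : nat.
Hypothesis n_ge7 : (7 <= n)%N.

Local Notation G0 := [set: 'S_n]%G.
Local Notation D0 := [set: 'I_n].

Let eqT : SymOn_group D0 :=: G0. Proof. exact: SymOnT. Qed.
Let eqT' : G0 :=: SymOn_group D0. Proof. by rewrite eqT. Qed.

(* [SymOn [set: 'I_n]] and [[set: 'S_n]] are equal but not convertible. *)
Definition fromD (phi : 'CF(SymOn D0)) : 'CF(G0) := 'Res[G0, SymOn D0] phi.
Definition toD (chi : 'CF(G0)) : 'CF(SymOn D0) := 'Res[SymOn D0, G0] chi.

Lemma fromDE phi x : fromD phi x = phi x.
Proof. exact: (Res_eqE eqT' phi x). Qed.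

Lemma toDE chi x : toD chi x = chi x.
Proof. exact: (Res_eqE eqT chi x). Qed.

Lemma toDK chi : fromD (toD chi) = chi.
Proof. by apply/cfunP => x; rewrite fromDE toDE. Qed.

Lemma fromD_irr phi : phi \in irr (SymOn D0) -> fromD phi \in irr G0.
Proof. exact: (@Res_irr_eq _ _ _ eqT' phi). Qed.

Lemma toD_irr chi : chi \in irr G0 -> toD chi \in irr (SymOn D0).
Proof. exact: (@Res_irr_eq _ _ _ eqT chi). Qed.

Let cardD0 : #|D0| = n. Proof. by rewrite cardsT card_ord. Qed.
Let D0_4 : (4 <= #|D0|)%N. Proof. by rewrite cardD0; lia. Qed.
Let D0_1 : (1 < #|D0|)%N. Proof. by rewrite cardD0; lia. Qed.

Definition sgn0 := fromD (sgnc D0).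
Definition std0 := fromD (std D0).
Definition ss0 := fromD (sgnc D0 * std D0).

Lemma fromD1 : 1 = fromD 1.
Proof.
apply/cfunP => x; rewrite fromDE !cfun1E; congr (_%:R); symmetry; rewrite in_setT.
have : x \in SymOn D0 by rewrite SymOnT inE.
by move=> xD; rewrite (_ : (x \in _) = true).
Qed.

Lemma sgn0E s : sgn0 s = (-1) ^+ odd_perm s.
Proof. by rewrite fromDE sgncE // SymOnT inE. Qed.

Lemma std0E s : std0 s = (nfix D0 s)%:R - 1.
Proof. by rewrite fromDE stdE ?SymOnT ?inE //; apply: ltnW. Qed.

Lemma std0_kcycle k s : (1 < k)%N -> kcycle k s -> (k < n)%N -> std0 s = (n - k - 1)%:R.
Proof.
move=> k1 ks kn; rewrite fromDE (std_kcycle k1 ks) ?SymOnT ?inE // cardD0.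
by rewrite [RHS]natrB // subn_gt0.
Qed.

Lemma ss0E s : ss0 s = (-1) ^+ odd_perm s * std0 s.
Proof. by rewrite !fromDE cfunE sgncE // SymOnT inE. Qed.

Lemma sgn0_deg : sgn0 1%g = 1. Proof. by rewrite sgn0E odd_perm1. Qed.
Lemma std0_deg : std0 1%g = (n - 1)%:R.
Proof. by rewrite fromDE std_deg // cardD0 subn1. Qed.
Lemma ss0_deg : ss0 1%g = (n - 1)%:R.
Proof. by rewrite ss0E odd_perm1 mul1r std0_deg. Qed.

Lemma sgn0_irr : sgn0 \in irr G0.
Proof. exact/fromD_irr/lin_char_irr/sgnc_lin. Qed.
Lemma std0_irr : std0 \in irr G0.
Proof. by apply: fromD_irr; apply: std_irr. Qed.
Lemma ss0_irr : ss0 \in irr G0.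
Proof. by apply: fromD_irr; rewrite sgnc_irr std_irr. Qed.

Lemma four_uniq : uniq [:: 1; sgn0; std0; ss0].
Proof.
have := special_uniq D0_4; rewrite fromD1.
have inj : injective fromD by move=> f h e; apply/cfunP => x; rewrite -!fromDE e.
by rewrite -(map_inj_uniq inj).
Qed.

Lemma irr_strict_bound chi k s : chi \in irr G0 -> chi \notin [:: 1; sgn0; std0; ss0] ->
  (1 < k <= n - 2)%N -> kcycle k s -> `|chi s / chi 1%g| < std0 s / std0 1%g.
Proof.
move=> Xchi nsp /andP[k1 kn] ks; have sD : s \in SymOn D0 by rewrite SymOnT inE.
have XD := toD_irr Xchi.
have nspD : ~~ special (toD chi).
  apply: contra nsp; rewrite /special !inE -{5 6 7 8}[chi]toDK fromD1.
  by case/or4P => /eqP->; rewrite eqxx ?orbT.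
have nl : nonlinear (toD chi).
  by apply/andP; split; apply: contraNneq nspD => ->; rewrite /special !inE eqxx ?orbT.
have [||_] := normalized_kcycle_bound _ k1 _ ks sD XD nl; rewrite cardD0 //; first lia.
move/(_ n_ge7 nspD); rewrite !toDE => lt.
have c0 := irr_deg_gt0 Xchi.
have n1 : 0 < (n - 1)%:R :> algC by rewrite ltr0n; lia.
rewrite normrM normfV (gtr0_norm c0) std0_deg (std0_kcycle k1 ks); last lia.
by rewrite ltr_pdivrMr // mulrAC ltr_pdivlMr // mulrC.
Qed.

Lemma irr_fixpoint_sum chi x : chi \in irr G0 ->
  \sum_(s in SymOn (D0 :\ x)) chi s != 0 -> chi = 1 \/ chi = std0.
Proof.
move=> Xchi nz; have xD : x \in D0 by rewrite inE.
have [|e|e] := constt_Res1 xD D0_1 (toD_irr Xchi).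
- rewrite cfdotE mulf_neq0 ?invr_neq0 ?neq0CG //; apply: contraNneq nz => e0.
  apply/eqP; rewrite -[RHS]e0; apply: eq_bigr => s sD; rewrite cfResE ?subSym // toDE cfun1E.
  by rewrite (_ : s \in _) // conjC1 mulr1.
- by left; rewrite -[chi]toDK e -fromD1.
- by right; rewrite -[chi]toDK e.
Qed.

Lemma irr_sgn_fixpoint_sum chi x : chi \in irr G0 ->
  \sum_(s in SymOn (D0 :\ x)) (-1) ^+ odd_perm s * chi s != 0 -> chi = sgn0 \/ chi = ss0.
Proof.
move=> Xchi nz; have xD : x \in D0 by rewrite inE.
have [|e|e] := constt_Res_sgn xD D0_1 (toD_irr Xchi).
- rewrite cfdotE mulf_neq0 ?invr_neq0 ?neq0CG //; apply: contraNneq nz => e0.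
  apply/eqP; rewrite -[RHS]e0; apply: eq_bigr => s sD; rewrite cfResE ?subSym // toDE sgncE //.
  by rewrite rmorph_sign mulrC.
- by left; rewrite -[chi]toDK e.
- by right; rewrite -[chi]toDK e.
Qed.

Lemma sign_sum0 (H : {group 'S_n}) (F : 'S_n -> algC) t : t \in H -> odd_perm t ->
  (forall s, s \in H -> F (t * s)%g = F s) -> \sum_(s in H) (-1) ^+ odd_perm s * F s = 0.
Proof.
move=> tH ot Ft; set S := \sum_(s in H) _; have : S = - S.
  rewrite {1}/S (reindex_inj (mulgI t)) /= /S -sumrN; apply: eq_big => [s|s].
    by rewrite groupMl.
  by rewrite groupMl // => sH; rewrite Ft // odd_permM signr_addb ot mulN1r mulNr.
by move/eqP; rewrite -addr_eq0 -mulr2n mulrn_eq0 /= => /eqP.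
Qed.

Section Specht.

Variable z : partn n.

Local Notation crow := (cell_row z).
Local Notation ccol := (cell_col z).
Local Notation sh := (val z).
Local Notation psi := (specht_char z).

Let psi_irr : psi \in irr G0 := specht_irr z.

Lemma tperm_colg i j : ccol i = ccol j -> tperm i j \in colg z.
Proof. by move=> e; apply/colgP => k; case: tpermP => // ->. Qed.

Lemma tperm_rowg i j : crow i = crow j -> tperm i j \in rowg z.
Proof. by move=> e; apply/rowgP => k; case: tpermP => // ->. Qed.

Lemma specht_neq1 i j : i != j -> ccol i = ccol j -> psi != 1.
Proof.
move=> ij e; apply: contraNneq (specht_col_sum z) => ->.
apply/eqP; apply: (@sign_sum0 (colg_group z) (1 : 'CF(G0)) (tperm i j)).
- exact: tperm_colg.
- by rewrite odd_tperm.
- by move=> s _; rewrite !cfun1E !inE.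
Qed.

Lemma specht_neq_sgn i j : i != j -> crow i = crow j -> psi != sgn0.
Proof.
move=> ij e; apply: contraNneq (specht_row_sum z) => ->.
rewrite (eq_bigr (fun s => (-1) ^+ odd_perm s * 1)) => [|s _]; last by rewrite sgn0E mulr1.
apply/eqP; apply: (@sign_sum0 (rowg_group z) (fun=> 1) (tperm i j)) => //.
- exact: tperm_rowg.
- by rewrite odd_tperm.
Qed.

Lemma nth_sh_gt0 r : (r < size sh)%N -> (0 < nth 0 sh r)%N.
Proof.
move=> rs; rewrite lt0n; apply: contraNneq (partn_pos z) => <-.
exact: mem_nth.
Qed.

(** The row stabilizer is the stabilizer of the one entry in the second row, so only 1 and std are
    possible; two cells in the first column exclude 1. *)
Lemma specht_std : sh = [:: n - 1; 1]%N -> psi = std0.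
Proof.
move=> esh.
have [c0 r0 q0] : exists2 c, val (crow c) = 0%N & ccol c = 0%N.
  by apply: cell_exists; rewrite esh /=; lia.
have [c1 r1 q1] : exists2 c, val (crow c) = 1%N & ccol c = 0%N.
  by apply: cell_exists; rewrite esh.
have c01 : c0 != c1 by apply: contra_eqN (r0) => /eqP->; rewrite r1.
have rc (c : 'I_n) : val (crow c) = 1%N -> c = c1.
  move=> rc; apply: (@cell_inj _ z); first by apply: val_inj; rewrite rc r1.
  have lt : (c < sumn sh)%N by rewrite partn_sum.
  have := reshape_offsetP lt; rewrite -[reshape_index _ _]/(val (crow c)) rc -/(ccol c) q1.
  by rewrite {1}esh /=; case: (ccol c).
have [|e|//] := @irr_fixpoint_sum psi c1 psi_irr.
  have -> : SymOn (D0 :\ c1) = rowg z.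
    apply/setP => s; rewrite inE; apply/subsetP/rowgP => [sub i|hs i].
      have s1 : s c1 = c1 by apply/eqP; apply: contraT => /(sub c1); rewrite !inE eqxx.
      have rlt (c : 'I_n) : (val (crow c) < 2)%N by have := ltn_ord (crow c); rewrite [X in (_ < X)%N](_ : _ = 2%N) // esh.
      have r01 (c : 'I_n) : c != c1 -> val (crow c) = 0%N.
        move=> nc; have := rlt c; case E: (val (crow c)) => [|[|//]] // _.
        by rewrite (rc _ E) eqxx in nc.
      have [->|ni] := eqVneq i c1; first by rewrite s1.
      apply: val_inj; rewrite !r01 //; apply: contraNneq ni => si.
      by apply/eqP; apply: (@perm_inj _ s); rewrite si s1.
    rewrite !inE andbT => ne; apply: contraNneq ne => ->; apply/eqP.
    by apply: rc; rewrite hs.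
  exact: specht_row_sum.
have := specht_neq1 c01; rewrite q0 q1 => /(_ erefl); by rewrite e eqxx.
Qed.

Lemma specht_sgn : sh = nseq n 1%N -> psi = sgn0.
Proof.
move=> esh.
have col0 i : ccol i = 0%N.
  have lt : (i < sumn sh)%N by rewrite partn_sum.
  have := reshape_offsetP lt; rewrite -/(ccol i) {1}esh nth_nseq.
  by case: ifP => _; [case: (ccol i) | rewrite ltn0].
apply: irr_dot_neq0 psi_irr sgn0_irr _.
rewrite cfdotE mulf_neq0 ?invr_neq0 ?neq0CG //.
rewrite (eq_bigr (fun s => (-1) ^+ odd_perm s * psi s)) => [|s _]; last first.
  by rewrite sgn0E rmorph_sign mulrC.
rewrite (eq_bigl (mem (colg z))); first exact: specht_col_sum.
by move=> s; rewrite inE /=; apply/esym/colgP => i; rewrite !col0.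
Qed.

(** The argument for std with rows and columns exchanged: the column stabilizer is that of the one
    entry in the second column, and two cells in the first row exclude the sign. *)
Lemma specht_ss : sh = 2%N :: nseq (n - 2) 1%N -> psi = ss0.
Proof.
move=> esh.
have [c0 r0 q0] : exists2 c, val (crow c) = 0%N & ccol c = 0%N.
  by apply: cell_exists; rewrite esh.
have [c1 r1 q1] : exists2 c, val (crow c) = 0%N & ccol c = 1%N.
  by apply: cell_exists; rewrite esh.
have c01 : c0 != c1 by apply: contra_eqN (q0) => /eqP->; rewrite q1.
have offP (c : 'I_n) : (ccol c < nth 0 sh (val (crow c)))%N.
  have lt : (c < sumn sh)%N by rewrite partn_sum.
  exact: reshape_offsetP lt.
have cc (c : 'I_n) : c != c1 -> ccol c = 0%N.
  move=> nc; have := offP c; rewrite {1}esh; case E: (val (crow c)) => [|r] /=.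
    case E1: (ccol c) => [//|[|//]] _.
    by move: nc; rewrite (@cell_inj _ z c c1) ?eqxx //; [apply: val_inj; rewrite E r1 | rewrite E1 q1].
  by rewrite nth_nseq; case: ifP => _ //; case: (ccol c).
have [|e|//] := @irr_sgn_fixpoint_sum psi c1 psi_irr.
  have -> : SymOn (D0 :\ c1) = colg z.
    apply/setP => s; rewrite inE; apply/subsetP/colgP => [sub i|hs i].
      have s1 : s c1 = c1 by apply/eqP; apply: contraT => /(sub c1); rewrite !inE eqxx.
      have [->|ni] := eqVneq i c1; first by rewrite s1.
      rewrite !cc //; apply: contraNneq ni => si.
      by apply/eqP; apply: (@perm_inj _ s); rewrite si s1.
    rewrite !inE andbT => ne; apply: contraNneq ne => ->.
    by apply: contraT => /cc; rewrite hs q1.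
  exact: specht_col_sum.
have := specht_neq_sgn c01; rewrite e eqxx => h.
by have /h : crow c0 = crow c1 by apply: val_inj; rewrite r0 r1.
Qed.

Lemma specht_eq_sgn : psi = sgn0 -> sh = nseq n 1%N.
Proof.
move=> e; have all1 r : (r < size sh)%N -> nth 0%N sh r = 1%N.
  move=> rs; have g0 := nth_sh_gt0 rs.
  apply/eqP; rewrite eqn_leq g0 andbT leqNgt; apply/negP => g1.
  have [c0 r0 q0] := cell_exists g0; have [c1 r1 q1] := cell_exists g1.
  have c01 : c0 != c1 by apply: contra_eqN (q0) => /eqP->; rewrite q1.
  have := specht_neq_sgn c01; rewrite e eqxx => h.
  by have /h : crow c0 = crow c1 by apply: val_inj; rewrite r0 r1.
have esh : sh = nseq (size sh) 1%N.
  apply: (@eq_from_nth _ 0%N); rewrite ?size_nseq // => i isz.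
  by rewrite all1 // nth_nseq isz.
have := partn_sum z; rewrite esh sumn_nseq mul1n => es.
by rewrite {1}es.
Qed.

(** If every point were fixed by some transposition of the column group, the signed column sum of
    std, a count of fixed points minus 1, would cancel term by term. So some cell [i0] belongs to
    every pair of cells in a common column: there are at most two rows, and the second has length at
    most 1. A single row is excluded, as the row group is then everything and std would be
    trivial. *)
Lemma specht_eq_std : psi = std0 -> sh = [:: n - 1; 1]%N.
Proof.
move=> e; have n_gt0 : (0 < n)%N by lia.
have [i0 hi0] : exists i0, forall j k, j != i0 -> k != i0 -> ccol j = ccol k -> j = k.
  pose P (i j k : 'I_n) := [&& j != i, k != i & ccol j == ccol k] ==> (j == k).
  case: (boolP [exists i, forall j, forall k, P i j k]) => [/existsP[i /forallP hi]|].
    exists i => j k ji ki /eqP ejk; apply/eqP.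
    by have /forallP/(_ k) := hi j; rewrite /P ji ki ejk.
  rewrite negb_exists => /forallP no; exfalso.
  have tr i : exists2 t, t \in colg z & odd_perm t /\ t i = i.
    have := no i; rewrite negb_forall => /existsP[j]; rewrite negb_forall => /existsP[k].
    rewrite negb_imply => /andP[/and3P[ji ki /eqP ejk] jk].
    exists (tperm j k); first exact: tperm_colg.
    by rewrite odd_tperm jk tpermD.
  apply: (negP (specht_col_sum z)); rewrite e.
  rewrite (eq_bigr (fun s => \sum_(i in D0) (-1) ^+ odd_perm s * (s i == i)%:R
     - (-1) ^+ odd_perm s * 1)) => [|s _]; last first.
    by rewrite std0E mulrBr nfixE mulr_sumr.
  rewrite sumrB exchange_big /= big1 => [|i _].
    have [t tC [ot _]] := tr (Ordinal n_gt0).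
    by rewrite (@sign_sum0 (colg_group z) (fun=> 1) t) ?subrr.
  have [t tC [ot ti]] := tr i.
  apply: (@sign_sum0 (colg_group z) (fun s => (s i == i)%:R) t) => // s _.
  by rewrite permM ti.
have cell0 r : (r < size sh)%N -> exists2 c, val (crow c) = r & ccol c = 0%N.
  by move=> rs; apply: cell_exists; apply: nth_sh_gt0.
have col_eq c d : val (crow c) <> val (crow d) -> ccol c = ccol d -> (c == i0) || (d == i0).
  move=> rcd ccd; apply: contraT; rewrite negb_or => /andP[nc nd].
  by case: rcd; rewrite (hi0 c d).
have size_lt3 : (size sh < 3)%N.
  rewrite ltnNge; apply/negP => s3.
  have [c0 r0 q0] := cell0 0%N (leq_trans (isT : 0 < 3)%N s3).
  have [c1 r1 q1] := cell0 1%N (leq_trans (isT : 1 < 3)%N s3).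
  have [c2 r2 q2] := cell0 2%N s3.
  have h01 := col_eq c0 c1; have h02 := col_eq c0 c2; have h12 := col_eq c1 c2.
  rewrite r0 r1 r2 q0 q1 q2 in h01 h02 h12.
  have {}h01 := h01 (ltac:(by [])) erefl; have {}h02 := h02 (ltac:(by [])) erefl.
  have {}h12 := h12 (ltac:(by [])) erefl.
  case: (c0 =P i0) h01 h02 => [e0|_] /= h01 h02.
    case/orP: h12 => /eqP e1; [move: r1|move: r2]; by rewrite e1 -e0 r0.
  by move: r1; rewrite (eqP h01) -(eqP h02) r2.
have := partn_sum z; case esh: sh size_lt3 => [|a [|b [|//]]] _ /= sumz.
- by move: n_gt0; rewrite -sumz.
- exfalso; have row0 c d : crow c = crow d.
    have r0 i : val (crow i) = 0%N.
      by apply/eqP; rewrite -leqn0 -ltnS; apply: leq_trans (ltn_ord _) _; rewrite esh.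
    by apply: val_inj; rewrite !r0.
  have nz := specht_row_sum z; rewrite e in nz.
  have e1 : std0 = 1.
    apply: (irr_dot_neq0 std0_irr); first by rewrite -irr0 mem_irr.
    rewrite cfdotE mulf_neq0 ?invr_neq0 ?neq0CG //; apply: contraNneq nz => e0.
    apply/eqP; rewrite -[RHS]e0; apply: eq_big => s; last by move=> _; rewrite cfun1E in_setT conjC1 mulr1.
    by rewrite [RHS]inE; apply/rowgP => i; apply: row0.
  have := four_uniq; by rewrite e1 /= !inE eqxx !orbT.
- have b0 : (0 < b)%N by have := @nth_sh_gt0 1%N; rewrite esh; apply.
  have ab : (b <= a)%N by have := partn_sorted z; rewrite esh /= andbT.
  have [b1|b2] := leqP b 1; first by congr [:: _; _]; lia.
  exfalso.
  have cellx r q : (r < 2)%N -> (q < 2)%N -> exists2 c, val (crow c) = r & ccol c = q.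
    move=> r2 q2; apply: cell_exists; rewrite esh.
    by case: r r2 => [|[|//]] _ /=; lia.
  have [c00 r00 q00] := cellx 0%N 0%N isT isT; have [c10 r10 q10] := cellx 1%N 0%N isT isT.
  have [c01 r01 q01] := cellx 0%N 1%N isT isT; have [c11 r11 q11] := cellx 1%N 1%N isT isT.
  have h0 := col_eq c00 c10; have h1 := col_eq c01 c11.
  rewrite r00 r10 q00 q10 in h0; rewrite r01 r11 q01 q11 in h1.
  have {h0} /orP h0 := h0 (ltac:(by [])) erefl; have {h1} /orP h1 := h1 (ltac:(by [])) erefl.
  have : ccol i0 = 0%N by case: h0 => /eqP <-.
  by case: h1 => /eqP <-; rewrite ?q01 ?q11.
Qed.

End Specht.

End FullSymmetricGroup.

(** * Comparison of the eigenvalues *)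

Section CycleEigenvalues.

Variables (n : nat) (I : {set 'I_n.+1}).
Hypothesis n_ge7 : (7 <= n)%N.
Hypothesis I_range : forall k, k \in I -> (2 <= k <= n - 2)%N.

Local Notation G0 := [set: 'S_n]%G.
Local Notation std0 := (std0 n).
Local Notation sgn0 := (sgn0 n).
Local Notation ss0 := (ss0 n).

Definition cycle_eig (chi : 'CF(G0)) : algC := \sum_(s in cycles I) chi s / chi 1%g.

Let d : algC := #|cycles I|%:R.

(** The gaps to the degree d: normalized, sgn is 1 or -1 and std is 1 - k/(n-1) on a k-cycle, so the
    gaps are [2 * even_cycles] and [moved_points / (n - 1)]. The two eigenvalues are thus compared
    in nat. *)
Definition even_cycles := (\sum_(k in I | ~~ odd k) ncyc n k)%N.
Definition moved_points := (\sum_(k in I) ncyc n k * k)%N.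

Let n1_gt0 : 0 < (n - 1)%:R :> algC.
Proof. by rewrite ltr0n; lia. Qed.

Lemma cycle_eig_sum (chi : 'CF(G0)) f :
    (forall k s, k \in I -> kcycle k s -> chi s / chi 1%g = f (nat_of_ord k)) ->
  cycle_eig chi = \sum_(k in I) f k *+ ncyc n k.
Proof. exact: (sum_cycles I_range). Qed.

Lemma card_cycles_sum : #|cycles I| = (\sum_(k in I) ncyc n k)%N.
Proof.
rewrite -sum1_card (sum_cycles I_range (f := fun=> 1%N)) //.
by apply: eq_bigr => k _; rewrite natn.
Qed.

Lemma cycle_eig1 : cycle_eig 1 = d.
Proof.
rewrite /cycle_eig (eq_bigr (fun=> 1)) => [|s _]; first by rewrite sumr_const.
by rewrite !cfun1E !in_setT divr1.
Qed.

Lemma cycle_eig_sgn : cycle_eig sgn0 = d - (2 * even_cycles)%:R.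
Proof.
rewrite (cycle_eig_sum (f := fun k => (-1) ^+ ~~ odd k)) => [|k s kI ks]; last first.
  have /andP[k2 _] := I_range kI.
  by rewrite sgn0_deg divr1 sgn0E (odd_kcycle k2 ks).
rewrite /d card_cycles_sum /even_cycles big_distrr big_mkcondr /= !natr_sum -sumrB.
apply: eq_bigr => k _; case: (odd k) => /=; first by rewrite expr0 subr0.
rewrite expr1 natrM mulNrn; ring.
Qed.

Lemma cycle_eig_std : cycle_eig std0 = d - moved_points%:R / (n - 1)%:R.
Proof.
have n0 : (n - 1)%:R != 0 :> algC by rewrite gt_eqF.
rewrite (cycle_eig_sum (f := fun k => 1 - k%:R / (n - 1)%:R)) => [|k s kI ks].
  rewrite /d card_cycles_sum /moved_points !natr_sum mulr_suml -sumrB.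
  apply: eq_bigr => k _; rewrite -mulr_natr natrM; ring.
have /andP[k2 kn] := I_range kI.
rewrite std0_deg // (std0_kcycle k2 ks); last by lia.
have -> : (n - k - 1 = n - 1 - k)%N by lia.
by rewrite natrB ?mulrBl ?divff //; lia.
Qed.

Lemma cycle_eig_ss_term (k : 'I_n.+1) s : k \in I -> kcycle k s ->
  ss0 s / ss0 1%g = (-1) ^+ (~~ odd k) * ((n - k - 1)%:R / (n - 1)%:R).
Proof.
move=> kI ks; have /andP[k2 kn] := I_range kI.
rewrite ss0_deg // ss0E (odd_kcycle k2 ks) (std0_kcycle k2 ks) ?mulrA //; lia.
Qed.

Lemma cycle_eig_std_term (k : 'I_n.+1) s : k \in I -> kcycle k s ->
  std0 s / std0 1%g = (n - k - 1)%:R / (n - 1)%:R.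
Proof.
move=> kI ks; have /andP[k2 kn] := I_range kI.
by rewrite std0_deg // (std0_kcycle k2 ks) //; lia.
Qed.

Lemma cycle_eig_ss_odd : (forall k, k \in I -> odd k) -> cycle_eig ss0 = cycle_eig std0.
Proof.
move=> oI; apply: eq_bigr => s /cyclesP[k kI ks].
by rewrite (cycle_eig_ss_term kI ks) (cycle_eig_std_term kI ks) oI // mul1r.
Qed.

Lemma cycle_eig_ss_lt (k : 'I_n.+1) : k \in I -> ~~ odd k -> cycle_eig ss0 < cycle_eig std0.
Proof.
move=> kI ek; have /andP[k2 kn] := I_range kI.
have nc : (0 < ncyc n k)%N by apply: ncyc_gt0 => //; lia.
rewrite (cycle_eig_sum (f := fun k => (-1) ^+ (~~ odd k) * ((n - k - 1)%:R / (n - 1)%:R))).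
  rewrite (cycle_eig_sum (f := fun k => (n - k - 1)%:R / (n - 1)%:R)).
    rewrite (bigD1 k) //= [X in _ < X](bigD1 k) //=; apply: ltr_leD.
      rewrite ltrMn2r nc /=.
      rewrite ek expr1 mulN1r gtrN // divr_gt0 // ltr0n; lia.
    apply: ler_sum => j _; rewrite lerMn2r; apply/orP; right.
    rewrite ler_piMl ?divr_ge0 //.
    by case: (odd j); rewrite /= ?expr0 // expr1 (le_trans (lerN10 _) ler01).
  by move=> j s; apply: cycle_eig_std_term.
by move=> j s; apply: cycle_eig_ss_term.
Qed.

Lemma even_cycles_gt0 (k : 'I_n.+1) : k \in I -> ~~ odd k -> (0 < even_cycles)%N.
Proof.
move=> kI ek; have /andP[k2 kn] := I_range kI.
rewrite /even_cycles (bigD1 k) ?kI //= addn_gt0 ncyc_gt0 //; lia.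
Qed.

Lemma cycle_eig_sgn_lt (k : 'I_n.+1) : k \in I -> ~~ odd k -> cycle_eig sgn0 < d.
Proof.
by move=> kI ek; rewrite cycle_eig_sgn gtrBl ltr0n muln_gt0 (even_cycles_gt0 kI ek).
Qed.

Lemma cycle_eig_sgn_odd : (forall k, k \in I -> odd k) -> cycle_eig sgn0 = d.
Proof.
move=> oI; rewrite cycle_eig_sgn /even_cycles big_pred0 ?muln0 ?subr0 // => k.
by case: (boolP (k \in I)) => // /oI ->.
Qed.

Lemma cycle_eig_sgn_scaled :
  (d - cycle_eig sgn0) * (n - 1)%:R = (2 * (n - 1) * even_cycles)%:R.
Proof. by rewrite cycle_eig_sgn subKr -natrM mulnAC. Qed.

Lemma cycle_eig_std_scaled : (d - cycle_eig std0) * (n - 1)%:R = moved_points%:R.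
Proof. by rewrite cycle_eig_std subKr divfK // gt_eqF. Qed.

Lemma cycle_eig_std_lt_sgn :
  (cycle_eig std0 < cycle_eig sgn0) = (2 * (n - 1) * even_cycles < moved_points)%N.
Proof.
by rewrite -(ltr_nat algC) -cycle_eig_sgn_scaled -cycle_eig_std_scaled ltr_pM2r // ltrD2l ltrN2.
Qed.

Lemma cycle_eig_sgn_lt_std :
  (cycle_eig sgn0 < cycle_eig std0) = (moved_points < 2 * (n - 1) * even_cycles)%N.
Proof.
by rewrite -(ltr_nat algC) -cycle_eig_sgn_scaled -cycle_eig_std_scaled ltr_pM2r // ltrD2l ltrN2.
Qed.

Lemma cycle_eig_sgn_eq_std : moved_points = (2 * (n - 1) * even_cycles)%N ->
  cycle_eig sgn0 = cycle_eig std0.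
Proof.
move=> e; have n0 : (n - 1)%:R != 0 :> algC by rewrite gt_eqF.
apply: (subrI d); apply: (mulIf n0).
by rewrite cycle_eig_sgn_scaled cycle_eig_std_scaled e.
Qed.

Hypothesis I_neq0 : I != set0.

Lemma moved_points_gt0 : (0 < moved_points)%N.
Proof.
have /set0Pn[k kI] := I_neq0; have /andP[k2 kn] := I_range kI.
rewrite /moved_points (bigD1 k) //= addn_gt0 muln_gt0 ncyc_gt0; lia.
Qed.

Lemma cycle_eig_std_lt : cycle_eig std0 < d.
Proof. by rewrite cycle_eig_std gtrBl divr_gt0 // ltr0n moved_points_gt0. Qed.

Lemma cycles_neq0 : exists s, s \in cycles I.
Proof.
have /set0Pn[k kI] := I_neq0; have /andP[k2 kn] := I_range kI.
have [|s ks] := @kcycle_exists_ord n k; first by lia.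
by exists s; apply/cyclesP; exists k.
Qed.

Lemma cycle_eig_nonspecial chi : chi \in irr G0 -> chi \notin [:: 1; sgn0; std0; ss0] ->
  `|cycle_eig chi| < cycle_eig std0.
Proof.
move=> Xchi nsp; have lt s : s \in cycles I -> `|chi s / chi 1%g| < std0 s / std0 1%g.
  by case/cyclesP => k kI ks; apply: irr_strict_bound Xchi nsp _ ks => //; apply: I_range.
apply: le_lt_trans (ler_norm_sum _ _ _) _.
have [s sI] := cycles_neq0.
rewrite /cycle_eig (bigD1 s) //= [X in _ < X](bigD1 s) //=; apply: ltr_leD; first exact: lt.
by apply: ler_sum => t /andP[tI _]; apply/ltW/lt.
Qed.

(** The common frame of the four cases: [L] collects the exceptional characters with eigenvalue a.
    Another one may reach d itself, as the sign does when all cycles are even permutations. *)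
Lemma second_largest_of (L : seq 'CF(G0)) chi0 a :
    uniq L -> chi0 \in L -> {subset L <= [:: sgn0; std0; ss0]} ->
    a < d -> cycle_eig std0 <= a -> (forall chi, chi \in L -> cycle_eig chi = a) ->
    (forall chi, chi \in [:: sgn0; std0; ss0] -> chi \notin L ->
       cycle_eig chi < a \/ cycle_eig chi = d) ->
  [/\ strictly_second_largest (cayley (cycles I)) a,
      (eig_multiplicity (cayley (cycles I)) a)%:R = \sum_(chi <- L) chi 1%g ^+ 2 &
      forall chi, chi \in irr G0 -> cycle_eig chi = a -> chi \in L].
Proof.
move=> uL L0 sL ad sa La nLa.
have irrL chi : chi \in L -> chi \in irr G0.
  move/sL; rewrite !inE => /or3P[]/eqP->; [exact: sgn0_irr | exact: std0_irr | exact: ss0_irr].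
have key chi : chi \in irr G0 ->
    chi \in L \/ cycle_eig chi <> a /\ (cycle_eig chi < d -> cycle_eig chi <= a).
  move=> Xchi; have [cL|ncL] := boolP (chi \in L); first by left.
  right; have dP : cycle_eig chi = d ->
      cycle_eig chi <> a /\ (cycle_eig chi < d -> cycle_eig chi <= a).
    by move=> ->; rewrite ltxx; split=> // e; rewrite e ltxx in ad.
  have [sp|nsp] := boolP (chi \in [:: 1; sgn0; std0; ss0]); last first.
    have lt := lt_le_trans (cycle_eig_nonspecial Xchi nsp) sa.
    split=> [e|bd]; last first.
      (* The order of [algC] is partial; being comparable with d is what makes this eigenvalue
         real. *)
      apply: le_trans (ltW lt); apply: real_ler_norm.
      by rewrite -(ger_real (ltW bd)) realn.
    rewrite e in lt; have a0 : 0 <= a := le_trans (normr_ge0 a) (ltW lt).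
    by rewrite ger0_norm // ltxx in lt.
  move: sp; rewrite inE => /orP[/eqP e|sp]; first by apply: dP; rewrite e cycle_eig1.
  case: (nLa _ sp ncL) => [lt|/dP//]; split=> [e|_]; last exact: ltW.
  by rewrite e ltxx in lt.
have cJ := @cyclesJ n I; have cV := @cyclesV n I.
split.
- exists #|cycles I|; first exact: cayley_regular.
  split=> //.
    have /irrP[k ek] := irrL _ L0; apply/(cayley_eigenvalueP cJ cV); exists k.
    by rewrite -(La _ L0) /cayley_eig -ek.
  move=> b /(cayley_eigenvalueP cJ cV)[k <-].
  case: (key 'chi_k (mem_irr k)) => [/La e|[_ h]]; last exact: h.
  by rewrite -e lexx.
- rewrite (cayley_multiplicity cJ cV).
  transitivity (\sum_(chi <- irr G0 | chi \in L) chi 1%g ^+ 2).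
    rewrite big_tuple; apply: eq_bigl => k; apply/eqP/idP => [e|/La//].
    by case: (key _ (mem_irr k)) => [//|[/(_ e)]].
  rewrite -big_filter; apply: perm_big; apply: uniq_perm => //.
    by rewrite filter_uniq // free_uniq // irr_free.
  move=> chi; rewrite mem_filter; case cL: (chi \in L) => //=.
  by rewrite irrL.
- by move=> chi Xchi e; case: (key _ Xchi) => // -[/(_ e)].
Qed.

End CycleEigenvalues.

Section Partitions.

Variable n : nat.
Hypothesis n_ge7 : (7 <= n)%N.

Lemma sorted_geq_nseq m x : sorted geq (nseq m x).
Proof. by case: m => //= m; elim: m => //= m ->; rewrite leqnn. Qed.

Lemma is_partn_std : is_partn n [:: n - 1; 1]%N.
Proof. by rewrite /is_partn /= !inE; lia. Qed.

Lemma is_partn_sgn : is_partn n (nseq n 1%N).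
Proof. by rewrite /is_partn sorted_geq_nseq mem_nseq sumn_nseq mul1n eqxx andbF. Qed.

Lemma is_partn_ss : is_partn n (2 :: nseq (n - 2) 1)%N.
Proof.
rewrite /is_partn inE mem_nseq /= sumn_nseq mul1n andbF.
apply/andP; split; last by lia.
by case: (n - 2)%N => //= m; apply: (sorted_geq_nseq m.+1 1).
Qed.

Lemma attained_std (I : {set 'I_n.+1}) : attained_by I (cycle_eig I (std0 n)) [:: n - 1; 1]%N.
Proof. by exists (Sub _ is_partn_std) => //; rewrite /eig_of (specht_std n_ge7). Qed.

Lemma attained_sgn (I : {set 'I_n.+1}) : attained_by I (cycle_eig I (sgn0 n)) (nseq n 1%N).
Proof. by exists (Sub _ is_partn_sgn) => //; rewrite /eig_of specht_sgn. Qed.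

Lemma attained_ss (I : {set 'I_n.+1}) :
  attained_by I (cycle_eig I (ss0 n)) (2 :: nseq (n - 2) 1)%N.
Proof. by exists (Sub _ is_partn_ss) => //; rewrite /eig_of (specht_ss n_ge7). Qed.

End Partitions.

Lemma sum_two_three n (F : nat -> nat) (P : pred nat) : (3 <= n)%N ->
  (\sum_(k in [set k : 'I_n.+1 | (k == 2 :> nat) || (k == 3 :> nat)] | P k) F k
   = (if P 2 then F 2 else 0) + (if P 3 then F 3 else 0))%N.
Proof.
move=> n3; have l2 : (2 < n.+1)%N by lia.
have l3 : (3 < n.+1)%N by lia.
rewrite big_mkcondr (bigD1 (Ordinal l2)) ?inE //= (bigD1 (Ordinal l3)) ?inE //=.
rewrite big_pred0 ?addn0 // => k; rewrite inE -!val_eqE /=.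
by case: (_ == 2)%N => //=; rewrite ?andbF //; case: (_ == 3)%N.
Qed.

Local Open Scope nat_scope.

Theorem theorem3p5 (n : nat) (I : {set 'I_n.+1}) (n_ge7 : 7 <= n)
    (I_neq0 : I != set0) (I_range : forall k, k \in I -> 2 <= k <= n - 2) :
  [/\ (* (a) *)
      (forall k, k \in I -> odd k) ->
        n_comp (cayley (cycles I)) predT = 2 /\
        exists a : algC,
          [/\ strictly_second_largest (cayley (cycles I)) a,
              attained_by I a [:: n - 1; 1],
              attained_by I a (2 :: nseq (n - 2) 1) &
              eig_multiplicity (cayley (cycles I)) a = 2 * (n - 1) ^ 2],
      (* (b) *)
      let J : {set 'I_n.+1} := [set k : 'I_n.+1 | (k == 2 :> nat) || (k == 3 :> nat)] in
        connected_graph (cayley (cycles J)) /\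
        exists a : algC,
          [/\ strictly_second_largest (cayley (cycles J)) a,
              attained_by J a [:: n - 1; 1],
              attained_by J a (nseq n 1) &
              eig_multiplicity (cayley (cycles J)) a = (n - 1) ^ 2 + 1],
      (* (c) *)
      (exists2 k, k \in I & ~~ odd k) -> (exists2 k, k \in I & odd k) ->
      odd (\max_(k in I) k) -> 5 <= \max_(k in I) k ->
        connected_graph (cayley (cycles I)) /\
        exists a : algC,
          [/\ strictly_second_largest (cayley (cycles I)) a,
              attained_uniquely_by I a (nseq n 1) &
              eig_multiplicity (cayley (cycles I)) a = 1] &
      (* (d) *)
      ~~ odd (\max_(k in I) k) ->
        connected_graph (cayley (cycles I)) /\
        exists a : algC,
          [/\ strictly_second_largest (cayley (cycles I)) a,
              attained_uniquely_by I a [:: n - 1; 1] &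
              eig_multiplicity (cayley (cycles I)) a = (n - 1) ^ 2]].
Proof.
have /and4P[_ u1 u2 _] := four_uniq n_ge7.
move: u1 u2; rewrite !inE negb_or => /andP[sgn_std sgn_ss] std_ss.
split.
- move=> oI; split; first exact: cycles_two_components.
  exists (cycle_eig I (std0 n)).
  have ss_std := cycle_eig_ss_odd n_ge7 I_range oI.
  have [||||||| ssl mult _] :=
    @second_largest_of n I n_ge7 I_range I_neq0 [:: std0 n; ss0 n] (std0 n) (cycle_eig I (std0 n)).
  + by rewrite /= inE std_ss.
  + by rewrite mem_head.
  + by move=> chi; rewrite !inE => /orP[]->; rewrite ?orbT.
  + exact: cycle_eig_std_lt.
  + exact: lexx.
  + by move=> chi; rewrite !inE => /orP[]/eqP->.
  + move=> chi; rewrite !inE => /orP[/eqP-> _|->//].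
    by right; apply: cycle_eig_sgn_odd.
  split=> //; first exact: attained_std.
    by rewrite -ss_std; apply: attained_ss.
  apply/eqP; rewrite -(eqr_nat algC) mult !big_cons big_nil std0_deg // ss0_deg //.
  by rewrite addr0 -mulr2n natrM natrX mulr_natl.
- set J := [set k : 'I_n.+1 | _].
  have J_range k : k \in J -> 2 <= k <= n - 2.
    by rewrite inE => /orP[]/eqP->; lia.
  have l2 : 2 < n.+1 by lia.
  have J2 : Ordinal l2 \in J by rewrite inE.
  have J_neq0 : J != set0 by apply/set0Pn; exists (Ordinal l2).
  split; first exact: (cycles_connected n_ge7 J_range J2).
  exists (cycle_eig J (std0 n)).
  (* Both sides of the numerical condition are n(n-1)^2: the moved points number n(n-1) +
     n(n-1)(n-2), and there are n(n-1)/2 transpositions. *)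
  have sgn_eq : cycle_eig J (sgn0 n) = cycle_eig J (std0 n).
    apply: (cycle_eig_sgn_eq_std n_ge7 J_range).
    have n3 : 3 <= n by lia.
    have := sum_two_three (fun k => ncyc n k * k) predT n3.
    rewrite -/J big_mkcondr /= => eK.
    have := sum_two_three (fun k => ncyc n k) (fun k => ~~ odd k) n3.
    rewrite -/J addn0 /moved_points /even_cycles => ->; rewrite eK.
    have e2 : ncyc n 2 * 2 = n ^_ 2 by apply: ncyc_ffact; lia.
    have e3 : ncyc n 3 * 3 = n ^_ 3 by apply: ncyc_ffact; lia.
    rewrite e3 ffactnSr -e2; have [m ->] : exists m, n = m.+2 by exists (n - 2); lia.
    by rewrite !subSS !subn0; move: (ncyc _ 2) => x; nia.
  have [||||||| ssl mult _] :=
    @second_largest_of n J n_ge7 J_range J_neq0 [:: std0 n; sgn0 n] (std0 n) (cycle_eig J (std0 n)).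
  + by rewrite /= inE eq_sym sgn_std.
  + by rewrite mem_head.
  + by move=> chi; rewrite !inE => /orP[]->; rewrite ?orbT.
  + exact: cycle_eig_std_lt.
  + exact: lexx.
  + by move=> chi; rewrite !inE => /orP[]/eqP->.
  + move=> chi; rewrite !inE => /or3P[->|->|/eqP-> _]; rewrite ?orbT //.
    by left; apply: (cycle_eig_ss_lt n_ge7 J_range J2).
  split=> //; first exact: attained_std.
    by rewrite -sgn_eq; apply: attained_sgn.
  apply/eqP; rewrite -(eqr_nat algC) mult !big_cons big_nil std0_deg // sgn0_deg //.
  by rewrite addr0 expr1n natrD natrX.
- move=> [k kI ek] _ om m5; split; first exact: (cycles_connected n_ge7 I_range kI).
  exists (cycle_eig I (sgn0 n)).
  have lt : (cycle_eig I (std0 n) < cycle_eig I (sgn0 n))%R.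
    by rewrite cycle_eig_std_lt_sgn //; apply: odd_max_sum.
  have [||||||| ssl mult uni] :=
    @second_largest_of n I n_ge7 I_range I_neq0 [:: sgn0 n] (sgn0 n) (cycle_eig I (sgn0 n)).
  + by [].
  + by rewrite mem_head.
  + by move=> chi; rewrite !inE => ->.
  + exact: (cycle_eig_sgn_lt n_ge7 I_range kI).
  + exact: ltW.
  + by move=> chi; rewrite inE => /eqP->.
  + move=> chi; rewrite !inE => /or3P[->//|/eqP->|/eqP->] _; left=> //.
    exact: lt_trans (cycle_eig_ss_lt n_ge7 I_range kI ek) lt.
  split=> //.
    split; first exact: attained_sgn.
    move=> z /(uni _ (specht_irr z)); rewrite inE => /eqP; exact: specht_eq_sgn.
  apply/eqP; rewrite -(eqr_nat algC) mult !big_cons big_nil sgn0_deg //.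
  by rewrite addr0 expr1n.
- move=> em; have [m mI [eqm _]] := max_in_I I_neq0; rewrite eqm in em.
  split; first exact: (cycles_connected n_ge7 I_range mI).
  exists (cycle_eig I (std0 n)).
  have lt : (cycle_eig I (sgn0 n) < cycle_eig I (std0 n))%R.
    by rewrite cycle_eig_sgn_lt_std //; apply: even_max_sum => //; rewrite eqm.
  have [||||||| ssl mult uni] :=
    @second_largest_of n I n_ge7 I_range I_neq0 [:: std0 n] (std0 n) (cycle_eig I (std0 n)).
  + by [].
  + by rewrite mem_head.
  + by move=> chi; rewrite !inE => ->; rewrite orbT.
  + exact: cycle_eig_std_lt.
  + exact: lexx.
  + by move=> chi; rewrite inE => /eqP->.
  + move=> chi; rewrite !inE => /or3P[/eqP->|->//|/eqP->] _; left=> //.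
    exact: (cycle_eig_ss_lt n_ge7 I_range mI em).
  split=> //.
    split; first exact: attained_std.
    move=> z /(uni _ (specht_irr z)); rewrite inE => /eqP; exact: specht_eq_std.
  apply/eqP; rewrite -(eqr_nat algC) mult !big_cons big_nil std0_deg //.
  by rewrite addr0 natrX.
Qed.
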